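(* Let $u\in \mathrm{BV}(X)$ and let $\varepsilon>0$. Then there exists an open set $G\subset X$ with $\mathrm{Cap}_1(G)<\varepsilon$ such that if $y_k\to x$ with $y_k,x\in X\setminus G$, then \[ \min_{l_2\in\{1,\ldots,n\}}|u^{l_1}(y_k)-u^{l_2}(x)|\to 0 \] (as $k\to\infty$) for each $l_1=1,\ldots,n$.
   Context: Standing assumptions: $(X,d,\mu)$ is a complete metric space with a Borel regular outer measure $\mu$ that is doubling (there is $C_d\ge 1$ with $0<\mu(B(x,2r))\le C_d\,\mu(B(x,r))<\infty$ for all $x\in X$, $r>0$) and supports a $(1,1)$-Poincaré inequality: there are $C_P>0$, $\lambda\ge 1$ such that for every ball $B(x,r)$, every locally integrable $u$ on $X$ and every upper gradient $g$ of $u$, $\frac{1}{\mu(B(x,r))}\int_{B(x,r)}|u-u_{B(x,r)}|\,d\mu\le C_P\, r\,\frac{1}{\mu(B(x,\lambda r))}\int_{B(x,\lambda r)}g\,d\mu$, where $u_B=\frac1{\mu(B)}\int_B u\,d\mu$. A curve is a rectifiable continuous map from a compact interval into $X$, parametrized by arc length. A nonnegative Borel function $g$ is an upper gradient of an extended real-valued function $u$ if $|u(x)-u(y)|\le\int_\gamma g\,ds$ for all curves $\gamma$ with end points $x,y$ (with $|u(x)-u(y)|=\infty$ if at least one of the values is infinite). For $u\in L^1_{\mathrm{loc}}(X)$, $\|Du\|(X):=\inf\{\liminf_{i}\int_X g_{u_i}\,d\mu: u_i\in \mathrm{Lip}_{\mathrm{loc}}(X),\ u_i\to u \text{ in } L^1_{\mathrm{loc}}(X)\}$,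 each $g_{u_i}$ being an upper gradient of $u_i$; $\|Du\|(\Omega)$ for open $\Omega$ is defined by replacing $X$ by $\Omega$, and $\|Du\|(A):=\inf\{\|Du\|(U):U\supset A\text{ open}\}$ for arbitrary $A$. $\mathrm{BV}(X)$ is the set of $u\in L^1(X)$ with $\|Du\|(X)<\infty$. A measurable $E\subset X$ is of finite perimeter if $\|D\chi_E\|(X)<\infty$. Capacity: $\|u\|_{N^{1,1}(X)}:=\|u\|_{L^1(X)}+\inf_g\|g\|_{L^1(X)}$, inf over upper gradients $g$ of $u$; $N^{1,1}(X)$ is the set of functions with finite norm; $\mathrm{Cap}_1(A):=\inf\|u\|_{N^{1,1}(X)}$ over $u\in N^{1,1}(X)$ with $u\ge 1$ in a neighborhood of $A$. Codimension $1$ Hausdorff measure: $\mathcal H_R(A):=\inf\{\sum_i \mu(B(x_i,r_i))/r_i: A\subset\bigcup_i B(x_i,r_i),\ r_i\le R\}$, $\mathcal H(A):=\lim_{R\to0^+}\mathcal H_R(A)$. Measure theoretic boundary: $\partial^*E$ is the set of points at which both $E$ and $X\setminus E$ have positive upper density. The number $\gamma\in(0,1/2]$ is a fixed constant, depending only on $C_d,C_P,\lambda$, such that for every $E\subset X$ of finite perimeter and $\mathcal H$-a.e. $x\in\partial^*E$, $\gamma\le\liminf_{r\to0^+}\frac{\mu(E\cap B(x,r))}{\mu(B(x,r))}\le\limsup_{r\to0^+}\frac{\mu(E\cap B(x,r))}{\mu(B(x,r))}\le1-\gamma$ (such $\gamma$ is known to exist). Put $n:=\lfloor 1/\gamma\rfloor$.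 Approximate limits: $u^\wedge(x):=\sup\{t\in\overline{\mathbb R}:\lim_{r\to0^+}\frac{\mu(B(x,r)\cap\{u<t\})}{\mu(B(x,r))}=0\}$, $u^\vee(x):=\inf\{t\in\overline{\mathbb R}:\lim_{r\to0^+}\frac{\mu(B(x,r)\cap\{u>t\})}{\mu(B(x,r))}=0\}$. Jump values: $u^1:=u^\wedge$, $u^n:=u^\vee$, and inductively for $l=2,\ldots,n-1$, $u^l(x):=\sup\{t\in\overline{\mathbb R}:\lim_{r\to0^+}\frac{\mu(B(x,r)\cap\{u^{l-1}(x)+\delta<u<t\})}{\mu(B(x,r))}=0\ \ \forall\,\delta>0\}$ if $u^{l-1}(x)<u^\vee(x)$, and $u^l(x):=u^\vee(x)$ otherwise. *)

(* Defs.v *)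
From HB Require Import structures.
From mathcomp Require Import all_boot all_order all_algebra.
From mathcomp Require Import all_classical all_reals all_analysis.
From mathcomp Require Import measurable_realfun.

Set Implicit Arguments.
Unset Strict Implicit.
Unset Printing Implicit Defensive.

Import Order.TTheory GRing.Theory Num.Theory.
Import numFieldNormedType.Exports.

Local Open Scope classical_set_scope.
Local Open Scope ring_scope.

#[short(type="completeMetricType")]
HB.structure Definition CompleteMetric (R : numDomainType) :=
  {T of CompletePseudoMetric R T & Metric R T}.

Section metric.
Context {R : realType} {X : completeMetricType R}.

Definition Borel : set (set X) := <<s open >>.

Definition curve_length (c : R -> X) (a b : R) : \bar R :=
  ereal_sup [set (\sum_(0 <= k < size s)
      mdist (c (nth b (a :: s) k)) (c (nth b (a :: s) k.+1)))%:E
    | s in [set s | itv_partition a b s]].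

(* A compact interval is nondegenerate: the length l is positive, so that
   constant curves are excluded. *)
Definition is_curve (c : R -> X) (l : R) : Prop :=
  [/\ 0 < l, {within `[0, l], continuous c} &
      forall s t, 0 <= s -> s <= t -> t <= l ->
        curve_length c s t = (t - s)%:E].

Definition curve_integral (g : X -> \bar R) (c : R -> X) (l : R) : \bar R :=
  (\int[lebesgue_measure]_(t in `[0%R, l]) g (c t))%E.

Definition Borel_fun (g : X -> \bar R) : Prop :=
  measurable_fun setT (g : g_sigma_algebraType (@open X) -> \bar R).

(* The library sets +oo - +oo = -oo and -oo - -oo = -oo, so that
   `|a - b| = +oo as soon as a or b is infinite. *)
Definition upper_gradient (u g : X -> \bar R) : Prop :=
  [/\ Borel_fun g, (forall x, (0 <= g x)%E) &
      forall (c : R -> X) (l : R), is_curve c l ->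
        (`|u (c 0%R) - u (c l)| <= curve_integral g c l)%E].

(* A property holds locally if it holds on every open set that is relatively
   compact. *)
Definition rel_compact_open (U : set X) : Prop :=
  open U /\ compact (closure U).

Definition Lip_loc (v : X -> R) : Prop :=
  forall U, rel_compact_open U -> exists L : R,
    forall x y, U x -> U y -> `|v x - v y| <= L * mdist x y.

End metric.

Section metric_measure.
Context {R : realType} {X : completeMetricType R}.
Variable mu : {outer_measure set X -> \bar R}.

Local Open Scope ereal_scope.

(* Measurability and integration with respect to the outer measure mu: X with
   its Caratheodory sigma-algebra. *)
Local Notation Xmu := (caratheodory_type mu).

Definition mu_measurable (E : set X) : Prop := measurable (E : set Xmu).

Definition mu_measurable_fun (D : set X) (u : X -> \bar R) : Prop :=
  measurable_fun (D : set Xmu) (u : Xmu -> \bar R).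

Definition mu_int (D : set X) (u : X -> \bar R) : \bar R :=
  \int[(mu : set Xmu -> \bar R)]_(x in (D : set Xmu)) (u : Xmu -> \bar R) x.

Definition L1 (D : set X) (u : X -> \bar R) : Prop :=
  integrable (mu : set Xmu -> \bar R) (D : set Xmu) (u : Xmu -> \bar R).

Definition L1_loc (u : X -> \bar R) : Prop :=
  forall U, rel_compact_open U -> L1 U u.

Definition mean (B : set X) (u : X -> \bar R) : \bar R := mu_int B u / mu B.

Definition Borel_regular : Prop :=
  (forall B, Borel B -> mu_measurable B) /\
  (forall A : set X, exists B, [/\ Borel B, A `<=` B & mu B = mu A]).

Definition doubling (Cd : R) : Prop :=
  forall (x : X) (r : R), (0 < r)%R ->
    [/\ 0 < mu (ball x (2 * r)%R),
        mu (ball x (2 * r)%R) <= Cd%:E * mu (ball x r) &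
        Cd%:E * mu (ball x r) < +oo].

Definition Poincare (CP lambda : R) : Prop :=
  forall (x : X) (r : R) (u g : X -> \bar R), (0 < r)%R ->
    L1_loc u -> upper_gradient u g ->
    mean (ball x r) (fun y => `|u y - mean (ball x r) u|) <=
      (CP * r)%:E * mean (ball x (lambda * r)%R) g.

(* ||Du||(X) *)
Definition total_variation (u : X -> \bar R) : \bar R :=
  ereal_inf [set a | exists (v : nat -> X -> R) (g : nat -> X -> \bar R),
    [/\ forall i, Lip_loc (v i),
        forall U, rel_compact_open U ->
          mu_int U (fun x => `|(v i x)%:E - u x|) @[i --> \oo] --> 0,
        forall i, upper_gradient (fun x => (v i x)%:E) (g i) &
        a = limn_einf (fun i => mu_int setT (g i))]].

Definition BV (u : X -> \bar R) : Prop := L1 setT u /\ total_variation u < +oo.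

Definition finite_perimeter (E : set X) : Prop :=
  mu_measurable E /\ total_variation (fun x => (\1_E x)%:E) < +oo.

Definition N11_norm (u : X -> \bar R) : \bar R :=
  mu_int setT (fun x => `|u x|) +
  ereal_inf [set mu_int setT g | g in [set g | upper_gradient u g]].

Definition N11 (u : X -> \bar R) : Prop :=
  mu_measurable_fun setT u /\ N11_norm u < +oo.

Definition Cap1 (A : set X) : \bar R :=
  ereal_inf [set N11_norm u
    | u in [set u | N11 u /\ set_nbhs A [set x | 1 <= u x]]].

(* Covers are indexed by a subset I of nat so that finite covers are allowed. *)
Definition codim1_content (rho : R) (A : set X) : \bar R :=
  ereal_inf [set a | exists (I : set nat) (x : nat -> X) (r : nat -> R),
    [/\ forall i, I i -> (0 < r i <= rho)%R,
        A `<=` \bigcup_(i in I) ball (x i) (r i) &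
        a = \esum_(i in I) (mu (ball (x i) (r i)) / (r i)%:E)]].

Definition codim1_Hausdorff (A : set X) : \bar R :=
  lim (codim1_content rho A @[rho --> 0^'+]).

Definition density_ratio (A : set X) (x : X) (r : R) : \bar R :=
  mu (A `&` ball x r) / mu (ball x r).

Definition lower_density (A : set X) (x : X) : \bar R :=
  limf_einf (density_ratio A x) 0^'+.

Definition upper_density (A : set X) (x : X) : \bar R :=
  limf_esup (density_ratio A x) 0^'+.

Definition zero_density (A : set X) (x : X) : Prop :=
  density_ratio A x r @[r --> 0^'+] --> 0.

Definition mt_boundary (E : set X) : set X :=
  [set x | 0 < upper_density E x /\ 0 < upper_density (~` E) x].

Definition boundary_density_bound (gamma : R) : Prop :=
  forall E : set X, finite_perimeter E ->
    codim1_Hausdorff [set x | mt_boundary E x /\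
      ~ [/\ gamma%:E <= lower_density E x,
            lower_density E x <= upper_density E x &
            upper_density E x <= (1 - gamma)%:E]] = 0.

Section jump_values.
Variable u : X -> \bar R.

Definition approx_liminf (x : X) : \bar R :=
  ereal_sup [set t | zero_density [set y | u y < t] x].

Definition approx_limsup (x : X) : \bar R :=
  ereal_inf [set t | zero_density [set y | t < u y] x].

(* u^l computed from the value w of u^(l-1) at x, for 2 <= l <= n - 1 *)
Definition next_jump_value (x : X) (w : \bar R) : \bar R :=
  if w < approx_limsup x then
    ereal_sup [set t | forall delta : R, (0 < delta)%R ->
                 zero_density [set y | w + delta%:E < u y < t] x]
  else approx_limsup x.

(* u^l for 1 <= l <= n, where n >= 2; the values for other l are junk *)
Definition jump_value (n l : nat) (x : X) : \bar R :=
  if l == n then approx_limsup x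
  else iter l.-1 (next_jump_value x) (approx_liminf x).

End jump_values.

End metric_measure.

(* Main.v *)
(** Call [v] an essential value of [u] at [x] if no set [{|u - v| < e}] has
    density zero at [x]. By the coarea formula the superlevel sets [{u > t}] have
    finite perimeter for a dense sequence of levels [t], and hence so do the slabs
    [{s < u <= t}] between two such levels. Off an exceptional set every slab has
    either density zero or lower density above [1 / (n + 1)] at [x]; disjoint
    slabs therefore leave room for at most [n] essential values, and the jump
    values [u^1, ..., u^n] enumerate these in increasing order.

    The heart of the matter is that, for [E] of finite perimeter, the set of
    points of density zero is quasi-open. On the points near which [E] is sparse at
    all small scales, approximants of [1_E] cannot concentrate a fixed share of
    their energy: otherwise cutting [E] off there would give functions still
    converging to [1_E], but with energy below the perimeter. Near such points
    the energy is thus as small as desired, and a boxing inequality (the relative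
    isoperimetric inequality and a Vitali covering) bounds the codimension 1
    content, and so the 1-capacity, of the points at which [E] is not sparse. The
    same boxing inequality and the coarea formula show that [u] is bounded off a
    set of small capacity.

    With one open set [G] of small capacity serving all slabs, a slab free of
    essential values at [x] stays so at the points of [X \ G] close to [x]; finitely
    many slabs cover the range of [u], so every essential value at [y_k] is close
    to one at [x]. *)

Require Import Defs.
From HB Require Import structures.
From mathcomp Require Import all_boot all_order all_algebra.
From mathcomp Require Import all_classical all_reals all_analysis.
From mathcomp Require Import measurable_realfun.
From mathcomp Require Import finmap ring lra.
Import Order.TTheory GRing.Theory Num.Theory.
Import numFieldNormedType.Exports.
Local Open Scope classical_set_scope.
Local Open Scope ring_scope.
Set Implicit Arguments.
Unset Strict Implicit.
Unset Printing Implicit Defensive.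

(** [total_variation] is an infimum over approximating sequences on the whole of [X], and no
    variation measure is built from it. Localization therefore takes place on the approximants:
    [TV_le] supplies them one ball and one tolerance at a time, and [TV_le_on] counts their energy
    on a set [W] only. What absolute continuity of a measure would give near sparse points comes
    instead from a competitor for the infimum. The coarea formula is likewise reduced to an
    inequality: variations of truncations to adjacent intervals are superadditive, so the variation
    as a function of the level is nondecreasing, and a level with a small difference quotient has a
    superlevel set of small perimeter by lower semicontinuity. Since [n] is the integer part of
    [1 / gamma], [1 / (n + 1) < gamma]; a density [c] strictly in between is at once guaranteed by
    the boundary density bound and too large for [n + 1] disjoint sets. Exceptional sets are
    measured by covers with balls of radius at most 1 ([cover_le]); these bounds add up countably
    and become a capacity bound only at the end. *)

Record PI_space (R : realType) (X : completeMetricType R)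
    (mu : {outer_measure set X -> \bar R}) (Cd CP lambda : R) : Prop := {
  PI_reg : Borel_regular mu ;
  PI_Cd_ge1 : 1 <= Cd ;
  PI_doubling : doubling mu Cd ;
  PI_CP_gt0 : 0 < CP ;
  PI_lambda_ge1 : 1 <= lambda ;
  PI_Poincare : Poincare mu CP lambda }.

(** * Metric measure spaces and integration *)

Section metric_facts.
Context {R : realType} {X : completeMetricType R}.
Implicit Types (x y z : X) (r s : R).

Lemma in_ball x r y : ball x r y <-> mdist x y < r.
Proof. by rewrite ballEmdist. Qed.

Lemma sub_ball x y r s : mdist x y + r <= s -> ball y r `<=` ball x s.
Proof.
move=> h z /in_ball yz; apply/in_ball; apply: le_lt_trans (metric_triangle _ y _) _.
by apply: lt_le_trans h; rewrite ltrD2l.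
Qed.

Lemma sub_ball_center x r s : r <= s -> ball x r `<=` ball x s.
Proof. by move=> h; apply: sub_ball; rewrite mdistxx add0r. Qed.

Lemma open_ball x r : open (ball x r).
Proof.
rewrite openE => y /in_ball xy; apply/nbhs_ballP; exists (r - mdist x y) => /=.
  by rewrite subr_gt0.
by apply: sub_ball; rewrite addrC subrK.
Qed.

(* The witness is maximal among the disjoint subfamilies [G] such that every ball
   of [Y] meeting a ball of [G] meets one of at least half its radius. *)
Lemma vitali_covering (Y : set X) (rho : X -> R) (r0 : R) :
  (forall y, Y y -> 0 < rho y <= r0) ->
  exists D : set X, [/\ D `<=` Y, trivIset D (fun y => ball y (rho y)) &
    forall y, Y y -> exists2 z, D z & ball y (rho y) `<=` ball z (5 * rho z)].
Proof.
move=> Yrho; pose B y := ball y (rho y).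
pose meet G y r := exists z, [/\ G z, B y `&` B z !=set0 & r <= rho z].
pose P (G : set X) := [/\ G `<=` Y, trivIset G B &
  forall y, Y y -> (exists2 z, G z & B y `&` B z !=set0) -> meet G y (rho y / 2)].
have [F FP Ftot|D [[DY Dtriv Dmeet] Dmax]] := @Zorn_bigcup X P.
  split.
  - by move=> y [G /FP[GY _ _] /GY].
  - move=> y z [G1 FG1 G1y] [G2 FG2 G2z] yz.
    have [G12|G21] := Ftot _ _ FG1 FG2.
      by have [_ t _] := FP _ FG2; apply: t => //; exact: G12.
    by have [_ t _] := FP _ FG1; apply: t => //; exact: G21.
  - move=> y Yy [z [G FG Gz] yz]; have [_ _ /(_ _ Yy)] := FP _ FG.
    case=> [|w [Gw yw rw]]; first by exists z.
    by exists w; split=> //; exists G.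
exists D; split=> // y Yy.
suff [z [Dz [w [/in_ball yw /in_ball zw]] rz]] : meet D y (rho y / 2).
  exists z => //; apply: sub_ball; have := metric_triangle z w y.
  rewrite (metric_sym w y); have /andP[] := Yrho _ Yy; have := Yrho _ (DY _ Dz).
  by move=> /andP[]; lra.
apply: contrapT => nmeet.
have nD z : Y z -> ~ meet D z (rho z / 2) -> forall w, D w -> B z `&` B w = set0.
  move=> Yz nz w Dw; apply: contrapT => /eqP/set0P h; apply: nz; apply: Dmeet => //.
  by exists w.
pose N := [set z | Y z /\ ~ meet D z (rho z / 2)].
have Ny : N y by [].
pose S := rho @` N.
have supS : has_sup S.
  split; first by exists (rho y), y.
  by exists r0 => _ [z [Yz _] <-]; have /andP[] := Yrho _ Yz.
have supS0 : 0 < sup S.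
  have /andP[h _] := Yrho _ Yy; apply: lt_le_trans h _.
  by apply: sup_upper_bound => //; exists y.
(* A ball of [N] with more than half the supremal radius: adding it to [D] preserves [P], which
   contradicts maximality. *)
have [_ [z [Yz nz] <-] zS] := sup_adherent (divr_gt0 supS0 (@ltr0n R 2)) supS.
have Ule w : N w -> rho w <= sup S.
  by move=> Nw; apply: sup_upper_bound => //; exists w.
have Dz := nD _ Yz nz.
have rz : 0 < rho z by have /andP[] := Yrho _ Yz.
have Bzz : B z z by exact: ballxx.
apply: (Dmax (D `|` [set z])).
  split; first by move=> w Dw; left.
  move=> /(_ z (or_intror erefl)) Dz'.
  by have := Dz _ Dz'; rewrite setIid => B0; move: Bzz; rewrite B0.
split.
- by move=> w [/DY//|->].
- move=> v w [Dv|->] [Dw|->] //; first exact: Dtriv.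
    by rewrite setIC (Dz _ Dv) => -[].
  by rewrite (Dz _ Dw) => -[].
- move=> v Yv [w [Dw|->]] vw.
    have [t [Dt vt rt]] := Dmeet _ Yv (ex_intro2 _ _ w Dw vw).
    by exists t; split=> //; left.
  have [[t [Dt vt rt]]|nv] := pselect (meet D v (rho v / 2)).
    by exists t; split=> //; left.
  exists z; split=> //; first by right.
  have := Ule v (conj Yv nv); lra.
Qed.

End metric_facts.

Section borel.
Context {R : realType} {X : completeMetricType R}.

Lemma Borel_open (A : set X) : open A -> Borel A.
Proof. exact: sub_gen_smallest. Qed.

End borel.

Section measure_facts.
Context {R : realType} {X : completeMetricType R}.
Context (mu : {outer_measure set X -> \bar R}) (Cd CP lambda : R).
Hypothesis H : PI_space mu Cd CP lambda.
Implicit Types (x y z : X) (r s : R) (A B E : set X).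
Local Open Scope ereal_scope.

Lemma measurable_Borel A : Borel A -> mu_measurable mu A.
Proof. exact: (PI_reg H).1. Qed.

Lemma measurable_openX A : open A -> mu_measurable mu A.
Proof. by move=> /Borel_open/measurable_Borel. Qed.

Lemma measurable_ball x r : mu_measurable mu (ball x r).
Proof. apply: measurable_openX; exact: open_ball. Qed.

Lemma mu_ball_fin x r : mu (ball x r) < +oo.
Proof.
have [r0|r0] := ltP 0%R r; last first.
  have -> : ball x r = set0 by apply/seteqP; split=> // y /in_ball; have := mdist_ge0 x y; lra.
  by rewrite outer_measure0.
have [_ h1 h2] := PI_doubling H x r0.
have := le_lt_trans h1 h2; apply: le_lt_trans; apply: le_outer_measure.
by apply: sub_ball_center; lra.
Qed.

Lemma mu_ball_gt0 x r : (0 < r)%R -> 0 < mu (ball x r).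
Proof.
move=> r0; have [] := PI_doubling H x (divr_gt0 r0 (@ltr0n R 2)).
by rewrite mulrC divfK.
Qed.

Lemma mu_ball_fin_num x r : mu (ball x r) \is a fin_num.
Proof. by rewrite ge0_fin_numE ?outer_measure_ge0// mu_ball_fin. Qed.

Lemma mu_bounded_fin A x r : A `<=` ball x r -> mu A < +oo.
Proof. by move=> /(le_outer_measure mu)/le_lt_trans; apply; exact: mu_ball_fin. Qed.

Lemma doubling_iter n x r : (0 < r)%R ->
  mu (ball x (2 ^+ n * r)%R) <= (Cd ^+ n)%:E * mu (ball x r).
Proof.
move=> r0; elim: n => [|n IH]; first by rewrite !expr0 mul1r mul1e.
rewrite exprS -mulrA.
have p0 : (0 < 2 ^+ n * r)%R by rewrite mulr_gt0// exprn_gt0.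
have [_ h _] := PI_doubling H x p0; apply: le_trans h _.
rewrite exprS EFinM -muleA lee_pmul2l// ?lte_fin.
by have := PI_Cd_ge1 H; lra.
Qed.

(** Both [s] and the distance of the centres are at most [K * r], so [ball z s] lies in
    [ball x (2 * K * r)], which finitely many doublings of [r] cover. *)
Lemma doubling_compare (K : R) : exists2 C : R, (0 < C)%R &
  forall x z r s, (0 < r)%R -> (s <= K * r)%R -> (mdist x z <= K * r)%R ->
    mu (ball z s) <= C%:E * mu (ball x r).
Proof.
exists (Cd ^+ (Num.Def.archi_bound (2 * K)))%R.
  by rewrite exprn_gt0//; have := PI_Cd_ge1 H; lra.
move=> x z r s r0 sK xz; apply: le_trans (doubling_iter _ _ r0).
apply: le_outer_measure; apply: sub_ball.
have h : (2 * K < 2 ^+ (Num.Def.archi_bound (2 * K)))%R by exact: upper_nthrootP.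
apply: (@le_trans _ _ (2 * K * r)%R); first lra.
by rewrite ler_wpM2r// ltW.
Qed.

End measure_facts.

Section integral_facts.
Context {R : realType} {X : completeMetricType R}.
Context (mu : {outer_measure set X -> \bar R}).
Implicit Types (x y z : X) (A B D E : set X) (f g h : X -> \bar R).
Local Open Scope ereal_scope.
Local Notation Xmu := (caratheodory_type mu).
Local Notation int := (mu_int mu).
Local Notation meas := (mu_measurable mu).

Definition ge0_measurable f :=
  (forall x, 0 <= f x) /\ mu_measurable_fun mu setT f.

Lemma measT : meas setT.
Proof. exact: (@measurableT _ Xmu). Qed.
Lemma meas0 : meas set0.
Proof. exact: (@measurable0 _ Xmu). Qed.
Lemma measI A B : meas A -> meas B -> meas (A `&` B).
Proof. exact: (@measurableI _ Xmu). Qed.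
Lemma measU A B : meas A -> meas B -> meas (A `|` B).
Proof. exact: (@measurableU _ Xmu). Qed.
Lemma measD A B : meas A -> meas B -> meas (A `\` B).
Proof. exact: (@measurableD _ Xmu). Qed.
Lemma measC A : meas A -> meas (~` A).
Proof. exact: (@measurableC _ Xmu). Qed.
Lemma meas_bigcup (F : nat -> set X) : (forall i, meas (F i)) -> meas (\bigcup_i F i).
Proof. by move=> h; apply: (@bigcupT_measurable _ Xmu). Qed.

Lemma measurable_funT D f : meas D ->
  mu_measurable_fun mu setT f -> mu_measurable_fun mu D f.
Proof. by move=> mD mf; apply: (@measurable_funS _ _ Xmu _ setT D f). Qed.

Lemma ge0_measurable_cst (c : \bar R) : 0 <= c -> ge0_measurable (cst c).
Proof. by move=> c0; split=> //; exact: (@measurable_cst _ _ Xmu). Qed.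

Lemma ge0_measurableD f g : ge0_measurable f -> ge0_measurable g ->
  ge0_measurable (fun x => f x + g x).
Proof.
move=> [f0 mf] [g0 mg]; split; first by move=> x; exact: adde_ge0.
exact: (@emeasurable_funD _ Xmu _ setT).
Qed.

Lemma ge0_measurableZ (k : R) f : (0 <= k)%R -> ge0_measurable f ->
  ge0_measurable (fun x => k%:E * f x).
Proof.
move=> k0 [f0 mf]; split; first by move=> x; exact: mule_ge0.
exact: (@measurable_funeM _ Xmu _ setT).
Qed.

Lemma ge0_measurable_restrict A f : meas A -> ge0_measurable f ->
  ge0_measurable (f \_ A).
Proof.
move=> mA [f0 mf]; split; first by move=> x; rewrite patchE; case: ifP.
by apply/(@measurable_restrictT _ _ Xmu _ A f mA); exact: measurable_funT.
Qed.

Lemma ge0_measurable_indic A : meas A -> ge0_measurable (fun x => (\1_A x)%:E).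
Proof.
move=> mA; split; first by move=> x; rewrite lee_fin indicE.
by apply/(@measurable_EFinP _ Xmu); exact: (@measurable_indic _ Xmu).
Qed.

Lemma ge0_measurable_abse f : mu_measurable_fun mu setT f ->
  ge0_measurable (fun x => `|f x|).
Proof.
by move=> mf; split=> //; exact: (measurableT_comp (@abse_measurable R setT) mf).
Qed.

Lemma int_ge0 D f : ge0_measurable f -> 0 <= int D f.
Proof. by move=> [f0 _]; apply: (@integral_ge0 _ Xmu). Qed.

Lemma int_le D f g : meas D -> ge0_measurable f -> ge0_measurable g ->
  (forall x, D x -> f x <= g x) -> int D f <= int D g.
Proof.
move=> mD [f0 mf] [g0 mg] fg; apply: (@ge0_le_integral _ Xmu) => //;
  exact: measurable_funT.
Qed.

Lemma int_eq D f g : (forall x, D x -> f x = g x) -> int D f = int D g.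
Proof. by move=> fg; apply: eq_integral => x /set_mem /fg. Qed.

Lemma int_subset A B f : meas A -> meas B -> ge0_measurable f -> A `<=` B ->
  int A f <= int B f.
Proof.
move=> mA mB [f0 mf] AB; apply: (@ge0_subset_integral _ Xmu) => //.
exact: measurable_funT.
Qed.

Lemma intD D f g : meas D -> ge0_measurable f -> ge0_measurable g ->
  int D (fun x => f x + g x) = int D f + int D g.
Proof.
move=> mD [f0 mf] [g0 mg]; apply: (@ge0_integralD _ Xmu) => //;
  exact: measurable_funT.
Qed.

Lemma intZ (k : R) D f : meas D -> (0 <= k)%R -> ge0_measurable f ->
  int D (fun x => k%:E * f x) = k%:E * int D f.
Proof.
move=> mD k0 [f0 mf]; apply: (@ge0_integralZl _ Xmu) => //; exact: measurable_funT.
Qed.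

Lemma int_restrict D A f : int D (f \_ A) = int (D `&` A) f.
Proof. by rewrite /mu_int (@integral_mkcondr _ Xmu). Qed.

Lemma int_indic D A : meas D -> meas A -> int D (fun x => (\1_A x)%:E) = mu (A `&` D).
Proof. by move=> mD mA; rewrite /mu_int (@integral_indic _ Xmu). Qed.

Lemma int_cst D (c : \bar R) : meas D -> int D (cst c) = c * mu D.
Proof. by move=> mD; rewrite /mu_int (@integral_cst _ Xmu). Qed.

Lemma int_setUD A B f : meas A -> meas B -> ge0_measurable f ->
  A `&` B = set0 -> int (A `|` B) f = int A f + int B f.
Proof.
move=> mA mB [f0 mf] AB; apply: (@ge0_integral_setU _ Xmu) => //.
  by apply: measurable_funT => //; exact: measU.
by apply/disj_set2P.
Qed.

Lemma int_disjoint_sum (T : choiceType) (s : seq T) (B : T -> set X) W f :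
  uniq s -> meas W -> (forall i, meas (B i)) -> trivIset [set` s] B ->
  (forall i, i \in s -> B i `<=` W) -> ge0_measurable f ->
  \sum_(i <- s) int (B i) f <= int W f.
Proof.
move=> us mW mB tB BW [f0 mf].
rewrite -(@ge0_integral_bigsetU _ Xmu _ _ _ B f) //.
- apply: int_subset => //; first by apply: (@bigsetU_measurable _ Xmu) => i _; exact: mB.
  by rewrite -bigcup_seq => x [i /= si]; exact: BW.
- apply: measurable_funT => //; apply: (@bigsetU_measurable _ Xmu) => i _; exact: mB.
Qed.

Lemma mu_disjoint_sum (T : choiceType) (s : seq T) (B : T -> set X) W :
  uniq s -> meas W -> (forall i, meas (B i)) -> trivIset [set` s] B ->
  (forall i, i \in s -> B i `<=` W) -> \sum_(i <- s) mu (B i) <= mu W.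
Proof.
move=> us mW mB tB BW.
have muE A : meas A -> mu A = int A (cst 1) by move=> mA; rewrite int_cst// mul1e.
rewrite muE//; under eq_bigr => i _ do rewrite muE//.
by apply: int_disjoint_sum => //; exact: ge0_measurable_cst.
Qed.

Lemma int_nneseries D (f : nat -> X -> \bar R) : meas D ->
  (forall n, ge0_measurable (f n)) ->
  int D (fun x => \sum_(n <oo) f n x) = \sum_(n <oo) int D (f n).
Proof.
move=> mD hf; apply: (@integral_nneseries _ Xmu) => //.
- by move=> n; apply: measurable_funT => //; case: (hf n).
- by move=> n x _; case: (hf n).
Qed.

Lemma int_Borel f : (forall B, Borel B -> meas B) -> Borel_fun f ->
  mu_measurable_fun mu setT f.
Proof.
move=> hB mf mT Y mY; rewrite setTI; apply: hB.
by have := mf measurableT _ mY; rewrite setTI.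
Qed.

End integral_facts.

(** * Properness: balls are relatively compact *)

Section properness.
Context {R : realType} {X : completeMetricType R}.
Context (mu : {outer_measure set X -> \bar R}) (Cd CP lambda : R).
Hypothesis H : PI_space mu Cd CP lambda.
Implicit Types (x y z : X) (r s : R) (A B E : set X).

(** Volume counting: the disjoint balls lie in one ball [W] around [z], whose measure is at most [C]
    times that of each of them. Passing from [K] to [|K| + 1] makes room for the radius [rho] and
    keeps the radius of [W] positive. *)
Lemma separated_size (K : R) : exists N : nat, forall z rho (s : seq X),
  0 < rho -> uniq s -> trivIset [set` s] (fun y => ball y rho) ->
  (forall y, y \in s -> mdist z y <= K * rho) -> (size s <= N)%N.
Proof.
pose K' := `|K| + 1; have [C C0 hC] := doubling_compare H K'.
exists (Num.truncn C) => z rho s rho0 us tD sz; rewrite leqNgt; apply/negP => nB.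
pose W := ball z (K' * rho).
have KK : K * rho + rho <= K' * rho.
  by rewrite /K' mulrDl mul1r lerD2r ler_wpM2r ?ler_norm// ltW.
have Wle y : y \in s -> (mu W <= C%:E * mu (ball y rho))%E.
  move=> /sz ys; apply: hC => //; rewrite metric_sym; apply: le_trans ys _.
  by apply: le_trans KK; rewrite lerDl ltW.
pose w := fine (mu W).
have wE : mu W = w%:E by rewrite fineK// (mu_ball_fin_num H).
have w0 : 0 < w.
  by rewrite -lte_fin -wE (mu_ball_gt0 H)// mulr_gt0// ltr_wpDl.
have : (\sum_(y <- s) mu (ball y rho) <= mu W)%E.
  apply: mu_disjoint_sum => //.
  - exact: (measurable_ball H).
  - by move=> y; exact: (measurable_ball H).
  - by move=> y /sz ys; apply: sub_ball; apply: le_trans KK; rewrite lerD2r.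
apply/negP; rewrite -ltNge.
apply: (@lt_le_trans _ _ (\sum_(y <- s) (w / C)%:E)%E).
  rewrite sumEFin big_const_seq count_predT iter_addr_0 wE lte_fin -mulr_natr.
  rewrite mulrAC -mulrA ltr_pMr// ltr_pdivlMr// mul1r.
  by apply: lt_le_trans (truncnS_gt _) _; rewrite ler_nat.
rewrite big_seq [leRHS]big_seq; apply: lee_sum => y /Wle.
rewrite wE -(fineK (mu_ball_fin_num H y rho)) -EFinM !lee_fin.
by rewrite ler_pdivrMr// mulrC.
Qed.

Lemma separated_finite (D : set X) x r rho : D `<=` ball x r -> 0 < rho ->
  trivIset D (fun y => ball y rho) -> finite_set D.
Proof.
move=> Dx rho0 tD; apply: contrapT => infD.
have [N hN] := separated_size (r / rho).
have [B BD nB] := infinite_set_fset N.+1 infD.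
have := hN x rho (enum_fset B) rho0 (fset_uniq B) (sub_trivIset BD tD).
rewrite leqNgt nB => /(_ _)/negP; apply=> // y yB.
by rewrite divfK ?gt_eqF//; apply/ltW/in_ball/Dx/BD.
Qed.

Lemma ball_totally_bounded x r e : 0 < e ->
  exists D : set X, [/\ finite_set D, D `<=` ball x r &
    ball x r `<=` \bigcup_(y in D) ball y e].
Proof.
move=> e0; have e5 : 0 < e / 5 by lra.
have [|D [DY tD covD]] := @vitali_covering R X (ball x r) (fun=> e / 5) (e / 5).
  by move=> y _; rewrite e5 lexx.
exists D; split=> //; first exact: (separated_finite DY e5 tD).
move=> y /covD[z Dz yz]; exists z => //.
have -> : e = 5 * (e / 5) by lra.
by apply: yz; exact: ballxx.
Qed.

(** By total boundedness an ultrafilter on the closure contains a ball of every radius, so it is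
    Cauchy and completeness gives its limit. *)
Lemma compact_closure_ball x r : compact (closure (ball x r)).
Proof.
rewrite compact_ultra => F UF Fcl.
have Fball : F (ball x (r + 1)).
  apply: filterS Fcl => y /(_ (ball y 1)) [].
    by apply: nbhsx_ballx.
  move=> z [/in_ball xz /in_ball yz]; apply/in_ball.
  by have := metric_triangle x z y; rewrite (metric_sym z y); lra.
have small e : 0 < e -> exists y, F (ball y e).
  move=> e0; have [D [finD _ covD]] := ball_totally_bounded x (r + 1) e0.
  apply: contrapT => nF.
  have : F (\bigcap_(i in [set` fset_set D]) ~` ball i e).
    apply: filter_bigI => i _; have [Fi|//] := in_ultra_setVsetC (ball i e) UF.
    by exfalso; apply: nF; exists i.
  move=> /(filterI Fball) /filter_ex[y [/covD[z Dz zy]]].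
  by move=> /(_ z); rewrite /= in_fset_set// => /(_ (mem_set Dz)).
have Fcvg : cvg F.
  apply: cauchy_cvg; apply/cauchy_ballP => e e0.
  have [y Fy] := small _ (divr_gt0 e0 (@ltr0n R 2)).
  exists (ball y (e / 2), ball y (e / 2)) => //= -[a b] /= [/in_ball ya /in_ball yb].
  apply/in_ball; have := metric_triangle a y b; rewrite (metric_sym a y); lra.
exists (lim F); split=> //.
move=> N nN; have /(filterI Fcl) /filter_ex[y [cy Ny]] : F (interior N).
  by apply: Fcvg; exact: nbhs_interior.
by have [z [xz Nz]] := cy _ Ny; exists z.
Qed.

Lemma ball_rel_compact_open x r : rel_compact_open (ball x r).
Proof. split; [exact: open_ball | exact: compact_closure_ball]. Qed.

Lemma rel_compact_sub_ball (U : set X) x : rel_compact_open U ->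
  exists2 r, 0 < r & U `<=` ball x r.
Proof.
move=> [_ cU]; pose f (i : nat) := ball x i%:R.
move: cU; rewrite compact_cover => /(_ nat setT f).
case=> [i _|y _|D _ covD]; first exact: open_ball.
  exists (Num.truncn (mdist x y)).+1 => //; apply/in_ball; exact: truncnS_gt.
exists (\sum_(i <- enum_fset D) i)%N.+1%:R; first by rewrite ltr0n.
move=> y /subset_closure/covD[i /= iD]; apply: sub_ball_center.
rewrite ler_nat (big_rem i)//=; apply: leqW; exact: leq_addr.
Qed.

(** [Lip_loc] speaks of relatively compact open sets; properness makes the unit ball around [x] one
    of them. *)
Lemma Lip_loc_continuous (v : X -> R) : Lip_loc v -> continuous v.
Proof.
move=> lv x; have [L hL] := lv _ (ball_rel_compact_open x 1).
apply/cvgrPdist_le => /= e e0.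
pose d := Num.min 1 (e / (`|L| + 1)).
have d0 : 0 < d by rewrite lt_min ltr01 divr_gt0//; have := normr_ge0 L; lra.
apply/nbhs_ballP; exists d => // y /in_ball xy.
have x1 : ball x 1 x by exact: ballxx.
have y1 : ball x 1 y by apply/in_ball; apply: lt_le_trans xy _; rewrite ge_min lexx.
apply: le_trans (hL _ _ x1 y1) _.
have : mdist x y <= e / (`|L| + 1).
  by apply/ltW/(lt_le_trans xy); rewrite ge_min lexx orbT.
rewrite ler_pdivlMr; last by have := normr_ge0 L; lra.
have := ler_norm L; have := mdist_ge0 x y; nra.
Qed.

Lemma Lipschitz_Lip_loc (v : X -> R) (L : R) :
  (forall x y, `|v x - v y| <= L * mdist x y) -> Lip_loc v.
Proof. by move=> h U _; exists L => x y _ _; exact: h. Qed.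

Lemma Lip_loc_comp2 (v w : X -> R) (f : R -> R -> R) (L : R) : 0 <= L ->
  (forall a b c d, `|f a b - f c d| <= L * (`|a - c| + `|b - d|)) ->
  Lip_loc v -> Lip_loc w -> Lip_loc (fun x => f (v x) (w x)).
Proof.
move=> L0 hf lv lw U rU; have [K hK] := lv _ rU; have [M hM] := lw _ rU.
exists (L * (K + M)) => x y Ux Uy; apply: le_trans (hf _ _ _ _) _.
by rewrite -mulrA ler_wpM2l// mulrDl lerD// ?hK ?hM.
Qed.

End properness.

Section Borel_functions.
Context {R : realType} {X : completeMetricType R}.
Local Notation XB := (g_sigma_algebraType (@open X)).

Lemma lsc_Borel_fun (f : X -> \bar R) :
  (forall a : R, open [set x | (a%:E < f x)%E]) -> Borel_fun f.
Proof.
move=> of_; apply: (measurability _ (ErealGenOInfty.measurableE R)).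
move=> /= _ [_ [a ->]] <-; rewrite setTI; apply: sub_gen_smallest.
by rewrite preimage_itvoy; exact: of_.
Qed.

Lemma continuous_open_gt (v : X -> R) (a : R) : continuous v ->
  open [set x | a < v x].
Proof. by move=> /continuousP cv; exact: (cv _ (@open_gt _ a)). Qed.

Lemma continuous_Borel_fun (v : X -> R) : continuous v -> Borel_fun (EFin \o v).
Proof.
move=> cv; apply: lsc_Borel_fun => a.
suff -> : [set x | (a%:E < (EFin \o v) x)%E] = [set x | a < v x].
  exact: continuous_open_gt.
by apply/seteqP; split=> x /=; rewrite lte_fin.
Qed.

Lemma Borel_fun_restrict (g : X -> \bar R) (U : set X) : open U ->
  Borel_fun g -> Borel_fun (g \_ U).
Proof.
move=> oU mg; have mU : measurable (U : set XB) by exact: sub_gen_smallest.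
by apply/(measurable_restrictT _ mU); apply: measurable_funS mg.
Qed.

End Borel_functions.

(** * Curves and upper gradients *)

Section real_line.
Context {R : realType}.
Local Open Scope ereal_scope.
Local Notation leb := lebesgue_measure.

Definition translate (a : R) (t : measurableTypeR R) : measurableTypeR R := (a + t)%R.

Lemma measurable_translate (a : R) : measurable_fun setT (translate a).
Proof. by apply: measurable_funD => //; exact: measurable_cst. Qed.

HB.instance Definition _ (a : R) := isMeasurableFun.Build _ _
  (measurableTypeR R) (measurableTypeR R) (translate a) (measurable_translate a).

(** Translation invariance allows a piece of a curve to be reparametrized so as to start at time
    0. *)
Lemma lebesgue_measure_translate (a : R) (A : set R) : measurable A ->
  pushforward leb (translate a) A = leb A.
Proof.
move=> mA; apply/esym/lebesgue_measure_unique => //= _ [[b c] _ <-].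
rewrite /pushforward /=.
have -> : translate a @^-1` `]b, c] = `](b - a)%R, (c - a)%R]%classic.
  by apply/seteqP; split=> t /=; rewrite /translate !in_itv/= => /andP[h1 h2];
    apply/andP; split; lra.
by rewrite !lebesgue_measure_itv/= !lte_fin ltrD2r -!EFinB opprB addrA subrK.
Qed.

Lemma integral_translate (f : R -> \bar R) (a b c : R) :
  measurable_fun `[(a + b)%R, (a + c)%R] f ->
  (forall t, 0 <= f t) ->
  \int[leb]_(t in `[b, c]) f (a + t)%R = \int[leb]_(t in `[(a + b)%R, (a + c)%R]) f t.
Proof.
move=> mf f0.
have -> : \int[leb]_(t in `[(a + b)%R, (a + c)%R]) f t =
    \int[pushforward leb (translate a)]_(t in `[(a + b)%R, (a + c)%R]) f t.
  by apply: eq_measure_integral => A mA _; exact/esym/lebesgue_measure_translate.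
rewrite ge0_integral_pushforward//; congr (integral _ _ _).
by apply/seteqP; split=> t /=; rewrite /translate !in_itv/= !lerD2l.
Qed.

End real_line.

Section zeros.
Context {R : realType}.
Implicit Types (F : R -> R) (a b t : R).

Lemma within_itv_gt0 F a b t : {within `[a, b], continuous F} ->
  a <= t <= b -> 0 < F t ->
  exists2 d, 0 < d & forall s, a <= s <= b -> `|t - s| < d -> 0 < F s.
Proof.
move=> /subspace_continuousP cF tab Ft.
have := cF t; rewrite /= in_itv/= => /(_ tab) /cvgrPdist_lt/(_ _ Ft).
rewrite /prop_near1/= nbhs_filterE /within /= => -[d /= d0 hd].
exists d => // s sab ts; have := hd s ts; rewrite /= in_itv/= => /(_ sab).
by have := ler_norm (F t - F s); lra.
Qed.

(** The infimum of the times with [F <= 0] is itself such a time by continuity. Along a curve it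
    locates the first exit from the set where a function is positive. *)
Lemma first_nonpos F a b t0 : {within `[a, b], continuous F} ->
  a <= t0 <= b -> F t0 <= 0 ->
  exists t, [/\ a <= t <= t0, F t <= 0 & forall s, a <= s < t -> 0 < F s].
Proof.
move=> cF t0ab Ft0; pose S := [set t | a <= t <= b /\ F t <= 0].
have infS : has_inf S by split; [exists t0 | exists a => t [/andP[]]].
have lbS t : S t -> inf S <= t by move=> St; apply: inf_lbound => //; case: infS.
have aS : a <= inf S by apply: lb_le_inf; [exists t0 | move=> t [/andP[]]].
exists (inf S); split.
- by rewrite aS lbS.
- rewrite leNgt; apply/negP => h.
  have Sab : a <= inf S <= b by rewrite aS (le_trans (lbS _ (conj t0ab Ft0)))//; case/andP: t0ab.
  have [d d0 hd] := within_itv_gt0 cF Sab h.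
  have [s [sab Fs] sd] := inf_adherent d0 infS.
  have := hd _ sab; have := lbS _ (conj sab Fs); move=> h1 h2.
  have : 0 < F s by apply: h2; rewrite ler0_norm; lra.
  by lra.
- move=> s /andP[sa sS]; rewrite ltNge; apply/negP => Fs.
  have : inf S <= s.
    apply: (lbS); split=> //; rewrite sa /=; have := lbS _ (conj t0ab Ft0).
    by case/andP: t0ab; lra.
  by lra.
Qed.

Lemma last_nonpos F a b t0 : {within `[a, b], continuous F} ->
  a <= t0 <= b -> F t0 <= 0 ->
  exists t, [/\ t0 <= t <= b, F t <= 0 & forall s, t < s <= b -> 0 < F s].
Proof.
move=> cF t0ab Ft0; pose S := [set t | a <= t <= b /\ F t <= 0].
have supS : has_sup S by split; [exists t0 | exists b => t [/andP[]]].
have ubS t : S t -> t <= sup S by move=> St; apply: sup_ubound => //; case: supS.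
have Sb : sup S <= b by apply: ge_sup; [exists t0 | move=> t [/andP[]]].
exists (sup S); split.
- by rewrite Sb ubS.
- rewrite leNgt; apply/negP => h.
  have Sab : a <= sup S <= b.
    by rewrite Sb (le_trans _ (ubS _ (conj t0ab Ft0)))//; case/andP: t0ab.
  have [d d0 hd] := within_itv_gt0 cF Sab h.
  have [s [sab Fs] sd] := sup_adherent d0 supS.
  have := hd _ sab; have := ubS _ (conj sab Fs); move=> h1 h2.
  have : 0 < F s by apply: h2; rewrite ger0_norm; lra.
  by lra.
- move=> s /andP[sa sS]; rewrite ltNge; apply/negP => Fs.
  have : s <= sup S.
    apply: (ubS); split=> //; rewrite sS andbT; have := ubS _ (conj t0ab Ft0).
    by case/andP: t0ab; lra.
  by lra.
Qed.

End zeros.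

Section curves.
Context {R : realType} {X : completeMetricType R}.
Implicit Types (c : R -> X) (a b l s t : R) (f v : X -> R) (g : X -> \bar R).
Local Open Scope ereal_scope.

Lemma within_comp c a b v : {within `[a, b], continuous c} -> continuous v ->
  {within `[a, b], continuous (v \o c)}.
Proof.
move=> /subspace_continuousP cc cv; apply/subspace_continuousP => t tab.
exact: (cvg_comp _ _ (cc t tab) (cv (c t))).
Qed.

Lemma within_translate c a b l : {within `[0%R, l], continuous c} ->
  (0 <= a)%R -> (b <= l)%R ->
  {within `[0%R, (b - a)%R], continuous (fun t => c (a + t)%R)}.
Proof.
move=> /subspace_continuousP cc a0 bl; apply/subspace_continuousP => t.
rewrite /= in_itv/= => /andP[t0 tb].
have tab : `[0%R, l]%classic (a + t)%R by rewrite /= in_itv/=; apply/andP; split; lra.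
move=> U nU; have := cc _ tab U nU; rewrite /= !nbhs_filterE /within /= => hU.
have /nbhs_ballP[d d0 hd] := hU; apply/nbhs_ballP; exists d => // s ts.
rewrite /= in_itv/= => /andP[s0 sb]; apply: (hd (a + s)%R).
  have tsd : (`|t - s| < d)%R by exact: ts.
  change (`|(a + t) - (a + s)| < d)%R; by rewrite opprD addrACA subrr add0r.
by rewrite /= in_itv/=; apply/andP; split; lra.
Qed.

Lemma le_curve_length_translate c a s t :
  curve_length (fun x => c (a + x)%R) s t <= curve_length c (a + s)%R (a + t)%R.
Proof.
apply: ereal_sup_le; move=> _ [p [/= ps pt] <-]; exists (map (fun x => a + x)%R p).
  split; last by rewrite (last_map (fun x => a + x)%R) (eqP pt).
  elim: p s ps {pt} => //= x p IH s /andP[sx xp]; apply/andP; split; first by rewrite ltrD2l.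
  exact: IH.
have nthE k : (nth (a + t) ((a + s) :: map (fun x => a + x) p) k = a + nth t (s :: p) k)%R.
  rewrite -(map_cons (fun x => a + x)%R); have [h|h] := ltnP k (size (s :: p)).
    by rewrite (nth_map t).
  by rewrite !nth_default// size_map.
rewrite size_map; congr EFin; apply: eq_bigr => k _.
have := nthE k.+1; rewrite /= => ->; by rewrite nthE.
Qed.

Lemma curve_length_translate c a s t :
  curve_length (fun x => c (a + x)%R) s t = curve_length c (a + s)%R (a + t)%R.
Proof.
apply/eqP; rewrite eq_le le_curve_length_translate/=.
have := le_curve_length_translate (fun x => c (a + x)%R) (- a) (a + s) (a + t).
by rewrite !addKr; under eq_fun do rewrite addNKr.
Qed.

Lemma subcurve c l a b : is_curve c l -> (0 <= a)%R -> (a < b)%R -> (b <= l)%R ->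
  is_curve (fun t => c (a + t)%R) (b - a).
Proof.
move=> [l0 cc cl] a0 ab bl; split; first by rewrite subr_gt0.
- exact: within_translate cc a0 bl.
- move=> s t s0 st tb; rewrite curve_length_translate cl; [congr EFin | | |]; lra.
Qed.

Lemma curve_measurable c l g : is_curve c l -> Borel_fun g ->
  measurable_fun `[0%R, l] (fun t => g (c t)).
Proof.
move=> [_ cc _] mg.
have mc : measurable_fun `[0%R, l]
    (c : measurableTypeR R -> g_sigma_algebraType (@open X)).
  apply: (@measurability _ _ _ (g_sigma_algebraType (@open X)) _ c open) => //.
  move=> _ [U oU <-]; apply: open_measurable_subspace => //.
  by move/continuousP : cc; apply.
exact: (measurable_comp _ _ mg mc).
Qed.

Lemma curve_measurable_sub c l g a b : is_curve c l -> Borel_fun g ->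
  (0 <= a)%R -> (b <= l)%R -> measurable_fun `[a, b] (fun t => g (c t)).
Proof.
move=> cl mg a0 bl; apply: measurable_funS (curve_measurable cl mg) => //.
by move=> t /=; rewrite !in_itv/= => /andP[h1 h2]; apply/andP; split; lra.
Qed.

(** A piece of a curve, shifted to start at time 0, is again parametrized by arc length. The case
    [a = b] is apart because [is_curve] requires positive length. *)
Lemma upper_gradient_sub f g c l a b : upper_gradient (EFin \o f) g ->
  is_curve c l -> (0 <= a)%R -> (a <= b)%R -> (b <= l)%R ->
  (`|f (c a) - f (c b)|)%:E <=
  \int[lebesgue_measure]_(t in `[a, b]) g (c t).
Proof.
move=> [mg g0 ug] cl a0; rewrite le_eqVlt => /predU1P[->|ab] bl.
  by rewrite subrr normr0; apply: integral_ge0 => t _.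
have abE : (a + (b - a) = b)%R by lra.
have := ug _ _ (subcurve cl a0 ab bl).
rewrite /curve_integral addr0 abE /= => h; apply: le_trans h _.
rewrite (@integral_translate R (fun t => g (c t)))//; first by rewrite addr0 abE.
rewrite addr0 abE; exact: curve_measurable_sub cl mg a0 bl.
Qed.

End curves.

Section upper_gradient_calculus.
Context {R : realType} {X : completeMetricType R}.
Implicit Types (c : R -> X) (a b l s t : R) (f v w : X -> R) (g : X -> \bar R).
Local Open Scope ereal_scope.
Local Notation leb := lebesgue_measure.
Local Notation ug f g := (upper_gradient (EFin \o f) g).

Lemma upper_gradientP f g : ug f g <-> [/\ Borel_fun g, forall x, 0 <= g x &
  forall c l, is_curve c l ->
    (`|f (c 0%R) - f (c l)|)%:E <= curve_integral g c l].
Proof. by []. Qed.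

Lemma upper_gradient_contract (phi : R -> R) f g :
  (forall s t, `|phi s - phi t| <= `|s - t|)%R -> ug f g ->
  ug (fun x => phi (f x)) g.
Proof.
move=> hphi [mg g0 hg]; apply/upper_gradientP; split=> // c l cl.
by apply: le_trans (hg _ _ cl); rewrite lee_fin; exact: hphi.
Qed.

Lemma Borel_funD g1 g2 : Borel_fun g1 -> Borel_fun g2 ->
  Borel_fun (fun x => g1 x + g2 x).
Proof. by move=> m1 m2; exact: emeasurable_funD. Qed.

Lemma Borel_funZ (k : R) g : Borel_fun g -> Borel_fun (fun x => k%:E * g x).
Proof. by move=> m; exact: measurable_funeM. Qed.

Lemma upper_gradientD f1 f2 g1 g2 : ug f1 g1 -> ug f2 g2 ->
  ug (fun x => f1 x + f2 x)%R (fun x => g1 x + g2 x).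
Proof.
move=> [m1 p1 h1] [m2 p2 h2]; apply/upper_gradientP; split.
- exact: Borel_funD.
- by move=> x; exact: adde_ge0.
move=> c l cl; rewrite /curve_integral ge0_integralD//; last 2 first.
- exact: curve_measurable cl m1.
- exact: curve_measurable cl m2.
apply: le_trans (leeD (h1 _ _ cl) (h2 _ _ cl)).
by rewrite /= -EFinD lee_fin opprD addrACA ler_normD.
Qed.

Lemma upper_gradientZ (k : R) f g : (0 <= k)%R -> ug f g ->
  ug (fun x => k * f x)%R (fun x => k%:E * g x).
Proof.
move=> k0 [m p h]; apply/upper_gradientP; split; first exact: Borel_funZ.
  by move=> x; rewrite mule_ge0.
move=> c l cl; rewrite /curve_integral ge0_integralZl//; last exact: curve_measurable cl m.
apply: le_trans (lee_wpmul2l _ (h _ _ cl)) => //.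
by rewrite /= -EFinM lee_fin -mulrBr normrM ger0_norm.
Qed.

Lemma curve_dist c l : is_curve c l -> (mdist (c 0) (c l) <= l)%R.
Proof.
move=> [l0 cc cl]; rewrite -lee_fin -[leRHS]/(l%:E).
have <- : curve_length c 0 l = l%:E by rewrite cl ?subr0//; exact: ltW.
apply: ereal_sup_ubound; exists [:: l]; first by split=> //=; rewrite andbT.
by rewrite /= big_nat1.
Qed.

Lemma upper_gradient_Lipschitz f (L : R) : (0 <= L)%R ->
  (forall x y, `|f x - f y| <= L * mdist x y)%R -> ug f (cst L%:E).
Proof.
move=> L0 hf; apply/upper_gradientP; split => //; first exact: measurable_cst.
move=> c l cl; rewrite /curve_integral integral_cst//= lebesgue_measure_itv/=.
have [l0 _ _] := cl; rewrite lte_fin l0 sube0 -EFinM lee_fin.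
apply: le_trans (hf _ _) _; rewrite ler_wpM2l//; exact: curve_dist.
Qed.

(* A curve leaving the set [f > 0] spends an initial and a final stretch
   inside it, and [f] vanishes at their other end points; the bound follows
   from [|a - b| <= max a b] for nonnegative numbers. *)
Lemma upper_gradient_pos_part f g : continuous f -> ug f g ->
  ug (fun x => Num.max (f x) 0)%R (g \_ [set x | 0 < f x]%R).
Proof.
move=> cf ugf; have [mg g0 hg] := ugf.
set U := [set x | (0 < f x)%R].
have oU : open U by exact: continuous_open_gt.
have mgU := Borel_fun_restrict oU mg.
have gU0 x : 0 <= (g \_ U) x by rewrite patchE; case: ifP.
apply/upper_gradientP; split=> // c l cl; have [l0 cc _] := cl.
have cF : {within `[0%R, l], continuous (f \o c)} by exact: within_comp.
set I := curve_integral _ _ _.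
have le_I a b : (0 <= a)%R -> (b <= l)%R -> forall i : interval R,
    [set` i] `<=` `[a, b] -> (forall t, t \in i -> (0 < f (c t))%R) ->
    \int[leb]_(t in [set` i]) g (c t) <= I.
  move=> a0 bl i iab Fi.
  have il : [set` i] `<=` `[0%R, l].
    by move=> t /iab/=; rewrite !in_itv/= => /andP[h1 h2]; apply/andP; split; lra.
  have -> : \int[leb]_(t in [set` i]) g (c t) = \int[leb]_(t in [set` i]) (g \_ U) (c t).
    by apply: eq_integral => t /set_mem /= ti; rewrite patchE mem_set//; exact: Fi.
  apply: ge0_subset_integral => //; exact: curve_measurable cl mgU.
have mgc a b : (0 <= a)%R -> (b <= l)%R -> measurable_fun `[a, b] (fun t => g (c t)).
  exact: curve_measurable_sub cl mg.
have [[t0 [t0l Ft0]]|/forallNP nF] := pselect (exists t, (0 <= t <= l)%R /\ (f (c t) <= 0)%R).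
  have maxI t : (f (c t))%:E <= I -> (Num.max (f (c t)) 0%R)%:E <= I.
    move=> h; rewrite EFin_max ge_max h /=; apply: integral_ge0 => s _; exact: gU0.
  have h0 : (f (c 0%R))%:E <= I.
    have [t [/andP[t1 t2] Ft hs]] := first_nonpos cF t0l Ft0.
    have tl : (t <= l)%R by case/andP: t0l; lra.
    have := upper_gradient_sub ugf cl (lexx 0%R) t1 tl.
    (* The end point [t], where [f] is no longer positive, is dropped: on the half-open stretch the
       curve stays in [U]. *)
    rewrite -(integral_itv_bndo_bndc); last first.
      by apply: measurable_funS (mgc 0%R t _ tl) => //; exact: subset_itv_co_cc.
    move=> h; apply: (@le_trans _ _ (\int[leb]_(t in `[0%R, t[) g (c t))).
      apply: le_trans h; rewrite lee_fin; have := ler_norm (f (c 0%R) - f (c t)).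
      by move: Ft => /=; lra.
    by apply: (le_I 0%R t) => //; exact: subset_itv_co_cc.
  have hl : (f (c l))%:E <= I.
    have [t [/andP[t1 t2] Ft hs]] := last_nonpos cF t0l Ft0.
    have tl : (0 <= t)%R by case/andP: t0l; lra.
    have := upper_gradient_sub ugf cl tl t2 (lexx l).
    rewrite -(integral_itv_obnd_cbnd); last first.
      by apply: measurable_funS (mgc t l tl _) => //; exact: subset_itv_oc_cc.
    move=> h; apply: (@le_trans _ _ (\int[leb]_(s in `]t, l]) g (c s))).
      apply: le_trans h; rewrite lee_fin distrC; have := ler_norm (f (c l) - f (c t)).
      by move: Ft => /=; lra.
    by apply: (le_I t l) => //; exact: subset_itv_oc_cc.
  apply: (@le_trans _ _ (maxe (Num.max (f (c 0)) 0)%:E (Num.max (f (c l)) 0)%:E)%R).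
    rewrite -EFin_max lee_fin.
    have a0 : (0 <= Num.max (f (c 0)) 0)%R by rewrite le_max lexx orbT.
    have b0 : (0 <= Num.max (f (c l)) 0)%R by rewrite le_max lexx orbT.
    by rewrite le_max ler_norml; case: (leP (Num.max (f (c 0)) 0)%R (Num.max (f (c l)) 0)%R) => h;
      apply/orP; [right|left]; rewrite ?ler_norml; apply/andP; split; lra.
  by rewrite ge_max !maxI.
have F0 t : (0 <= t <= l)%R -> (0 < f (c t))%R.
  by move=> tl; rewrite ltNge; apply/negP => h; apply: (nF t).
have m0 t : (0 <= t <= l)%R -> Num.max (f (c t)) 0%R = f (c t).
  by move=> /F0 h; rewrite max_l// ltW.
rewrite !m0 ?lexx ?(ltW l0)//; apply: le_trans (hg _ _ cl) _.
exact: (le_I 0%R l).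
Qed.

End upper_gradient_calculus.

(** * Total variation and the coarea inequality *)

Section relative_isoperimetric.
Context {R : realType} {X : completeMetricType R}.
Context (mu : {outer_measure set X -> \bar R}) (Cd CP lambda : R).
Hypothesis H : PI_space mu Cd CP lambda.
Implicit Types (x y z : X) (r s : R) (A B E : set X) (v : X -> R) (g : X -> \bar R).
Local Open Scope ereal_scope.
Local Notation int := (mu_int mu).
Local Notation meas := (mu_measurable mu).
Local Notation ug f g := (upper_gradient (EFin \o f) g).

Lemma Lip_loc_measurable v : Lip_loc v -> mu_measurable_fun mu setT (EFin \o v).
Proof.
move=> lv; apply: int_Borel (measurable_Borel H) _.
by apply: continuous_Borel_fun; exact: (Lip_loc_continuous H lv).
Qed.

Lemma Borel_ge0_measurable g : Borel_fun g -> (forall x, 0 <= g x) ->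
  ge0_measurable mu g.
Proof. by move=> mg g0; split=> //; exact: int_Borel (measurable_Borel H) mg. Qed.

Lemma ug_ge0_measurable v g : ug v g -> ge0_measurable mu g.
Proof. by move=> [mg g0 _]; exact: Borel_ge0_measurable. Qed.

Lemma ge0_measurable_dist (u v : X -> \bar R) : mu_measurable_fun mu setT u ->
  mu_measurable_fun mu setT v -> ge0_measurable mu (fun x => `|u x - v x|).
Proof.
move=> mv mf; apply: ge0_measurable_abse.
exact: (@emeasurable_funB _ (caratheodory_type mu) _ setT).
Qed.

Lemma measurable_indicE E : meas E ->
  mu_measurable_fun mu setT (fun x => (\1_E x)%:E).
Proof. by case/(@ge0_measurable_indic _ _ mu). Qed.

Lemma measurable_cstE (c : \bar R) : mu_measurable_fun mu setT (fun=> c).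
Proof. exact: (@measurable_cst _ _ (caratheodory_type mu)). Qed.

Lemma Lip_loc_L1_loc v : Lip_loc v -> L1_loc mu (EFin \o v).
Proof.
move=> lv U rU; have [oU _] := rU; have mU := measurable_openX H oU.
have mv := Lip_loc_measurable lv.
apply/integrableP; split; first exact: measurable_funT.
have [[x Ux]|nU] := pselect (exists x, U x); last first.
  suff -> : U = set0 by rewrite integral_set0.
  by apply/seteqP; split=> // x Ux; apply: nU; exists x.
have [L hL] := lv _ rU; have [r r0 Ur] := rel_compact_sub_ball x rU.
pose K : R := (`|v x| + `|L| * r)%R.
have K0 : (0 <= K)%R by rewrite addr_ge0// mulr_ge0// ltW.
apply: (@le_lt_trans _ _ (int U (cst K%:E))).
  apply: int_le => //; first exact: ge0_measurable_abse.
    exact: ge0_measurable_cst.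
  move=> y Uy; rewrite /= lee_fin /K -lerBlDl.
  apply: le_trans (lerB_dist _ _) _; rewrite distrC; apply: le_trans (hL _ _ Ux Uy) _.
  have := Ur _ Uy; move/in_ball => xy; have := mdist_ge0 x y => d0.
  have := ler_norm L; have := normr_ge0 L; nra.
rewrite int_cst// lte_mul_pinfty//; exact: (mu_bounded_fin H Ur).
Qed.

(** With [c] the mean of [v], multiplying the Poincaré inequality by [mu B] removes both averages,
    since [mu B <= mu B']. *)
Lemma Poincare_ball v g x r : (0 < r)%R -> Lip_loc v -> ug v g ->
  exists c : R, int (ball x r) (fun y => `|(v y)%:E - c%:E|) <=
    (CP * r)%:E * int (ball x (lambda * r)%R) g.
Proof.
move=> r0 lv ugv; set B := ball x r; set B' := ball x (lambda * r)%R.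
have rU : rel_compact_open B by exact: (ball_rel_compact_open H).
have mB : meas B by exact: (measurable_ball H).
have mB' : meas B' by exact: (measurable_ball H).
have BB' : B `<=` B'.
  by apply: sub_ball_center; rewrite ler_peMl ?(PI_lambda_ge1 H)// ltW.
pose c := fine (mean mu B (EFin \o v)); exists c.
have mB0 : 0 < mu B by exact: (mu_ball_gt0 H).
pose m := fine (mu B); pose m' := fine (mu B').
have mE : mu B = m%:E by rewrite fineK// (mu_ball_fin_num H).
have m'E : mu B' = m'%:E by rewrite fineK// (mu_ball_fin_num H).
have m0 : (0 < m)%R by rewrite -lte_fin -mE.
have mm' : (m <= m')%R by rewrite -lee_fin -mE -m'E; exact: le_outer_measure.
have mVE (k : R) : (0 < k)%R -> k%:E^-1 = (k^-1)%:E.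
  by move=> k0; rewrite inver gt_eqF.
have cE : mean mu B (EFin \o v) = c%:E.
  rewrite fineK// /mean mE mVE// fin_numM//.
  exact: (@integrable_fin_num _ (caratheodory_type mu)) (Lip_loc_L1_loc lv rU).
have gi0 : 0 <= int B' g by apply: int_ge0; exact: ug_ge0_measurable ugv.
have CPr : (0 <= CP * r)%R by rewrite mulr_ge0// ltW// (PI_CP_gt0 H).
have := PI_Poincare H x r0 (Lip_loc_L1_loc lv) ugv; rewrite -/B -/B' cE.
rewrite {1 2}/mean mE m'E !mVE//; last exact: lt_le_trans mm'.
rewrite lee_pdivrMr// => h; apply: le_trans h _.
rewrite -!muleA lee_wpmul2l// -EFinM.
rewrite -[leRHS]mule1 lee_wpmul2l// lee_fin mulrC ler_pdivrMr ?mul1r//.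
exact: lt_le_trans mm'.
Qed.

(** The Poincaré inequality is applied to [v], and the [L^1] distance to [1_E] is paid for. Against
    any constant [c], [1_E] differs by [|1 - c|] on [E] and by [|c|] off [E]; these add up to at
    least 1, so the integral dominates the smaller of the two measures. *)
Lemma relative_isoperimetric E v g x r : meas E -> (0 < r)%R -> Lip_loc v ->
  ug v g ->
  mine (mu (E `&` ball x r)) (mu (ball x r `\` E)) <=
    (CP * r)%:E * int (ball x (lambda * r)%R) g +
    int (ball x r) (fun y => `|(v y)%:E - (\1_E y)%:E|).
Proof.
move=> mE r0 lv ugv; have [c hc] := Poincare_ball x r0 lv ugv.
set B := ball x r in hc *.
have mB : meas B by exact: (measurable_ball H).
have mv := Lip_loc_measurable lv; have m1 := measurable_indicE mE.
pose h y := `|(\1_E y)%:E - c%:E|.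
have gh : ge0_measurable mu h by apply: ge0_measurable_dist => //; exact: measurable_cstE.
have gvc : ge0_measurable mu (fun y => `|(v y)%:E - c%:E|).
  by apply: ge0_measurable_dist => //; exact: measurable_cstE.
have gv1 := ge0_measurable_dist mv m1.
apply: le_trans (leeD2r _ hc); rewrite -intD//.
apply: (@le_trans _ _ (int B h)); last first.
  apply: int_le => //; first exact: ge0_measurableD.
  move=> y _; rewrite /h -EFinB !abse_EFin -EFinD lee_fin.
  have -> : (\1_E y - c = (v y - c) - (v y - \1_E y))%R by ring.
  exact: ler_normB.
have BE : B = (B `&` E) `|` (B `\` E) by rewrite setUIDK.
have mI : meas (B `&` E) by exact: measI.
have mD : meas (B `\` E) by exact: measD.
have hI : int (B `&` E) h = (`|1 - c|)%:E * mu (B `&` E).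
  rewrite -int_cst//; apply: int_eq => y [_ Ey].
  by rewrite /h indicE mem_set.
have hD : int (B `\` E) h = (`|c|)%:E * mu (B `\` E).
  rewrite -int_cst//; apply: int_eq => y [_ Ey].
  by rewrite /h indicE memNset// sub0e -EFinN abse_EFin normrN.
rewrite [leRHS](_ : _ = int (B `&` E) h + int (B `\` E) h); last first.
  by rewrite -int_setUD// -?BE//; apply/seteqP; split=> // y [[_ Ey] []].
rewrite hI hD setIC.
have fI : mu (B `&` E) \is a fin_num.
  by rewrite ge0_fin_numE ?outer_measure_ge0//; apply: (mu_bounded_fin H (x := x) (r := r)) => y [].
have fD : mu (B `\` E) \is a fin_num.
  by rewrite ge0_fin_numE ?outer_measure_ge0//; apply: (mu_bounded_fin H (x := x) (r := r)) => y [].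
have I0 := outer_measure_ge0 mu (B `&` E); have D0 := outer_measure_ge0 mu (B `\` E).
move: I0 D0; rewrite -(fineK fI) -(fineK fD) -EFin_min -!EFinM -EFinD !lee_fin.
set p := fine _; set q := fine _ => p0 q0.
have h1 : (1 <= `|1 - c| + `|c|)%R by have := ler_normD (1 - c)%R c; rewrite subrK normr1.
have := normr_ge0 (1 - c)%R; have := normr_ge0 c; move: h1.
set a := `|1 - c|%R; set b := `|c|%R => h1 b0 a0.
by case: (leP p q) => pq; nra.
Qed.

End relative_isoperimetric.

Ltac minmax_cases :=
  repeat (match goal with
  | |- context [Num.min ?x ?y] => is_var x; is_var y; case: (leP x y) => ?
  | |- context [Num.max ?x ?y] => is_var x; is_var y; case: (leP x y) => ? end).

Section clamp.
Context {R : realType}.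
Implicit Types (a b s t : R) (y : \bar R).

Definition clampE a b y : R :=
  match y with
  | r%:E => Num.max a (Num.min r b)
  | +oo%E => b
  | -oo%E => a
  end.

Lemma clampE_dist a b t y :
  (`|clampE a b t%:E - clampE a b y|%:E <= `|t%:E - y|)%E.
Proof.
case: y => [r| |] /=; [|by rewrite leey|by rewrite leey].
have := ler_norm (t - r); have := ler_norm (r - t); rewrite (distrC r t) => h3 h4.
rewrite lee_fin; case: (leP t b) => h1; case: (leP r b) => h2;
  rewrite ler_norml; apply/andP; split;
  repeat (match goal with |- context [Num.max ?x ?y] => case: (leP x y) => ? end);
  lra.
Qed.

Lemma min_clampE a b s y : a <= s <= b -> Num.min (clampE a b y) s = clampE a s y.
Proof. by move=> /andP[? ?]; case: y => [r| |] /=; minmax_cases; lra. Qed.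

Lemma max_clampE a b s y : a <= s <= b -> Num.max (clampE a b y) s = clampE s b y.
Proof. by move=> /andP[? ?]; case: y => [r| |] /=; minmax_cases; lra. Qed.

End clamp.

(** * Total variation through single approximants *)

Section variation.
Context {R : realType} {X : completeMetricType R}.
Context (mu : {outer_measure set X -> \bar R}) (Cd CP lambda : R).
Hypothesis H : PI_space mu Cd CP lambda.
Implicit Types (x y z : X) (r s : R) (A B E : set X) (v : X -> R) (g f : X -> \bar R).
Local Open Scope ereal_scope.
Local Notation int := (mu_int mu).
Local Notation meas := (mu_measurable mu).
Local Notation mfun := (mu_measurable_fun mu setT).

Definition admissible v g := Lip_loc v /\ upper_gradient (EFin \o v) g.

(* [||Df||(X) <= M], with the approximating sequence replaced by a single
   function for each ball and each tolerance [e]. *)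
Definition TV_le f (M : R) := forall r e : R, (0 < e)%R -> exists v g,
  [/\ admissible v g, int setT g <= (M + e)%:E &
      int (ball point r) (fun x => `|(v x)%:E - f x|) <= e%:E].

Let mball r := measurable_ball H point r.

Lemma admissible_ge0 v g : admissible v g -> ge0_measurable mu g.
Proof. by move=> [_ ugv]; exact: (ug_ge0_measurable H ugv). Qed.

Lemma admissible_measurable v g : admissible v g -> mfun (EFin \o v).
Proof. by move=> [lv _]; exact: (Lip_loc_measurable H). Qed.

Lemma cvg0_near_lt (T : Type) (F : set_system T) (h : T -> \bar R) (e : R) :
  Filter F -> (0 < e)%R -> h t @[t --> F] --> 0 ->
  \forall t \near F, h t < e%:E.
Proof.
move=> FF e0 h0; have U : nbhs (0 : \bar R) [set y | y < e%:E].
  apply: open_nbhs_nbhs; split; first exact: open_ereal_lt_ereal. by rewrite /= lte_fin.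
exact: (h0 _ U).
Qed.

Lemma TV_le_of_total_variation f (M : R) :
  Defs.total_variation mu f <= M%:E -> TV_le f M.
Proof.
move=> tf r e e0.
have : Defs.total_variation mu f < (M + e)%:E.
  by apply: le_lt_trans tf _; rewrite lte_fin ltrDl.
move=> /ereal_inf_lt[_ [v [g [lv cv ugv ->]]]]; rewrite limn_einf_lim => hlim.
have [N _ hN] := cvg0_near_lt _ e0 (cv _ (ball_rel_compact_open H point r)).
have : einfs (fun i => int setT (g i)) N < (M + e)%:E.
  apply: le_lt_trans hlim.
  rewrite (cvg_lim _ (@cvg_einfs_sup _ _))//.
  by apply: ereal_sup_ubound; exists N.
move=> /ereal_inf_lt[_ [k /= Nk <-] hk].
exists (v k), (g k); split; [by split; [exact: lv | exact: ugv] | exact: (ltW hk) | apply: ltW; exact: (hN k)].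
Qed.

(** Approximants for the ball of radius [k] and tolerance [1 / (k + 1)] form an admissible sequence:
    each relatively compact open set lies in all but finitely many of these balls. *)
Lemma total_variation_le f (M : R) : mfun f ->
  TV_le f M -> Defs.total_variation mu f <= M%:E.
Proof.
move=> mf tf.
have h k : exists vg : (X -> R) * (X -> \bar R),
  [/\ admissible vg.1 vg.2, int setT vg.2 <= (M + k.+1%:R^-1)%:E &
      int (ball point k%:R) (fun x => `|(vg.1 x)%:E - f x|) <= (k.+1%:R^-1)%:E].
  have [|v [g ?]] := tf k%:R%R (k.+1%:R^-1)%R; first by rewrite invr_gt0.
  by exists (v, g).
pose vg k := sval (cid (h k)).
have hvg k := svalP (cid (h k)).
apply: le_trans (_ : limn_einf (fun k => int setT (vg k).2) <= _).
  apply: ereal_inf_lbound; exists (fun k => (vg k).1), (fun k => (vg k).2); split => //.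
  - by move=> k; have [[]] := hvg k.
  - move=> U rU; have [r r0 Ur] := rel_compact_sub_ball point rU.
    have mU : meas U by apply: (measurable_openX H); case: rU.
    have gd k : ge0_measurable mu (fun x => `|((vg k).1 x)%:E - f x|).
      by apply: (ge0_measurable_dist _ mf); have [/admissible_measurable] := hvg k.
    apply: (@squeeze_cvge _ _ _ _ (cst 0) _ (fun k => (k.+1%:R^-1)%:E)).
    + exists (Num.truncn r).+1 => // k /= rk; rewrite int_ge0//=.
      have [_ _] := hvg k; apply: le_trans; apply: int_subset => //.
      apply: subset_trans Ur _; apply: sub_ball_center.
      by apply/ltW/(lt_le_trans (truncnS_gt r)); rewrite ler_nat.
    + exact: cvg_cst.
    + by apply: cvg_EFin; [exact: nearW|exact: cvg_harmonic].
  - by move=> k; have [[]] := hvg k.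
rewrite limn_einf_lim; apply: lime_le; first exact: is_cvg_einfs.
apply: nearW => n; apply/lee_addgt0Pr => e e0.
have [k nk ke] : exists2 k, (n <= k)%N & (k.+1%:R^-1 <= e)%R.
  exists (maxn n (Num.truncn e^-1)); first exact: leq_maxl.
  rewrite invf_ple ?posrE//; apply/ltW/(lt_le_trans (truncnS_gt _)).
  by rewrite ler_nat ltnS leq_maxr.
apply: (@le_trans _ _ (int setT (vg k).2)).
  by apply: ereal_inf_lbound; exists k.
by have [_ h2 _] := hvg k; apply: le_trans h2 _; rewrite -EFinD lee_fin lerD2l.
Qed.

Lemma TV_le_ge0 f (M : R) : TV_le f M -> (0 <= M)%R.
Proof.
move=> tf; apply/ler_addgt0Pr => e e0.
have [v [g [avg h _]]] := tf 0%R e e0; rewrite -lee_fin.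
by apply: le_trans h; apply: int_ge0; exact: admissible_ge0 avg.
Qed.

Lemma TV_le_closed f (M : R) : (forall e, (0 < e)%R -> TV_le f (M + e)) -> TV_le f M.
Proof.
move=> tf r e e0; have e2 : (0 < e / 2)%R by lra.
have [v [g [avg h1 h2]]] := tf _ e2 r _ e2.
exists v, g; split => //; first by rewrite [e]splitr addrA.
by apply: le_trans h2 _; rewrite lee_fin; lra.
Qed.

Lemma TV_le_trans f (M M' : R) : (M <= M')%R -> TV_le f M -> TV_le f M'.
Proof.
move=> MM' tf r e e0; have [v [g [avg h1 h2]]] := tf r e e0.
by exists v, g; split=> //; apply: le_trans h1 _; rewrite lee_fin lerD2r.
Qed.

(** Lower semicontinuity of the variation under [L^1] convergence on balls. *)
Lemma TV_le_lim f (M : R) : mfun f ->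
  (forall r e : R, (0 < e)%R -> exists f' : X -> R, [/\ mfun (EFin \o f'),
    TV_le (EFin \o f') (M + e) &
    int (ball point r) (fun x => `|(f' x)%:E - f x|) <= e%:E]) -> TV_le f M.
Proof.
move=> mf hf r e e0; have e2 : (0 < e / 2)%R by lra.
have [f' [mf' tf' df']] := hf r _ e2; have [v [g [avg h1 h2]]] := tf' r _ e2.
exists v, g; split=> //; first by rewrite [e]splitr addrA.
have mv := admissible_measurable avg.
apply: (@le_trans _ _ (int (ball point r)
    (fun x => `|(v x)%:E - (f' x)%:E| + `|(f' x)%:E - f x|))).
  apply: int_le => //; first exact: ge0_measurable_dist.
    by apply: ge0_measurableD; exact: ge0_measurable_dist.
  move=> x _; have -> : (v x)%:E - f x = ((v x)%:E - (f' x)%:E) + ((f' x)%:E - f x).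
    by rewrite -EFinB addeA -EFinD subrK.
  exact: lee_abs_add.
rewrite intD//; [|exact: ge0_measurable_dist..].
by rewrite [e]splitr EFinD; exact: leeD.
Qed.

End variation.

Section slope.
Context {R : realType}.

(** Takes the place of almost everywhere differentiability of a monotone function. Let [s] be the
    supremum of the [t] at which the chord from [a] has slope at least [K]. Monotonicity puts [s] in
    this set, so [s < b]; if all small chords to the right of [s] had slope above [K], the set would
    extend beyond [s]. *)
Lemma monotone_slope (F : R -> R) (a b K : R) : a < b ->
  (forall s t, a <= s -> s <= t -> t <= b -> F s <= F t) ->
  F b - F a < K * (b - a) ->
  exists2 t, a <= t < b & forall h0, 0 < h0 ->
    exists h, [/\ 0 < h < h0, t + h <= b & F (t + h) - F t <= K * h].
Proof.
move=> ab mF FK; have K0 : 0 <= K.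
  by have := mF a b (lexx a) (ltW ab) (lexx b); nra.
apply: contrapT => nt0.
have nt t : a <= t < b -> ~ (forall h0, 0 < h0 -> exists h,
    [/\ 0 < h < h0, t + h <= b & F (t + h) - F t <= K * h]).
  by move=> tab ht; apply: nt0; exists t.
pose S := [set t | a <= t <= b /\ K * (t - a) <= F t - F a].
have Sa : S a by split; [rewrite lexx ltW|rewrite !subrr mulr0].
have supS : has_sup S by split; [exists a | exists b => t [/andP[]]].
set s := sup S.
have ubS t : S t -> t <= s by move=> St; apply: sup_ubound => //; case: supS.
have as_ : a <= s by exact: ubS.
have sb : s <= b by apply: ge_sup; [exists a | move=> t [/andP[]]].
have Ss : K * (s - a) <= F s - F a.
  apply/ler_addgt0Pr => e e0; have d0 : 0 < e / (K + 1) by rewrite divr_gt0//; lra.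
  have [t [/andP[at_ tb] Ft] st] := sup_adherent d0 supS.
  have ts : t <= s by apply: (ubS); split=> //; rewrite at_.
  have := mF _ _ at_ ts sb; have : K * (e / (K + 1)) <= e.
    rewrite mulrA ler_pdivrMr; last lra.
    by rewrite mulrC ler_wpM2l ?ltW//; lra.
  by rewrite -/s in st; nra.
have {}sb : s < b.
  rewrite lt_neqAle sb andbT; apply/eqP => sb'; move: Ss; rewrite sb'; lra.
have : a <= s < b by rewrite as_ sb.
move=> /nt/existsNP[h0 /not_implyP[h00 /forallNP nh]].
pose h := Num.min (h0 / 2) (b - s).
have h_gt0 : 0 < h by rewrite lt_min; apply/andP; split; lra.
have hh0 : h < h0 by rewrite gt_min; apply/orP; left; lra.
have hb : s + h <= b by have : h <= b - s by [rewrite ge_min lexx orbT]; lra.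
have /not_and3P [] := nh h; rewrite ?h_gt0 ?hh0 ?hb // => /negP; rewrite -ltNge => Fh.
have : s + h <= s by apply: (ubS); split; [apply/andP; split; lra | nra].
by lra.
Qed.

End slope.

Section variation_operations.
Context {R : realType} {X : completeMetricType R}.
Context (mu : {outer_measure set X -> \bar R}) (Cd CP lambda : R).
Hypothesis H : PI_space mu Cd CP lambda.
Implicit Types (x y z : X) (r s : R) (A B E : set X) (v : X -> R) (g f : X -> \bar R).
Local Open Scope ereal_scope.
Local Notation int := (mu_int mu).
Local Notation meas := (mu_measurable mu).
Local Notation mfun := (mu_measurable_fun mu setT).

Let mball r := measurable_ball H point r.

Lemma max_contract (c s t : R) : (`|Num.max s c - Num.max t c| <= `|s - t|)%R.
Proof.
have := ler_norm (s - t); have := ler_norm (t - s); rewrite (distrC t s) => h1 h2.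
by rewrite ler_norml; minmax_cases; apply/andP; split; lra.
Qed.

Lemma min_contract (c s t : R) : (`|Num.min s c - Num.min t c| <= `|s - t|)%R.
Proof.
have := ler_norm (s - t); have := ler_norm (t - s); rewrite (distrC t s) => h1 h2.
by rewrite ler_norml; minmax_cases; apply/andP; split; lra.
Qed.

Lemma admissible_contract (phi : R -> R) v g :
  (forall s t, `|phi s - phi t| <= `|s - t|)%R ->
  admissible v g -> admissible (fun x => phi (v x)) g.
Proof.
move=> hphi [lv ugv]; split; last exact: upper_gradient_contract.
apply: (@Lip_loc_comp2 _ _ v v (fun a _ => phi a) 1%R) => // a b c d.
by rewrite mul1r; apply: le_trans (hphi _ _) _; rewrite lerDl.
Qed.

Lemma admissible_pos_part v g : admissible v g ->
  admissible (fun x => Num.max (v x) 0%R) (g \_ [set x | (0 < v x)%R]).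
Proof.
move=> avg; have [lv ugv] := avg; split.
  apply: (@Lip_loc_comp2 _ _ v v (fun a _ => Num.max a 0%R) 1%R) => // a b c d.
  by rewrite mul1r; apply: le_trans (max_contract _ _ _) _; rewrite lerDl.
exact: upper_gradient_pos_part (Lip_loc_continuous H lv) ugv.
Qed.

Lemma admissible_max (c : R) v g : admissible v g ->
  admissible (fun x => Num.max (v x) c) (g \_ [set x | (c < v x)%R]).
Proof.
move=> avg.
have h1 : admissible (fun x => v x - c)%R g.
  by apply: (admissible_contract (phi := fun a => (a - c)%R)) avg => s t; rewrite (_ : s - c - (t - c) = s - t)%R//; lra.
have := admissible_pos_part h1.
rewrite (_ : [set x | _] = [set x | (c < v x)%R]); last by apply/seteqP; split=> x /=; rewrite subr_gt0.
move=> /(admissible_contract (phi := fun a => (a + c)%R)) h2.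
rewrite (_ : (fun x => _) = (fun x => Num.max (v x - c) 0 + c)%R).
  by apply: h2 => s t; rewrite (_ : s + c - (t + c) = s - t)%R//; lra.
by apply/funext => x; case: (leP (v x) c) => ?; case: (leP (v x - c)%R 0%R) => ?; lra.
Qed.

Lemma admissible_min (c : R) v g : admissible v g ->
  admissible (fun x => Num.min (v x) c) (g \_ [set x | (v x < c)%R]).
Proof.
move=> avg.
have h1 : admissible (fun x => c - v x)%R g.
  by apply: (admissible_contract (phi := fun a => (c - a)%R)) avg => s t; rewrite distrC (_ : c - t - (c - s) = s - t)%R//; lra.
have := admissible_pos_part h1.
rewrite (_ : [set x | _] = [set x | (v x < c)%R]); last by apply/seteqP; split=> x /=; rewrite subr_gt0.
move=> /(admissible_contract (phi := fun a => (c - a)%R)) h2.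
rewrite (_ : (fun x => _) = (fun x => c - Num.max (c - v x) 0)%R).
  by apply: h2 => s t; rewrite distrC (_ : c - t - (c - s) = s - t)%R//; lra.
by apply/funext => x; case: (leP (v x) c) => ?; case: (leP (c - v x)%R 0%R) => ?; lra.
Qed.

Lemma admissible_affine (k c : R) v g : (0 < k)%R -> admissible v g ->
  admissible (fun x => k * v x + c)%R (fun x => k%:E * g x).
Proof.
move=> k0 [lv ugv]; split.
  apply: (@Lip_loc_comp2 _ _ v v (fun a _ => k * a + c)%R k) => //; first exact: ltW.
  move=> p q s t; rewrite (_ : k * p + c - (k * s + c) = k * (p - s))%R; last by ring.
  by rewrite normrM (ger0_norm (ltW k0)) ler_pM2l// lerDl.
apply: (upper_gradient_contract (phi := fun t => (t + c)%R)) => [s t|].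
  by rewrite (_ : s + c - (t + c) = s - t)%R//; lra.
exact: upper_gradientZ (ltW k0) ugv.
Qed.

Lemma admissibleB v w g h : admissible v g -> admissible w h ->
  admissible (fun x => v x - w x)%R (fun x => g x + h x).
Proof.
move=> [lv ugv] [lw ugw]; split; last first.
  apply: (upper_gradientD ugv); apply: (upper_gradient_contract (phi := fun t => - t)%R) ugw.
  by move=> s t; rewrite -opprD normrN.
apply: (@Lip_loc_comp2 _ _ v w (fun a b => a - b)%R 1%R) => // a b c d.
by rewrite mul1r (_ : a - b - (c - d) = (a - c) - (b - d))%R ?ler_normB//; ring.
Qed.

Lemma int_dist_le D v w f f' : meas D -> mfun (EFin \o v) -> mfun (EFin \o w) ->
  mfun f -> mfun f' ->
  (forall x, `|(w x)%:E - f' x| <= `|(v x)%:E - f x|) ->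
  int D (fun x => `|(w x)%:E - f' x|) <= int D (fun x => `|(v x)%:E - f x|).
Proof.
move=> mD mv mw mf mf' h; apply: int_le => //.
- exact: ge0_measurable_dist mf'.
- exact: ge0_measurable_dist mf.
Qed.

Lemma TV_le_clampE f (M : R) (a b : R) : mfun f ->
  mfun (fun x => (clampE a b (f x))%:E) -> TV_le mu f M ->
  TV_le mu (fun x => (clampE a b (f x))%:E) M.
Proof.
move=> mf mc tf r e e0; have [v [g [avg h1 h2]]] := tf r e e0.
exists (fun x => clampE a b (v x)%:E), g.
have avg' : admissible (fun x => clampE a b (v x)%:E) g.
  apply: (admissible_contract (phi := fun t => clampE a b t%:E)) avg => s t.
  by have := clampE_dist a b s t%:E; rewrite -EFinB abse_EFin lee_fin.
split=> //; apply: le_trans h2; apply: int_dist_le => //.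
- exact: (admissible_measurable H avg).
- exact: (admissible_measurable H avg').
- by move=> x; rewrite -EFinB abse_EFin; exact: clampE_dist.
Qed.

(* The two truncations of an approximant of [f] have upper gradients with
   disjoint supports. *)
Lemma TV_le_split (f : X -> R) (c M M1 : R) : mfun (EFin \o f) ->
  mfun (fun x => (Num.min (f x) c)%:E) -> mfun (fun x => (Num.max (f x) c)%:E) ->
  TV_le mu (EFin \o f) M -> ~ TV_le mu (fun x => (Num.min (f x) c)%:E) M1 ->
  TV_le mu (fun x => (Num.max (f x) c)%:E) (M - M1).
Proof.
move=> mf mmin mmax tf /existsNP[r0 /existsNP[e0 /not_implyP[e0_gt0 nap]]] r e e_gt0.
(* One approximant of [f] serves both for the goal, at [r] and [e], and at [r0] and [e0], where the
   bound [M1] fails. Its lower truncation must then have energy above [M1 + e0], which leaves little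
   for the upper one. *)
pose r' := Num.max r r0; pose e' := Num.min e e0.
have e'_gt0 : (0 < e')%R by rewrite lt_min e_gt0.
have [v [g [avg h1 h2]]] := tf r' e' e'_gt0.
have mv := admissible_measurable H avg.
have avg1 := admissible_min c avg; have avg2 := admissible_max c avg.
set g1 := _ \_ _ in avg1; set g2 := _ \_ _ in avg2.
have err w f' s g' : (s <= r')%R -> admissible w g' -> mfun f' ->
    (forall x, `|(w x)%:E - f' x| <= `|(v x)%:E - (f x)%:E|) ->
    int (ball point s) (fun x => `|(w x)%:E - f' x|) <= e'%:E.
  move=> sr aw mf' hw; have mw := admissible_measurable H aw.
  apply: le_trans h2; apply: (@le_trans _ _ (int (ball point s) (fun x => `|(v x)%:E - (f x)%:E|))).
    exact: int_dist_le.
  by apply: int_subset => //; [exact: ge0_measurable_dist|exact: sub_ball_center].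
have hg : int setT g1 + int setT g2 <= int setT g.
  have gg := admissible_ge0 H avg.
  rewrite -intD//; [|exact: measT|exact: (admissible_ge0 H avg1)|exact: (admissible_ge0 H avg2)].
  apply: int_le => //; first exact: measT.
    by apply: ge0_measurableD; [exact: (admissible_ge0 H avg1)|exact: (admissible_ge0 H avg2)].
  move=> x _; rewrite /g1 /g2 !patchE; have [g0 _] := gg.
  case: (ltgtP (v x) c) => h; [rewrite mem_set// memNset|rewrite memNset|rewrite !memNset];
    rewrite ?mem_set ?adde0 ?add0e//=; lra.
have G1 : (M1 + e0)%:E < int setT g1.
  rewrite ltNge; apply/negP => le1; apply: nap; exists (fun x => Num.min (v x) c), g1; split=> //.
  apply: (@le_trans _ _ e'%:E); last by rewrite lee_fin ge_min lexx orbT.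
  apply: (err _ _ _ g1) => //; first by rewrite le_max lexx orbT.
  by move=> x; rewrite -!EFinB !abse_EFin lee_fin; exact: min_contract.
exists (fun x => Num.max (v x) c), g2; split=> //; last first.
  apply: (@le_trans _ _ e'%:E); last by rewrite lee_fin ge_min lexx.
  apply: (err _ _ _ g2) => //; first by rewrite le_max lexx.
  by move=> x; rewrite -!EFinB !abse_EFin lee_fin; exact: max_contract.
have := le_trans hg h1; have : (e' <= e)%R by rewrite ge_min lexx.
have g20 : 0 <= int setT g2 by apply: int_ge0; exact: (admissible_ge0 H avg2).
move: G1 g20; case: (int setT g1) => [p| |]; case: (int setT g2) => [q| |] //=.
by rewrite lte_fin !lee_fin; lra.
Qed.

Lemma TV_le_affine (f : X -> R) (k c M : R) : (0 < k)%R -> mfun (EFin \o f) ->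
  TV_le mu (EFin \o f) M -> TV_le mu (fun x => (k * f x + c)%:E) (k * M).
Proof.
move=> k0 mf tf r e e0; have ek : (0 < e / k)%R by rewrite divr_gt0.
have [v [g [avg h1 h2]]] := tf r _ ek.
have mv := admissible_measurable H avg.
exists (fun x => k * v x + c)%R, (fun x => k%:E * g x); split.
- exact: admissible_affine.
- rewrite intZ//; [|exact: measT|exact: ltW|exact: (admissible_ge0 H avg)].
  apply: le_trans (lee_wpmul2l _ h1) _; first by rewrite lee_fin ltW.
  by rewrite -EFinM lee_fin mulrDr (mulrC k (e / k)%R) divfK// gt_eqF.
- rewrite [X in X <= _](_ : _ = int (ball point r) (fun x => k%:E * `|(v x)%:E - (f x)%:E|)).
    rewrite intZ//; [|exact: ltW|exact: ge0_measurable_dist].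
    apply: le_trans (lee_wpmul2l _ h2) _; first by rewrite lee_fin ltW.
    by rewrite -EFinM (mulrC k (e / k)%R) divfK// gt_eqF.
  apply: int_eq => x _; rewrite -!EFinB !abse_EFin -EFinM; congr EFin.
  rewrite (_ : k * v x + c - (k * f x + c) = k * (v x - f x))%R; last by ring.
  by rewrite normrM (ger0_norm (ltW k0)).
Qed.

(** [1_(A \ B)] is the positive part of [1_A - 1_B], and the same operation is applied to the
    approximants. It makes the slabs between two levels sets of finite perimeter. *)
Lemma TV_le_setD A B (M1 M2 : R) : meas A -> meas B ->
  TV_le mu (fun x => (\1_A x)%:E) M1 -> TV_le mu (fun x => (\1_B x)%:E) M2 ->
  TV_le mu (fun x => (\1_(A `\` B) x)%:E) (M1 + M2).
Proof.
move=> mA mB tA tB r e e0; have e2 : (0 < e / 2)%R by lra.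
have [v [g [av h1 h2]]] := tA r _ e2; have [w [h [aw k1 k2]]] := tB r _ e2.
have ad := admissibleB av aw.
have admax := admissible_max 0%R ad.
exists (fun x => Num.max (v x - w x) 0)%R, ((fun x => g x + h x) \_ [set x | (0 < v x - w x)%R]).
have gg := admissible_ge0 H av; have gh := admissible_ge0 H aw.
split=> //.
- apply: (@le_trans _ _ (int setT (fun x => g x + h x))).
    apply: int_le; [exact: measT|exact: (admissible_ge0 H admax)|exact: ge0_measurableD|].
    by move=> x _; rewrite patchE; case: ifP => // _; apply: adde_ge0; [case: gg|case: gh].
  rewrite intD//; last exact: measT.
  by apply: le_trans (leeD h1 k1) _; rewrite -EFinD lee_fin; lra.
- have mv := admissible_measurable H av; have mw := admissible_measurable H aw.
  have mA1 := measurable_indicE mA; have mB1 := measurable_indicE mB.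
  apply: (@le_trans _ _ (int (ball point r)
      (fun x => `|(v x)%:E - (\1_A x)%:E| + `|(w x)%:E - (\1_B x)%:E|))).
    apply: int_le => //.
    + apply: ge0_measurable_dist; first exact: (admissible_measurable H admax).
      by apply: measurable_indicE; exact: measD.
    + by apply: ge0_measurableD; exact: ge0_measurable_dist.
    + move=> x _; rewrite -!EFinB !abse_EFin -EFinD lee_fin.
      have -> : (\1_(A `\` B) x = Num.max (\1_A x - \1_B x) 0 :> R)%R.
        rewrite !indicE in_setD; case: (x \in A); case: (x \in B) => /=;
          rewrite ?subrr ?subr0 ?sub0r ?maxxx ?(max_l ler01)// max_r//; lra.
      apply: le_trans (max_contract _ _ _) _.
      rewrite (_ : v x - w x - _ = (v x - \1_A x) - (w x - \1_B x))%R; last by ring.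
      exact: ler_normB.
  rewrite intD//; [|exact: ge0_measurable_dist..].
  by rewrite [e]splitr EFinD; exact: leeD.
Qed.

Lemma TV_leN f (M : R) : mfun f -> TV_le mu f M -> TV_le mu (fun x => - f x) M.
Proof.
move=> mf tf r e e0; have [v [g [av h1 h2]]] := tf r e e0.
exists (fun x => - v x)%R, g; split=> //.
  by apply: (admissible_contract (phi := fun t => - t)%R) av => s t; rewrite -opprD normrN.
rewrite [X in X <= _](_ : _ = int (ball point r) (fun x => `|(v x)%:E - f x|))//.
apply: int_eq => x _; rewrite -[RHS]abseN; congr (`|_|).
by rewrite EFinN [in RHS]addeC fin_num_oppeD// addeC.
Qed.

End variation_operations.

(** * Coarea inequality by truncations *)

Section coarea.
Context {R : realType} {X : completeMetricType R}.
Context (mu : {outer_measure set X -> \bar R}) (Cd CP lambda : R).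
Hypothesis H : PI_space mu Cd CP lambda.
Implicit Types (a b s t : R) (u : X -> \bar R).
Local Open Scope ereal_scope.
Local Notation int := (mu_int mu).
Local Notation meas := (mu_measurable mu).
Local Notation mfun := (mu_measurable_fun mu setT).
Local Notation T a b u := (fun x => (clampE a b (u x))%:E).

Lemma clampE_quotient_dist (t h k : R) (y : \bar R) : (0 < h)%R -> (h <= k)%R ->
  (`|(clampE t (t + h) y - t) / h - (t%:E < y)%E%:R| <= (t%:E < y < (t + k)%:E)%E%:R)%R.
Proof.
move=> h0 hk; have th : (t <= t + h)%R by rewrite lerDl ltW.
have [ty|yt] := ltP t%:E y; last first.
  have -> : clampE t (t + h) y = t.
    by move: yt; case: y => [q| |]//; rewrite lee_fin => qt /=; rewrite max_l// ge_min qt.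
  by rewrite subrr mul0r subrr normr0.
have [yk|ky] := ltP y (t + k)%:E; last first.
  have -> : clampE t (t + h) y = (t + h)%R.
    move: ky; case: y {ty} => [q| |]//=.
    rewrite lee_fin => qt; have hq : (t + h <= q)%R by apply: le_trans qt; rewrite lerD2l.
    by rewrite min_r// max_r.
  by rewrite addrAC subrr add0r divff ?gt_eqF//= subrr normr0.
have /andP[h1 h2] : (t <= clampE t (t + h) y <= t + h)%R.
  case: y {ty yk} => [q| |] /=; rewrite ?lexx ?th//.
  by rewrite le_max lexx ge_max th ge_min lexx orbT.
rewrite /= distrC ger0_norm ?subr_ge0 ?ler_pdivrMr// ?mul1r; last by rewrite lerBlDl.
by rewrite gerBl divr_ge0// ?subr_ge0// ltW.
Qed.

Definition superlevel u t : set X := [set x | t%:E < u x].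

Lemma measurable_superlevel u t : mfun u -> meas (superlevel u t).
Proof.
move=> mu_; have := mu_ (@measurableT _ (caratheodory_type mu)) `]t%:E, +oo[%classic.
rewrite setTI preimage_itvoy; apply; exact: emeasurable_itv.
Qed.

Lemma measurable_clampE a b u : (a <= b)%R -> mfun u -> mfun (T a b u).
Proof.
move=> ab mu_; rewrite (_ : (fun x => _) = (fun x => maxe a%:E (mine (u x) b%:E))).
  apply: measurable_maxe; first exact: measurable_cst.
  by apply: measurable_mine => //; exact: measurable_cst.
apply/funext => x; case: (u x) => [r| |] /=.
- by rewrite -EFin_min -EFin_max.
- by rewrite min_r ?leey// -EFin_max max_r.
- by rewrite min_l ?leNye// max_l ?leNye.
Qed.

Lemma TV_le_clamp_split u a s b (M M1 : R) : mfun u -> (a <= s <= b)%R ->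
  TV_le mu (T a b u) M -> ~ TV_le mu (T a s u) M1 -> TV_le mu (T s b u) (M - M1).
Proof.
move=> mu_ asb; have /andP[as_ sb] := asb; have ab := le_trans as_ sb.
have Emin : T a s u = (fun x => (Num.min (clampE a b (u x)) s)%:E).
  by apply/funext => x; rewrite min_clampE.
have Emax : T s b u = (fun x => (Num.max (clampE a b (u x)) s)%:E).
  by apply/funext => x; rewrite max_clampE.
have mab := measurable_clampE ab mu_.
have mas := measurable_clampE as_ mu_; have msb := measurable_clampE sb mu_.
by rewrite Emin Emax in mas msb *; exact: (TV_le_split H).
Qed.

(** Continuity from above on a set of finite measure: the sets [{t < u < t + 1/n}] decrease to the
    empty set. *)
Lemma superlevel_itv_small u t r e : mfun u -> (0 < e)%R ->
  exists2 n : nat, (0 < n)%N &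
    mu (ball point r `&` [set x | t%:E < u x < (t + n%:R^-1)%:E]) <= e%:E.
Proof.
move=> mu_ e0; pose F n := ball point r `&` [set x | t%:E < u x < (t + n.+1%:R^-1)%:E].
have mF n : meas (F n).
  apply: measI; first exact: (measurable_ball H).
  have := mu_ (@measurableT _ (caratheodory_type mu)) `]t%:E, (t + n.+1%:R^-1)%:E[%classic.
  rewrite setTI => h; have := h (emeasurable_itv _).
  by congr (measurable _); apply/seteqP; split=> x /=; rewrite in_itv.
have F0 : \bigcap_n F n = set0.
  apply/seteqP; split=> // x hx.
  have [_ /andP[tx _]] := hx 0%N I.
  have hu n : u x < (t + n.+1%:R^-1)%:E by have [_ /andP[]] := hx n I.
  move: tx hu; case: (u x) => [q| |] // tq hq; last by have := hq 0%N.
  rewrite lte_fin in tq; pose n := Num.truncn (q - t)^-1.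
  have := hq n; rewrite lte_fin ltNge => /negP; apply.
  rewrite -lerBrDl invf_ple ?posrE ?ltr0n ?subr_gt0//; apply/ltW; exact: truncnS_gt.
have hc : mu (F n) @[n --> \oo] --> 0.
  rewrite -[X in _ --> X](outer_measure0 mu) -F0.
  apply: (@nonincreasing_cvg_mu _ (caratheodory_type mu) R mu F) => //.
  - by apply: (mu_bounded_fin H (x := point) (r := r)) => x [].
  - by rewrite F0; exact: (@measurable0 _ (caratheodory_type mu)).
  - move=> m n mn; apply/subsetPset => x [bx /andP[h1 h2]]; split=> //.
    rewrite /= h1; apply: (lt_le_trans h2); rewrite lee_fin lerD2l.
    by rewrite lef_pV2 ?posrE ?ltr0n// ler_nat.
have [N _ hN] := cvg0_near_lt _ e0 hc.
by exists N.+1 => //; apply: ltW; exact: (hN N (leqnn N)).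
Qed.

(** The variation as a real number, so that differences of variations make sense; informative only
    if some bound [TV_le] holds, in which case it is itself a bound. *)
Definition TV_inf f : R := inf [set M | TV_le mu f M].

Lemma TV_inf_le f (M : R) : TV_le mu f M -> (TV_inf f <= M)%R.
Proof.
by move=> tf; apply: inf_lbound => //; exists 0%R => M' /(TV_le_ge0 H).
Qed.

Lemma TV_le_TV_inf f (M : R) : TV_le mu f M -> TV_le mu f (TV_inf f).
Proof.
move=> tf; apply: TV_le_closed => e e0.
have [|M' tM' hM'] := @inf_adherent _ [set M | TV_le mu f M] _ e0.
  by split; [exists M | exists 0%R => ? /(TV_le_ge0 H)].
exact: TV_le_trans (ltW hM') tM'.
Qed.

Lemma TV_le_sub_clampE u a s b (M : R) : mfun u -> (a <= s <= b)%R ->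
  TV_le mu (T a b u) M -> TV_le mu (T a s u) M.
Proof.
move=> mu_ /andP[as_ sb] tab.
have E x : clampE a s (clampE a b (u x))%:E = clampE a s (u x).
  rewrite /= min_clampE ?as_// max_r//.
  by case: (u x) => [q| |] /=; rewrite ?lexx// le_max lexx.
have := TV_le_clampE H (a := a) (b := s) (measurable_clampE (le_trans as_ sb) mu_) _ tab.
under eq_fun do rewrite E; apply; exact: measurable_clampE.
Qed.

(** No number below the variation of the truncation to [[a, s]] bounds it, so [TV_le_clamp_split]
    applies with that variation minus [e], for every [e]. *)
Lemma TV_le_clampE_inf u a s b (M : R) : mfun u -> (a <= s <= b)%R ->
  TV_le mu (T a b u) M ->
  TV_le mu (T s b u) (TV_inf (T a b u) - TV_inf (T a s u)).
Proof.
move=> mu_ asb tab; apply: TV_le_closed => e e0.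
rewrite -addrA -[(_ + e)%R]opprK opprD opprK.
apply: (TV_le_clamp_split mu_ asb); first exact: TV_le_TV_inf tab.
by move=> /TV_inf_le; lra.
Qed.

(** The variation [F t] of the truncation to [[a, t]] is nondecreasing and grows by less than
    [K * (b - a)], so at some [t] arbitrarily short right difference quotients are at most [K]. The
    truncations to [[t, t + h]], rescaled to [[0, 1]], have variation at most [K] for these [h].
    They differ from the indicator of [{u > t}] by at most 1, and only where [t < u < t + h]; lower
    semicontinuity concludes. *)
Lemma TV_le_superlevel u a b (M K : R) : mfun u -> (a < b)%R ->
  TV_le mu (T a b u) M -> (M < K * (b - a))%R ->
  exists2 t, (a <= t < b)%R & TV_le mu (fun x => (\1_(superlevel u t) x)%:E) K.
Proof.
move=> mu_ ab tab MK; pose F t := TV_inf (T a t u).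
have tFF s t : (a <= s)%R -> (s <= t)%R -> (t <= b)%R ->
    TV_le mu (T s t u) (F t - F s).
  move=> as_ st tb; apply: (TV_le_clampE_inf (M := M)) => //; first by rewrite as_.
  by apply: TV_le_sub_clampE tab => //; rewrite tb (le_trans as_).
have mF s t : (a <= s)%R -> (s <= t)%R -> (t <= b)%R -> (F s <= F t)%R.
  by move=> h1 h2 h3; rewrite -subr_ge0; apply: (TV_le_ge0 H); exact: tFF.
have FK : (F b - F a < K * (b - a))%R.
  apply: le_lt_trans MK; have := TV_inf_le tab.
  have : (0 <= F a)%R.
    by apply: (TV_le_ge0 H); apply: (TV_le_TV_inf (M := M)); apply: TV_le_sub_clampE tab => //; rewrite lexx ltW.
  by rewrite -/(F b); clear; lra.
have [t tab' ht] := monotone_slope ab mF FK; exists t => //.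
have /andP[at_ tb] := tab'.
have mE : meas (superlevel u t) by exact: measurable_superlevel.
apply: (TV_le_lim H); first exact: measurable_indicE.
move=> r e e0; have [n n0 hn] := superlevel_itv_small t r mu_ e0.
have [|h [/andP[h0 hn'] hb FhK]] := ht (n%:R^-1)%R; first by rewrite invr_gt0 ltr0n.
have th : (t <= t + h)%R by rewrite lerDl ltW.
have mT := measurable_clampE th mu_.
pose f x := (h^-1 * clampE t (t + h) (u x) + - (h^-1 * t))%R.
have hV : (0 < h^-1)%R by rewrite invr_gt0.
have mf : mfun (EFin \o f).
  apply/(@measurable_EFinP _ (caratheodory_type mu)).
  apply: (@measurable_funD _ (caratheodory_type mu)); last exact: measurable_cst.
  apply: (@measurable_funM _ (caratheodory_type mu)); first exact: measurable_cst.
  exact/(@measurable_EFinP _ (caratheodory_type mu)).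
exists f; split => //.
  apply: (@TV_le_trans _ _ _ _ (h^-1 * (F (t + h) - F t))%R).
    by rewrite mulrC ler_pdivrMr//; apply: le_trans FhK _; rewrite ler_wpM2r ?lerDl// ltW.
  by apply: (TV_le_affine H) => //; exact: tFF.
set I := [set x | t%:E < u x < (t + n%:R^-1)%:E] in hn.
have mI : meas (superlevel u t `&` [set x | u x < (t + n%:R^-1)%:E]).
  apply: measI => //.
  have := mu_ (@measurableT _ (caratheodory_type mu)) `]-oo, (t + n%:R^-1)%:E[%classic.
  by rewrite setTI preimage_itvNyo; apply; exact: emeasurable_itv.
have IE : I = superlevel u t `&` [set x | u x < (t + n%:R^-1)%:E].
  by apply/seteqP; split=> [x /andP[]|x [h1 h2]]//; apply/andP.
rewrite -IE in mI; apply: le_trans hn; rewrite setIC -int_indic//; last exact: (measurable_ball H).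
apply: int_le; [exact: (measurable_ball H)| |exact: ge0_measurable_indic|].
  by apply: ge0_measurable_dist => //; exact: measurable_indicE.
move=> x _; rewrite -EFinB abse_EFin lee_fin !indicE /f -mulrBr mulrC.
have := clampE_quotient_dist t (u x) h0 (ltW hn').
have -> : (x \in superlevel u t) = (t%:E < u x) by apply/idP/idP => [/set_mem|/mem_set].
by have -> : (x \in I) = (t%:E < u x < (t + n%:R^-1)%:E) by apply/idP/idP => [/set_mem|/mem_set].
Qed.

(* The variations of the truncations to the disjoint intervals [k, k + 1] add
   up to at most the variation of [u]. *)
Lemma TV_le_clampE_tail u (M e : R) (k0 : nat) : mfun u -> TV_le mu u M -> (0 < e)%R ->
  exists2 k : nat, (k0 <= k)%N & TV_le mu (T k%:R k.+1%:R u) e.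
Proof.
move=> mu_ tu e0; apply: contrapT => nk.
have nT k : (k0 <= k)%N -> ~ TV_le mu (T k%:R k.+1%:R u) e.
  by move=> kk tk; apply: nk; exists k.
have hn n m : TV_le mu (T (k0 + n)%:R (k0 + n + m)%:R u) (M - n%:R * e).
  elim: n m => [|n IH] m.
    rewrite mul0r subr0 addn0; apply: (TV_le_clampE H) => //.
    by apply: (measurable_clampE _ mu_); rewrite ler_nat leq_addr.
  have h : TV_le mu (T (k0 + n).+1%:R (k0 + n + m.+1)%:R u) (M - n%:R * e - e).
    apply: (TV_le_clamp_split mu_ _ (IH m.+1) (nT (k0 + n)%N (leq_addr _ _))).
    by rewrite !ler_nat leqnSn addnS ltnS leq_addr.
  by rewrite addnS addSnnS -[n.+1%:R]natr1 mulrDl mul1r opprD addrA.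
pose n := (Num.truncn (M / e)).+1.
have := TV_le_ge0 H (hn n 0%N); rewrite leNgt => /negP; apply.
by rewrite subr_lt0 -ltr_pdivrMr//; exact: truncnS_gt.
Qed.

End coarea.

(** * Codimension 1 content and the boxing inequality *)

Section covers.
Context {R : realType} {X : completeMetricType R}.
Context (mu : {outer_measure set X -> \bar R}).
Implicit Types (A : set X) (p : X * R) (e : R).
Local Open Scope ereal_scope.

Definition ball_weight p : \bar R := mu (ball p.1 p.2) * (p.2^-1)%:E.

(** A bound on the codimension 1 content at scale 1, witnessed by one cover. The balls form a set of
    pairs (centre, radius) rather than a sequence, so that covers are merged by taking unions. *)
Definition cover_le A e := exists D : set (X * R),
  [/\ forall p, D p -> (0 < p.2 <= 1)%R,
      A `<=` \bigcup_(p in D) ball p.1 p.2 &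
      \esum_(p in D) ball_weight p <= e%:E].

Lemma ball_weight_ge0 p : 0 <= ball_weight p.
Proof.
rewrite /ball_weight; have [p0|p0] := leP 0%R p.2.
  by rewrite mule_ge0 ?outer_measure_ge0// lee_fin invr_ge0.
suff -> : ball p.1 p.2 = set0 by rewrite outer_measure0 mul0e.
by apply/seteqP; split=> // y /in_ball; have := mdist_ge0 p.1 y; lra.
Qed.

Lemma cover_le_sub A B e : A `<=` B -> cover_le B e -> cover_le A e.
Proof. by move=> AB [D [h1 h2 h3]]; exists D; split=> //; exact: subset_trans h2. Qed.

Lemma esum_le_seq (T : choiceType) (D : set T) (a : T -> \bar R) (M : \bar R) :
  (forall s : seq T, uniq s -> (forall i, i \in s -> D i) ->
    \sum_(i <- s) a i <= M) -> \esum_(i in D) a i <= M.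
Proof.
move=> h; apply: ge_ereal_sup => _ [F [finF FD] <-].
rewrite fsbig_finite//=; apply: h => [|i]; first exact: fset_uniq.
by rewrite in_fset_set// => /set_mem/FD.
Qed.

Lemma le_esum_seq (T : choiceType) (D : set T) (a : T -> \bar R) (s : seq T) :
  uniq s -> (forall i, i \in s -> D i) ->
  \sum_(i <- s) a i <= \esum_(i in D) a i.
Proof.
move=> us sD; apply: ereal_sup_ubound; exists [set` s].
  by split=> // i /=; exact: sD.
by rewrite -fsbig_seq.
Qed.

Lemma esum_subset (T : choiceType) (D D' : set T) (a : T -> \bar R) :
  D `<=` D' -> \esum_(i in D) a i <= \esum_(i in D') a i.
Proof.
move=> DD; apply: ereal_sup_le => _ [F [finF FD] <-]; exists F => //.
by split=> //; exact: subset_trans DD.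
Qed.

Lemma cover_le_bigcup (A : nat -> set X) e : (0 <= e)%R ->
  (forall n, cover_le (A n) (e / (2 ^ n.+1)%:R)) -> cover_le (\bigcup_n A n) e.
Proof.
move=> e0 hA; pose D n := sval (cid (hA n)); have hD n := svalP (cid (hA n)).
exists (\bigcup_n D n); split.
- by move=> p [n _]; have [h _ _] := hD n; exact: h.
- move=> x [n _ Anx]; have [_ h _] := hD n; have [p Dp px] := h _ Anx.
  by exists p => //; exists n.
- rewrite seqDU_bigcup_eq nneseries_sum_bigcup; last 2 first.
  + exact: trivIset_seqDU.
  + exact: ball_weight_ge0.
  apply: le_trans (epsilon_trick0 xpredT e0); apply: lee_nneseries.
    by move=> n *; apply: esum_ge0 => p _; exact: ball_weight_ge0.
  move=> n *; have [_ _] := hD n; apply: le_trans.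
  by apply: esum_subset; exact: subset_seqDU.
Qed.

(** The content grows as the scale shrinks, so a zero limit forces zero content already at scale
    [1 / 2]. *)
Lemma cover_le_codim1_Hausdorff (N : set X) e : (0 < e)%R ->
  codim1_Hausdorff mu N = 0 -> cover_le N e.
Proof.
move=> e0; rewrite /codim1_Hausdorff => hN.
have mono : {in `]0%R, 1%R[ &, {homo (codim1_content mu)^~ N : r s / (r <= s)%R >-> s <= r}}.
  move=> r s _ _ rs; apply/ereal_inf_le_tmp => _ [I [x [d [hd cd ->]]]].
  exists I, x, d; split=> // i /hd/andP[d0 dr]; apply/andP; split=> //; exact: le_trans rs.
have lt01 : (BRight 0%R < BLeft (1%R : R))%O by rewrite bnd_simp.
have hcv := @nonincreasing_at_right_cvge R _ 0%R (BLeft 1%R) lt01 mono.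
have : codim1_content mu 2^-1 N <= 0.
  rewrite -hN (cvg_lim _ hcv)//; apply: ereal_sup_ubound; exists (2^-1)%R => //.
  by rewrite /= in_itv/=; apply/andP; split; lra.
move=> h; have : codim1_content mu 2^-1 N < e%:E by apply: le_lt_trans h _; rewrite lte_fin.
move=> /ereal_inf_lt[_ [I [x [d [hd cd ->]]]] hlt].
pose f i := (x i, d i).
exists (f @` I); split.
- by move=> _ [i Ii <-] /=; have /andP[d0 d1] := hd _ Ii; rewrite d0/=; lra.
- by move=> y /cd[i Ii yi]; exists (f i) => //; exists i.
- apply: le_trans (ltW hlt); apply: le_trans (_ : _ <= \esum_(i in I) ball_weight (f i)) _; last first.
    apply: le_esum => i Ii; rewrite /ball_weight /= inver gt_eqF//.
    by have /andP[] := hd _ Ii.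
  apply: esum_le_seq => s us sI.
  (* Several indices may give the same ball; choosing one index for each ball turns a sum over balls
     into a sum over distinct indices. *)
  have hs p : exists i, p \in s -> I i /\ f i = p.
    by have [/sI[i Ii fi]|_] := boolP (p \in s); [exists i | exists 0%N].
  pose j p := sval (cid (hs p)); have hj p := svalP (cid (hs p)).
  have -> : \sum_(p <- s) ball_weight p = \sum_(i <- map j s) ball_weight (f i).
    rewrite big_map big_seq [RHS]big_seq; apply: eq_bigr => p /hj[_].
    by rewrite -/(j p) => ->.
  apply: le_esum_seq.
    rewrite map_inj_in_uniq// => p q /hj[_ hp] /hj[_ hq] jpq.
    by rewrite -hp -hq -/(j p) -/(j q) jpq.
  by move=> i /mapP[p /hj[Ip _] ->].
Qed.

End covers.

Section boxing.
Context {R : realType} {X : completeMetricType R}.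
Context (mu : {outer_measure set X -> \bar R}) (Cd CP lambda : R).
Hypothesis H : PI_space mu Cd CP lambda.
Implicit Types (x y z : X) (r s : R) (A B E W : set X) (v : X -> R) (g : X -> \bar R).
Local Open Scope ereal_scope.
Local Notation int := (mu_int mu).
Local Notation meas := (mu_measurable mu).

(** Only the energy is restricted to [W]; the approximants live on all of [X] and converge to [1_E]
    on every ball. This stands in for a bound on the perimeter of [E] in [W]. *)
Definition TV_le_on W E (tau : R) := forall r e : R, (0 < e)%R -> exists v g,
  [/\ admissible v g, int W g <= (tau + e)%:E &
      int (ball point r) (fun x => `|(v x)%:E - (\1_E x)%:E|) <= e%:E].

Lemma seq_bounded (T : eqType) (s : seq T) (f : T -> R) :
  exists2 Q, (0 < Q)%R & forall p, p \in s -> (f p <= Q)%R.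
Proof.
elim: s => [|a s [Q Q0 hQ]]; first by exists 1%R.
exists (Num.max Q (f a)); first by rewrite lt_max Q0.
move=> p; rewrite inE => /predU1P[->|/hQ h]; rewrite le_max ?lexx ?orbT//.
by rewrite h.
Qed.

(** At each [y] both [E] and its complement fill a fixed share of [ball y (rho y)], so the relative
    isoperimetric inequality bounds [mu (ball y (rho y)) / rho y] by the energy in the [lambda]
    times larger ball. These larger balls are made disjoint by the Vitali covering, and their
    energies add up to at most the energy on [W]. *)
Lemma boxing (c0 : R) : (0 < c0)%R -> exists2 C : R, (0 < C)%R &
  forall E W Y (rho : X -> R) (tau : R), meas E -> meas W -> (0 <= tau)%R ->
    TV_le_on W E tau ->
    (forall y, Y y -> (0 < rho y)%R /\ (5 * (lambda * rho y) <= 1)%R) ->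
    (forall y, Y y -> ball y (lambda * rho y)%R `<=` W) ->
    (forall y, Y y -> c0%:E * mu (ball y (rho y)) <=
       mine (mu (E `&` ball y (rho y))) (mu (ball y (rho y) `\` E))) ->
    cover_le mu Y (C * tau).
Proof.
move=> c00; have l1 := PI_lambda_ge1 H; have CP0 := PI_CP_gt0 H.
have l0 : (0 < lambda)%R by lra.
have [C1 C10 hC1] := doubling_compare H (5 * lambda).
exists (C1 * CP / c0)%R; first by rewrite divr_gt0// mulr_gt0.
move=> E W Y rho tau mE mW tau0 tW Yrho YW Ymin.
have [|D [DY tD covD]] := @vitali_covering R X Y (fun y => lambda * rho y)%R 1%R.
  by move=> y /Yrho[h1 h2]; rewrite mulr_gt0//=; have := mulr_gt0 l0 h1; lra.
pose f y : X * R := (y, 5 * (lambda * rho y))%R.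
exists (f @` D); split.
- by move=> _ [y /DY/Yrho[h1 h2] <-] /=; rewrite h2 andbT !mulr_gt0.
- by move=> y Yy; have [z Dz yz] := covD _ Yy; exists (f z); [exists z|apply: yz; apply: ballxx;
    have [h _] := Yrho _ Yy; rewrite mulr_gt0].
apply: esum_le_seq => s us sD.
pose B (p : X * R) : set X := ball p.1 (p.2 / 5)%R.
have pf p : p \in s -> [/\ D p.1, (p.2 = 5 * (lambda * rho p.1))%R & B p = ball p.1 (lambda * rho p.1)%R].
  by move=> /sD[y Dy <-]; split=> //; rewrite /B /=; congr ball; rewrite [LHS]mulrC mulKf// pnatr_eq0.
have tB : trivIset [set` s] B.
  move=> p q ps qs; have [Dp ep Bp] := pf _ ps; have [Dq eq_ Bq] := pf _ qs.
  rewrite Bp Bq => h; have pq : p.1 = q.1 by exact: tD h.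
  by move: ep eq_; rewrite pq => <-; case: p q pq {ps qs Dp Bp Dq Bq h} => [? ?] [? ?] /= -> ->.
have mB p : meas (B p) by exact: (measurable_ball H).
have [r r0 hr] := seq_bounded s (fun p : X * R => mdist point p.1 + 1)%R.
have BU p : p \in s -> B p `<=` ball point r.
  move=> ps; apply: sub_ball; apply: le_trans (hr _ ps); rewrite lerD2l.
  have [Dp -> _] := pf _ ps; have [_] := Yrho _ (DY _ Dp); lra.
(* The [L^1] error of an approximant is divided by the radius. The tolerance [e] is chosen only
   after the finite family [s], whose inverse radii are bounded by [Q]. *)
have [Q Q0 hQ] := seq_bounded s (fun p : X * R => (rho p.1)^-1)%R.
apply/lee_addgt0Pr => d d0.
pose K := (C1 * CP / c0 + C1 / c0 * Q)%R.
have K0 : (0 < K)%R by apply: addr_gt0; [rewrite divr_gt0// mulr_gt0|rewrite mulr_gt0// divr_gt0].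
pose e := (d / K)%R; have e0 : (0 < e)%R by rewrite divr_gt0.
have [v [g [avg hg hv]]] := tW r e e0; have [lv ugv] := avg.
have gg := admissible_ge0 H avg.
have gd : ge0_measurable mu (fun x => `|(v x)%:E - (\1_E x)%:E|).
  by apply: ge0_measurable_dist; [exact: (admissible_measurable H avg)|exact: measurable_indicE].
set dist := (fun x => `|(v x)%:E - (\1_E x)%:E|) in hv gd.
have wle p : p \in s -> ball_weight mu p <=
    (C1 * CP / c0)%:E * int (B p) g + (C1 / c0 * Q)%:E * int (B p) dist.
  move=> ps; have [Dp ep Bp] := pf _ ps; have [rp _] := Yrho _ (DY _ Dp).
  set b := mu (ball p.1 (rho p.1)).
  have w1 : ball_weight mu p <= (C1 / rho p.1)%:E * b.
    rewrite /ball_weight muleC mulrC EFinM -muleA; apply: lee_pmul.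
    - by rewrite lee_fin invr_ge0 ep ltW// !mulr_gt0.
    - exact: outer_measure_ge0.
    - rewrite lee_fin lef_pV2 ?posrE// ep ?mulr_gt0// mulrA ler_peMl// ?ltW//.
      by lra.
    - by apply: hC1 => //; rewrite ?ep ?mulrA// mdistxx !mulr_ge0// ltW.
  have w2 : b <= c0^-1%:E * ((CP * rho p.1)%:E * int (B p) g + int (B p) dist).
    rewrite lee_pdivlMl//; apply: le_trans (Ymin _ (DY _ Dp)) _.
    apply: le_trans (relative_isoperimetric H p.1 mE rp lv ugv) _.
    rewrite Bp leeD2l//; apply: int_subset;
      [exact: (measurable_ball H)|exact: (measurable_ball H)|exact: gd|].
    by apply: sub_ball_center; rewrite ler_peMl// ltW.
  apply: le_trans w1 _; apply: le_trans (lee_wpmul2l _ w2) _.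
    by rewrite lee_fin divr_ge0// ltW.
  have i1 : 0 <= int (B p) g by exact: int_ge0.
  have i2 : 0 <= int (B p) dist by exact: int_ge0.
  rewrite muleA ge0_muleDr//; last by rewrite mule_ge0// lee_fin mulr_ge0// ltW.
  rewrite muleA -!EFinM leeD// lee_wpmul2r// lee_fin.
    by rewrite le_eqVlt; apply/orP; left; apply/eqP; field; rewrite !gt_eqF.
  rewrite mulrAC ler_wpM2l ?divr_ge0 ?(ltW C10) ?(ltW c00)//. exact: (hQ p ps).
have -> : (C1 * CP / c0 * tau)%:E + d%:E = (C1 * CP / c0)%:E * (tau + e)%:E + (C1 / c0 * Q)%:E * e%:E.
  rewrite -!EFinM -!EFinD; congr EFin.
  by rewrite mulrDr -addrA -mulrDl -/K /e mulrC (mulrC K) divfK// gt_eqF.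
apply: le_trans (_ : _ <= \sum_(p <- s) ((C1 * CP / c0)%:E * int (B p) g + (C1 / c0 * Q)%:E * int (B p) dist)) _.
  by rewrite big_seq [leRHS]big_seq; apply: lee_sum => p /wle.
have k1 : (0 <= C1 * CP / c0)%R by rewrite divr_ge0 ?mulr_ge0// ltW.
have k2 : (0 <= C1 / c0 * Q)%R by rewrite mulr_ge0 ?divr_ge0// ltW.
rewrite big_split/=; apply: leeD.
- rewrite -ge0_sume_distrr; last by move=> p _; exact: int_ge0.
  apply: lee_wpmul2l => //; apply: le_trans hg; apply: int_disjoint_sum => //.
  by move=> p ps; have [Dp _ ->] := pf _ ps; apply/YW/DY.
- rewrite -ge0_sume_distrr; last by move=> p _; exact: int_ge0.
  apply: lee_wpmul2l => //; apply: le_trans hv; apply: int_disjoint_sum => //.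
  exact: (measurable_ball H).
Qed.

End boxing.

Section distance_to_a_set.
Context {R : realType} {X : completeMetricType R}.
Implicit Types (x y : X) (r s : R) (A : set X).

Definition dist_set A x : R := inf [set mdist x a | a in A].

Definition thickening A r : set X := [set x | dist_set A x < r].

Lemma dist_set_has_inf A x : A !=set0 -> has_inf [set mdist x a | a in A].
Proof.
move=> [a Aa]; split; first by exists (mdist x a), a.
by exists 0 => _ [b _ <-]; exact: mdist_ge0.
Qed.

Lemma dist_set_le A x a : A a -> dist_set A x <= mdist x a.
Proof.
by move=> Aa; apply: inf_lbound; [case: (dist_set_has_inf x (ex_intro _ a Aa))|exists a].
Qed.

Lemma dist_set_triangle A x y : A !=set0 -> dist_set A x <= dist_set A y + mdist x y.
Proof.
move=> A0; rewrite -lerBlDr; apply: lb_le_inf; first by case: (dist_set_has_inf y A0).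
move=> _ [a Aa <-]; rewrite lerBlDr; apply: le_trans (dist_set_le x Aa) _.
by rewrite addrC; exact: metric_triangle.
Qed.

Lemma dist_set_Lipschitz A x y : A !=set0 ->
  `|dist_set A x - dist_set A y| <= mdist x y.
Proof.
move=> A0; have := dist_set_triangle x y A0; have := dist_set_triangle y x A0.
by rewrite (metric_sym y x) ler_norml => h1 h2; apply/andP; split; lra.
Qed.

Lemma thickeningP A r x : A !=set0 ->
  thickening A r x <-> exists2 a, A a & mdist x a < r.
Proof.
move=> A0; split=> [h|[a Aa ar]]; last exact: le_lt_trans (dist_set_le x Aa) ar.
have [_ [a Aa <-] ar] := inf_lt (dist_set_has_inf x A0).1 h.
by exists a.
Qed.

Lemma dist_set_continuous A : A !=set0 -> continuous (dist_set A).
Proof.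
move=> A0 x; apply/cvgrPdist_le => e e0; apply/nbhs_ballP; exists e => //= y /in_ball xy.
by apply: le_trans (dist_set_Lipschitz _ _ A0) _; exact: ltW.
Qed.

Lemma open_thickening A r : A !=set0 -> open (thickening A r).
Proof.
move=> /dist_set_continuous/continuousP h; exact: (h _ (@open_lt _ r)).
Qed.

Lemma thickening_sub A r s : r <= s -> thickening A r `<=` thickening A s.
Proof. by move=> rs x /lt_le_trans; apply. Qed.

Lemma thickening_ball A r s t x : A !=set0 -> thickening A r x -> r + s <= t ->
  ball x s `<=` thickening A t.
Proof.
move=> A0 xr rst y /in_ball xy; apply: le_lt_trans (dist_set_triangle y x A0) _.
by move: xr; rewrite /thickening/= metric_sym; lra.
Qed.

Lemma thickening_bounded A x r s : A !=set0 -> A `<=` ball x r ->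
  thickening A s `<=` ball x (r + s).
Proof.
move=> A0 Ax y /(thickeningP _ _ A0)[a /Ax/in_ball xa ya]; apply/in_ball.
by have := metric_triangle x a y; rewrite (metric_sym a y); lra.
Qed.

End distance_to_a_set.

(** * Sparse sets at a single scale *)

Section single_scale.
Context {R : realType} {X : completeMetricType R}.
Context (mu : {outer_measure set X -> \bar R}) (Cd CP lambda : R).
Hypothesis H : PI_space mu Cd CP lambda.
Implicit Types (x y z : X) (r s : R) (A B E V W : set X) (v : X -> R) (g : X -> \bar R).
Local Open Scope ereal_scope.
Local Notation int := (mu_int mu).
Local Notation meas := (mu_measurable mu).

Lemma mu_setID E B : meas E -> mu B = mu (E `&` B) + mu (B `\` E).
Proof. by move=> mE; rewrite (mE B) setIC setDE. Qed.

Lemma half_density E x r (c : R) : meas E -> (c <= 1 / 2)%R ->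
  mu (E `&` ball x r) <= c%:E * mu (ball x r) ->
  c%:E * mu (ball x r) <= mu (ball x r `\` E) /\
  mu (E `&` ball x r) <= mu (ball x r `\` E).
Proof.
move=> mE c2; have := mu_setID (ball x r) mE.
have fI : mu (E `&` ball x r) \is a fin_num.
  by rewrite ge0_fin_numE ?outer_measure_ge0//; apply: (mu_bounded_fin H (x := x) (r := r)) => y [].
have fD : mu (ball x r `\` E) \is a fin_num.
  by rewrite ge0_fin_numE ?outer_measure_ge0//; apply: (mu_bounded_fin H (x := x) (r := r)) => y [].
have := outer_measure_ge0 mu (E `&` ball x r).
have := outer_measure_ge0 mu (ball x r `\` E).
rewrite -(fineK fI) -(fineK fD) -(fineK (mu_ball_fin_num H x r)).
move: (fine _) (fine _) (fine _) => q p m; rewrite -EFinD -!EFinM !lee_fin.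
by move=> h1 h2 [->] h3; split; nra.
Qed.

Lemma sume_cst (T : Type) (s : seq T) (c : \bar R) : 0 <= c ->
  \sum_(y <- s) c = (size s)%:R%:E * c.
Proof.
move=> c0; elim: s => [|y s IH]; first by rewrite big_nil mul0e.
rewrite big_cons IH /= -[(size s).+1%:R]natr1 EFinD ge0_muleDl ?lee_fin//.
by rewrite mul1e addeC.
Qed.

(** Bounded overlap: a point lies in at most [N] of the enlarged balls, because their centres are
    separated at scale [rho / 5]. *)
Lemma overlap_sum : exists N : nat, forall rho (s : seq X) W (h : X -> \bar R),
  (0 < rho)%R -> uniq s -> trivIset [set` s] (fun y => ball y (rho / 5)%R) ->
  meas W -> (forall y, y \in s -> ball y (lambda * rho)%R `<=` W) ->
  ge0_measurable mu h ->
  \sum_(y <- s) int (ball y (lambda * rho)%R) h <= N%:R%:E * int W h.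
Proof.
have [N hN] := separated_size H (5 * lambda).
exists N => rho s W h rho0 us ts mW sW gh; have [h0 mh] := gh.
pose B y : set X := ball y (lambda * rho)%R.
have mB y : meas (B y) by exact: (measurable_ball H).
rewrite (_ : \sum_(y <- s) _ = \sum_(y <- s) int W (h \_ (B y))); last first.
  rewrite big_seq [RHS]big_seq; apply: eq_bigr => y ys.
  by rewrite int_restrict; congr (mu_int _ _ _); apply/esym/setIidPr; exact: sW.
rewrite -(@ge0_integral_sum _ (caratheodory_type mu)) //=; last 2 first.
- move=> y; apply: measurable_funT => //.
  by case: (ge0_measurable_restrict (mB y) gh).
- by move=> y x _; rewrite patchE; case: ifP.
rewrite -intZ//; apply: int_le => //.
- split; first by move=> x; apply: sume_ge0 => y _; rewrite patchE; case: ifP.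
  apply: (@emeasurable_fun_sum _ (caratheodory_type mu)) => y.
  by case: (ge0_measurable_restrict (mB y) gh).
- exact: ge0_measurableZ.
move=> z _; rewrite (eq_bigr (fun y => if z \in B y then h z else 0)); last first.
  by move=> y _; rewrite patchE.
rewrite -big_mkcond -big_filter sume_cst//.
rewrite lee_wpmul2r// lee_fin ler_nat.
apply: (hN z (rho / 5)%R); [by rewrite divr_gt0|exact: filter_uniq| |].
- by apply: sub_trivIset ts => y /=; rewrite mem_filter => /andP[].
- move=> y; rewrite mem_filter => /andP[/set_mem/in_ball yz _].
  rewrite metric_sym; apply: le_trans (ltW yz) _; have := PI_lambda_ge1 H; lra.
Qed.

(** On a ball where [E] fills at most half, the minimum in the relative isoperimetric inequality is
    the measure of [E]; balls of bounded overlap sum this up. The gain is the factor [rho] in front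
    of the energy: near its sparse points [E] itself has little measure. *)
Lemma single_scale : exists2 N : R, (0 < N)%R & forall E V W rho v g x r,
  meas E -> meas V -> meas W -> (0 < rho)%R -> V `<=` ball x r ->
  (forall y, V y -> ball y (lambda * rho)%R `<=` W) ->
  (forall y, V y -> mu (E `&` ball y rho) <= (1 / 2)%:E * mu (ball y rho)) ->
  admissible v g ->
  mu (E `&` V) <= N%:E * ((CP * rho)%:E * int W g +
    int W (fun y => `|(v y)%:E - (\1_E y)%:E|)).
Proof.
have [N hN] := overlap_sum; exists N.+1%:R; first by rewrite ltr0n.
move=> E V W rho v g x r mE mV mW rho0 Vx VW Vhalf avg.
have [lv ugv] := avg; have l1 := PI_lambda_ge1 H; have CP0 := PI_CP_gt0 H.
have r5 : (0 < rho / 5)%R by rewrite divr_gt0.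
have [|D [DV tD covD]] := @vitali_covering R X V (fun=> rho / 5)%R (rho / 5)%R.
  by move=> y _; rewrite r5 lexx.
have finD : finite_set D by apply: (separated_finite H _ r5 tD); exact: subset_trans DV Vx.
pose s := enum_fset (fset_set D).
have sD y : y \in s -> D y by rewrite in_fset_set// => /set_mem.
have Ds y : D y -> y \in s by move=> Dy; rewrite in_fset_set//; exact: mem_set.
have gg := admissible_ge0 H avg.
set dist := (fun y => `|(v y)%:E - (\1_E y)%:E|).
have gd : ge0_measurable mu dist.
  by apply: ge0_measurable_dist; [exact: (admissible_measurable H avg)|exact: measurable_indicE].
have mB y r' : meas (ball y r') by exact: (measurable_ball H).
apply: (@le_trans _ _ (\sum_(y <- s) mu (E `&` ball y rho))).
  have -> : mu (E `&` V) = mu (E `&` V `&` \big[setU/set0]_(y <- s) (E `&` ball y rho)).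
    congr (mu _); apply/seteqP; split=> [y [Ey Vy]|y []//]; split=> //.
    have [z Dz yz] := covD _ Vy; rewrite -bigcup_seq; exists z => /=; first exact: Ds.
    split=> //; have -> : rho = (5 * (rho / 5))%R by rewrite mulrC divfK.
    by apply: yz; exact: ballxx.
  apply: le_trans (le_outer_measure mu _ _ (@subIsetr _ _ _)) _.
  elim: (s) => [|y s' IH]; first by rewrite !big_nil outer_measure0.
  rewrite !big_cons; apply: le_trans (outer_measureU2 _ _ _) _; exact: leeD2l.
apply: (@le_trans _ _ (\sum_(y <- s) ((CP * rho)%:E * int (ball y (lambda * rho)%R) g +
    int (ball y (lambda * rho)%R) dist))).
  rewrite big_seq [leRHS]big_seq; apply: lee_sum => y /sD/DV Vy.
  have [_ h2] := half_density mE (lexx _) (Vhalf _ Vy).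
  have := relative_isoperimetric H y mE rho0 lv ugv.
  rewrite min_l// => h; apply: le_trans h _; apply: leeD2l; apply: int_subset => //.
  by apply: sub_ball_center; rewrite ler_peMl// ltW.
have iW0 f : ge0_measurable mu f -> 0 <= int W f by exact: int_ge0.
have sum_le f : ge0_measurable mu f ->
    \sum_(y <- s) int (ball y (lambda * rho)%R) f <= N.+1%:R%:E * int W f.
  move=> gf; apply: (@le_trans _ _ (N%:R%:E * int W f)).
    apply: hN => //; first exact: fset_uniq.
    - by apply: sub_trivIset tD => y /=; exact: sD.
    - by move=> y /sD/DV; exact: VW.
  by rewrite lee_wpmul2r ?iW0// lee_fin ler_nat.
have k0 : (0 <= CP * rho)%R by rewrite mulr_ge0// ltW.
rewrite big_split/= ge0_muleDr ?iW0//; last by rewrite mule_ge0 ?iW0.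
apply: leeD; last exact: sum_le.
rewrite -ge0_sume_distrr; last by move=> y _; exact: int_ge0.
by rewrite muleCA; apply: lee_wpmul2l => //; exact: sum_le.
Qed.

(** [R0] is halved until the density of [E] first reaches [c0]. At twice that radius it was still
    below [c0], so by doubling it is now at most [Cd * c0 <= 1 / 2], and the complement keeps a
    share as well. *)
Lemma crossing_radius E y R0 (c0 : R) : meas E -> (0 < R0)%R -> (0 < c0)%R ->
  (Cd * c0 <= 1 / 2)%R -> mu (E `&` ball y R0) <= c0%:E * mu (ball y R0) ->
  (exists2 r0, (0 < r0)%R & forall r, (0 < r < r0)%R ->
     c0%:E * mu (ball y r) <= mu (E `&` ball y r)) ->
  exists2 rho, (0 < rho <= R0)%R & c0%:E * mu (ball y rho) <=
    mine (mu (E `&` ball y rho)) (mu (ball y rho `\` E)).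
Proof.
move=> mE R00 c00 Cc hR [r0 r00 hr0].
have Cd1 := PI_Cd_ge1 H; have c2 : (c0 <= 1 / 2)%R by apply: le_trans Cc; rewrite ler_peMl// ltW.
pose rj (j : nat) := (R0 / 2 ^+ j)%R.
have rj0 j : (0 < rj j)%R by rewrite divr_gt0// exprn_gt0.
pose P j := c0%:E * mu (ball y (rj j)) <= mu (E `&` ball y (rj j)).
have exP : exists j, P j.
  exists (Num.Def.archi_bound (R0 / r0)); apply: hr0; rewrite rj0/= /rj.
  by rewrite ltr_pdivrMr ?exprn_gt0// mulrC -ltr_pdivrMr//; exact: upper_nthrootP.
have [j Pj minj] := ex_minnP exP.
exists (rj j).
  rewrite rj0/= /rj ler_pdivrMr ?exprn_gt0//; apply: ler_peMr; first exact: ltW.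
  by apply: exprn_ege1; rewrite ler1n.
rewrite le_min; apply/andP; split; first exact: Pj.
suff h : mu (E `&` ball y (rj j)) <= (1 / 2)%:E * mu (ball y (rj j)).
  have [h1 _] := half_density mE (lexx _) h; apply: le_trans h1.
  by rewrite lee_wpmul2r// outer_measure_ge0.
case: j Pj minj => [|j] Pj minj.
  rewrite {1}/rj {1}/rj expr0 divr1; apply: le_trans hR _.
  by rewrite lee_wpmul2r// outer_measure_ge0.
have nPj : ~~ P j by apply/negP => /minj; rewrite ltnn.
move: nPj; rewrite /P -ltNge => nPj.
have r2 : (2 * rj j.+1 = rj j)%R.
  by rewrite /rj exprS invfM mulrCA mulVKf.
apply: (@le_trans _ _ (c0%:E * mu (ball y (rj j)))).
  apply: le_trans (ltW nPj); apply: le_outer_measure; apply: setIS.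
  by apply: sub_ball_center; have := rj0 j.+1; rewrite -r2; lra.
have [_ hd _] := PI_doubling H y (rj0 j.+1); rewrite -r2.
apply: le_trans (lee_wpmul2l _ hd) _; first by rewrite lee_fin ltW.
by rewrite muleA -EFinM mulrC lee_wpmul2r// outer_measure_ge0.
Qed.

End single_scale.

(** * Quasi-openness of the set of density zero *)

Section cutoff.
Context {R : realType} {X : completeMetricType R}.
Context (mu : {outer_measure set X -> \bar R}) (Cd CP lambda : R).
Hypothesis H : PI_space mu Cd CP lambda.
Implicit Types (x y z : X) (r s : R) (A B E V W : set X) (v : X -> R) (g : X -> \bar R).
Local Open Scope ereal_scope.
Local Notation int := (mu_int mu).
Local Notation meas := (mu_measurable mu).

(** Chebyshev's inequality off [E], where [v > theta] means that [v] is more than [theta] away from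
    [1_E]. *)
Lemma chebyshev v g E W (theta : R) : meas E -> meas W -> admissible v g ->
  (0 < theta)%R ->
  mu ([set x | (theta < v x)%R] `&` W) <=
    mu (E `&` W) + (theta^-1)%:E * int W (fun x => `|(v x)%:E - (\1_E x)%:E|).
Proof.
move=> mE mW avg th0; set U := [set x | _].
have mU : meas U.
  by apply: (measurable_openX H); apply: continuous_open_gt; exact: (Lip_loc_continuous H avg.1).
have gd : ge0_measurable mu (fun y => `|(v y)%:E - (\1_E y)%:E|).
  by apply: ge0_measurable_dist; [exact: (admissible_measurable H avg)|exact: measurable_indicE].
have mZ : meas (U `\` E) by exact: measD.
apply: le_trans (_ : mu ((E `&` W) `|` ((U `\` E) `&` W)) <= _).
  by apply: le_outer_measure => x [Ux Wx]; have [Ex|nEx] := pselect (E x); [left|right].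
apply: le_trans (outer_measureU2 _ _ _) _; apply: leeD2l.
rewrite lee_pdivlMl// -int_indic// -intZ//; [|exact: ltW|exact: ge0_measurable_indic].
apply: int_le => //; first by apply: ge0_measurableZ; [exact: ltW|exact: ge0_measurable_indic].
move=> x _; rewrite indicE; case: (boolP (x \in U `\` E)) => [/set_mem[Ux nEx]|_]; last first.
  by rewrite mule0.
rewrite mule1 indicE memNset// sube0 abse_EFin lee_fin.
by apply: le_trans (ler_norm _); exact: ltW.
Qed.

Definition unit_clamp (t : R) : R := Num.max (Num.min t 1%R) 0%R.

Lemma unit_clamp_contract s t : (`|unit_clamp s - unit_clamp t| <= `|s - t|)%R.
Proof. exact: le_trans (max_contract _ _ _) (min_contract _ _ _). Qed.

Lemma unit_clamp_itv t : (0 <= unit_clamp t <= 1)%R.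
Proof. by rewrite /unit_clamp le_max lexx orbT ge_max ge_min lexx orbT ler01. Qed.

Lemma unit_clamp_le0 t : (t <= 0)%R -> unit_clamp t = 0%R.
Proof. by move=> t0; rewrite /unit_clamp max_r// ge_min t0. Qed.

Lemma unit_clamp_ge1 t : (1 <= t)%R -> unit_clamp t = 1%R.
Proof. by move=> t1; rewrite /unit_clamp min_r// max_l. Qed.

Lemma inv_1B_le (th : R) : (0 < th <= 1 / 2)%R -> ((1 - th)^-1 <= 1 + 2 * th)%R.
Proof.
move=> /andP[h1 h2]; have p : (0 < 1 - th)%R by lra.
by rewrite -[X in (X <= _)%R]mul1r ler_pdivrMr//; nra.
Qed.

Lemma Lipschitz_bump (d : X -> R) (eta : R) : (0 < eta)%R ->
  (forall x y, `|d x - d y| <= mdist x y)%R ->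
  exists p : X -> R, [/\ forall x, (0 <= p x <= 1)%R,
    forall x, (d x < eta)%R -> p x = 1%R,
    forall x, (2 * eta <= d x)%R -> p x = 0%R &
    admissible p (cst (eta^-1)%:E \_ [set x | (d x < 2 * eta)%R])].
Proof.
move=> eta0 dL; have etaV : (0 < eta^-1)%R by rewrite invr_gt0.
pose p0 x := Num.min (2 - eta^-1 * d x)%R 1%R.
have ap0 : admissible p0 (cst (eta^-1)%:E).
  have pL x y : (`|p0 x - p0 y| <= eta^-1 * mdist x y)%R.
    apply: le_trans (min_contract _ _ _) _.
    rewrite (_ : 2 - _ - _ = eta^-1 * (d y - d x))%R; last by ring.
    by rewrite normrM gtr0_norm// ler_pM2l// distrC.
  by split; [exact: Lipschitz_Lip_loc pL | exact: upper_gradient_Lipschitz (ltW etaV) pL].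
have etaM t : (eta^-1 * t = t / eta)%R by rewrite mulrC.
have p0W x : (0 < p0 x)%R = (d x < 2 * eta)%R.
  by rewrite /p0 lt_min ltr01 andbT subr_gt0 etaM ltr_pdivrMr.
exists (fun x => unit_clamp (2 - eta^-1 * d x)); split.
- by move=> x; exact: unit_clamp_itv.
- move=> x dx; rewrite unit_clamp_ge1// lerBrDr -lerBrDl etaM ler_pdivrMr//.
  by rewrite (_ : 2 - 1 = 1)%R ?mul1r ?ltW//; lra.
- by move=> x dx; rewrite unit_clamp_le0// subr_le0 etaM ler_pdivlMr.
- have := admissible_pos_part H ap0; congr (admissible _ (_ \_ _)).
  by apply/seteqP; split=> x /=; rewrite p0W.
Qed.

(* [w] lowers the levels of [v] above [theta] by a cutoff function equal to 1
   on the inner thickening, so that [w] vanishes there. *)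
Lemma cutoff_energy v g A (eta theta : R) : admissible v g -> A !=set0 ->
  (0 < eta)%R -> (0 < theta <= 1 / 2)%R ->
  exists w h, [/\ admissible w h,
    int setT h <= (1 + 2 * theta)%:E * int (~` thickening A eta) g +
      (eta^-1)%:E * mu ([set x | (theta < v x)%R] `&` thickening A (2 * eta)%R) &
    forall E x, (`|w x - \1_E x| <= 2 * `|v x - \1_E x| +
      \1_(E `&` thickening A (2 * eta)) x)%R].
Proof.
move=> avg A0 eta0 thetaP; have /andP[th0 th2] := thetaP.
have th1 : (0 < 1 - theta)%R by lra.
have th3 : (1 + 2 * theta <= 2)%R by lra.
have thV : (0 < (1 - theta)^-1)%R by rewrite invr_gt0.
have etaV : (0 < eta^-1)%R by rewrite invr_gt0.
pose W := thickening A eta; pose W2 := thickening A (2 * eta)%R.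
have oW2 : open W2 by exact: open_thickening.
have mW : meas W by apply: (measurable_openX H); exact: open_thickening.
have mW2 : meas W2 by exact: (measurable_openX H).
(* [aff] maps [theta] to 0 and 1 to 1. After clamping, [vt] vanishes where [v <= theta], so the
   gradient [1 / eta] of the cutoff is paid only on [{v > theta}], at the cost of a factor
   [(1 - theta)^-1] in front of [g]. The values 0 and 1 of [1_E] are unchanged. *)
pose aff t := ((1 - theta)^-1 * t + - ((1 - theta)^-1 * theta))%R.
have affE t : aff t = ((t - theta) / (1 - theta))%R by rewrite /aff mulrBl mulrC (mulrC _ theta).
pose vt x := unit_clamp (aff (v x)).
have avt : admissible vt (fun x => (1 - theta)^-1%:E * g x).
  apply: (admissible_contract (phi := unit_clamp)) unit_clamp_contract _.
  exact: admissible_affine.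
have [p [p01 pW pW2' ap]] := Lipschitz_bump eta0 (fun x y => dist_set_Lipschitz x y A0).
have pW2 x : ~ W2 x -> p x = 0%R by move=> /negP; rewrite -leNgt => /pW2'.
have aw := admissible_pos_part H (admissibleB avt ap).
set U := [set x | _] in aw.
exists (fun x => Num.max (vt x - p x) 0)%R; eexists; split; first exact: aw.
- have gg := admissible_ge0 H avg; have [g0 _] := gg.
  have mTh : meas [set x | (theta < v x)%R].
    by apply: (measurable_openX H); apply: continuous_open_gt; exact: (Lip_loc_continuous H avg.1).
  have mTW : meas ([set x | (theta < v x)%R] `&` W2) by exact: measI.
  have gC := ge0_measurable_restrict (measC mW) gg.
  have gI := ge0_measurable_indic mTW.
  apply: (@le_trans _ _ (int setT (fun x => (1 - theta)^-1%:E * (g \_ (~` W)) x +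
      (eta^-1)%:E * (\1_([set x | (theta < v x)%R] `&` W2) x)%:E))).
    apply: int_le; [exact: measT|exact: (admissible_ge0 H aw)| |].
      by apply: ge0_measurableD; apply: ge0_measurableZ => //; exact: ltW.
    move=> x _; have r0 : 0 <= (1 - theta)^-1%:E * (g \_ (~` W)) x.
      by apply: mule_ge0; [rewrite lee_fin ltW | case: gC => h _; exact: h].
    have r1 : 0 <= (eta^-1)%:E * (\1_([set x | (theta < v x)%R] `&` W2) x)%:E.
      by apply: mule_ge0; [rewrite lee_fin ltW | case: gI => h _; exact: h].
    rewrite [leLHS]patchE; case: ifPn => [/set_mem Ux|_]; last exact: adde_ge0.
    have vtp : (p x < vt x)%R by move: Ux; rewrite /U/= subr_gt0.
    have nWx : ~ W x.
      move=> /pW px; move: vtp; rewrite px ltNge => /negP; apply.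
      by have /andP[] := unit_clamp_itv (aff (v x)).
    have vx : (theta < v x)%R.
      rewrite ltNge; apply/negP => vth; move: vtp; rewrite /vt unit_clamp_le0.
        by rewrite ltNge; have /andP[-> _] := p01 x.
      by rewrite affE ler_pdivrMr// mul0r subr_le0.
    apply: leeD; first by rewrite patchE mem_set.
    rewrite patchE indicE in_setI (mem_set (_ : [set y | (theta < v y)%R] x))//=.
    by case: (x \in W2); rewrite ?mule1 ?mule0.
  rewrite intD//; [|exact: measT|by apply: ge0_measurableZ => //; exact: ltW..].
  rewrite !intZ//; [|exact: measT|exact: ltW|exact: measT|exact: ltW].
  rewrite int_restrict setTI int_indic// ?setIT; last exact: measT.
  apply: leeD2r; apply: lee_wpmul2r; first exact: int_ge0.
  by rewrite lee_fin; exact: inv_1B_le.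
- move=> E x; set e := (\1_E x : R)%R.
  have eE : e = unit_clamp (aff e).
    rewrite /e indicE; case: (x \in E) => /=.
      by rewrite unit_clamp_ge1// affE divff// gt_eqF.
    by rewrite unit_clamp_le0// affE ler_pdivrMr// mul0r sub0r oppr_le0 ltW.
  have vtE : (`|vt x - e| <= 2 * `|v x - e|)%R.
    rewrite {1}eE; apply: le_trans (unit_clamp_contract _ _) _.
    rewrite (_ : aff (v x) - aff e = (1 - theta)^-1 * (v x - e))%R; last by rewrite /aff; ring.
    rewrite normrM gtr0_norm//; apply: ler_wpM2r => //.
    exact: le_trans (inv_1B_le thetaP) th3.
  have [/andP[a0 a1] /andP[q0 q1]] := (unit_clamp_itv (aff (v x)), p01 x).
  rewrite -/(vt x) in a0 a1.
  have [xW2|xW2] := pselect (W2 x); last first.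
    rewrite (pW2 _ xW2) subr0 max_l//; apply: le_trans vtE _.
    by rewrite lerDl indicE ler0n.
  have -> : (\1_(E `&` W2) x = e :> R)%R by rewrite /e !indicE in_setI (mem_set xW2) andbT.
  have [w0 w1] : (0 <= Num.max (vt x - p x) 0 /\ Num.max (vt x - p x) 0 <= vt x)%R.
    by rewrite le_max lexx orbT ge_max a0 andbT gerBl.
  move: w0 w1 vtE; set w := Num.max _ _; rewrite /e indicE; case: (x \in E) => /= w0 w1.
    move=> _; rewrite distrC ger0_norm ?subr_ge0 ?(le_trans w1)//.
    apply: (@le_trans _ _ 1%R); first by rewrite gerBl.
    by rewrite lerDr mulr_ge0.
  by rewrite !subr0 addr0 (ger0_norm w0) (ger0_norm a0); exact: le_trans.
Qed.

End cutoff.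

Section concentration.
Context {R : realType}.

Lemma harmonic_le (c : R) : 0 < c -> exists K : nat, forall k : nat, (K <= k)%N ->
  k.+1%:R^-1 <= c.
Proof.
move=> c0; exists (Num.truncn c^-1) => k Kk.
rewrite invf_ple ?posrE//; apply/ltW/(lt_le_trans (truncnS_gt _)).
by rewrite ler_nat ltnS.
Qed.

Lemma nat_ge (r : R) : exists K : nat, forall k : nat, (K <= k)%N -> r <= k%:R.
Proof.
exists (Num.truncn r).+1 => k Kk; apply/ltW/(lt_le_trans (truncnS_gt _)).
by rewrite ler_nat.
Qed.

(** The budget of [no_concentration]: [P] is the perimeter, [i] the tolerance, [a] the energy off
    the inner thickening, [b] the measure of [{v > theta}] in the outer one and [m] that of [E]
    there. Cutting off saves [3/4 kappa] and costs at most [kappa / 16] through [theta],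
    [kappa / 16] through [i] and [kappa / 8] through [m]. *)
Lemma energy_decrease (N q kappa eta theta i P a b m : R) :
  0 < eta -> 0 < theta -> 0 <= i <= 1 -> 16 * q <= 1 -> 0 < kappa ->
  theta * (2 * (P + 1)) <= kappa / 16 ->
  (2 + eta^-1 * (N + theta^-1)) * i <= kappa / 16 ->
  a <= P + i - 3 / 4 * kappa -> b <= m + theta^-1 * i ->
  m <= q * eta * (2 * kappa) + N * i ->
  (1 + 2 * theta) * a + eta^-1 * b <= P - kappa / 4.
Proof.
move=> eta0 th0 /andP[i0 i1] q1 k0 h1 h2 ha hb hm.
have e1 : eta^-1 * b <= 2 * q * kappa + eta^-1 * (N + theta^-1) * i.
  apply: (@le_trans _ _ (eta^-1 * (q * eta * (2 * kappa) + N * i + theta^-1 * i))).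
    by rewrite ler_pM2l ?invr_gt0//; apply: le_trans hb _; rewrite lerD2r.
  rewrite le_eqVlt; apply/orP; left; apply/eqP; field.
  by rewrite !gt_eqF.
have e2 : (1 + 2 * theta) * a <= P + i - 3 / 4 * kappa + kappa / 16.
  apply: (@le_trans _ _ ((1 + 2 * theta) * (P + i - 3 / 4 * kappa))).
    by rewrite ler_wpM2l//; lra.
  by move: h1 i1 k0 th0; clear; nra.
have e3 : 2 * q * kappa <= kappa / 8 by move: q1 k0; clear; nra.
move: e1 e2 e3 h2 i0 k0; rewrite mulrDl; clear; lra.
Qed.

Context {X : completeMetricType R}.
Context (mu : {outer_measure set X -> \bar R}) (Cd CP lambda : R).
Hypothesis H : PI_space mu Cd CP lambda.
Implicit Types (x y z : X) (r s : R) (A B E V W : set X) (v : X -> R) (g : X -> \bar R).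
Local Open Scope ereal_scope.
Local Notation int := (mu_int mu).
Local Notation meas := (mu_measurable mu).

Lemma near_optimal f (M : R) : TV_le mu f M -> exists vg : nat -> (X -> R) * (X -> \bar R),
  forall k, [/\ admissible (vg k).1 (vg k).2,
    int setT (vg k).2 <= (TV_inf mu f + k.+1%:R^-1)%:E &
    int (ball point k%:R) (fun x => `|((vg k).1 x)%:E - f x|) <= (k.+1%:R^-1)%:E].
Proof.
move=> /(TV_le_TV_inf H) tf.
have h k : exists vg : (X -> R) * (X -> \bar R), [/\ admissible vg.1 vg.2,
    int setT vg.2 <= (TV_inf mu f + k.+1%:R^-1)%:E &
    int (ball point k%:R) (fun x => `|(vg.1 x)%:E - f x|) <= (k.+1%:R^-1)%:E].
  have [|v [g ?]] := tf k%:R%R (k.+1%:R^-1)%R; first by rewrite invr_gt0.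
  by exists (v, g).
by exists (fun k => sval (cid (h k))) => k; exact: svalP (cid (h k)).
Qed.

(* If a fixed share of the energy concentrated on [A], where [E] is sparse at
   all small scales, then cutting [E] off near [A] would lower its perimeter. *)
Lemma no_concentration : exists2 delta : R, (0 < delta)%R &
  forall E (M : R) A x r (r1 tau : R), meas E -> TV_le mu (fun y => (\1_E y)%:E) M ->
    A !=set0 -> A `<=` ball x r -> (0 < r1)%R ->
    (forall a s, A a -> (0 < s <= r1)%R ->
       mu (E `&` ball a s) <= delta%:E * mu (ball a s)) ->
    (0 < tau)%R ->
    exists2 eta : R, (0 < eta)%R & TV_le_on mu (thickening A eta) E tau.
Proof.
have l1 := PI_lambda_ge1 H; have CP0 := PI_CP_gt0 H.
have [N N0 hN] := single_scale H.
(* Scale, relative to [eta], of the balls used near [A]: [lambda * s <= 1] keeps their enlargements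
   in the next thickening, and [16 * N * CP * s <= 1] makes the energy term for the measure of [E]
   there at most [eta * kappa / 8], small against what cutting off saves. *)
pose s := ((lambda + 16 * N * CP)^-1)%R.
have NC0 : (0 < N * CP)%R by rewrite mulr_gt0.
have sD : (0 < lambda + 16 * N * CP)%R by move: l1 NC0; rewrite -mulrA; clear -H; lra.
have s0 : (0 < s)%R by rewrite invr_gt0.
have ls1 : (lambda * s <= 1)%R.
  by rewrite ler_pdivrMr// mul1r lerDl -mulrA mulr_ge0// ltW.
have q1 : (16 * (N * CP * s) <= 1)%R.
  by rewrite mulrA ler_pdivrMr// mul1r mulrA lerDr; move: l1; clear -H; lra.
have s1 : (s <= 1)%R by apply: le_trans ls1; rewrite ler_peMl// ltW.
have [C C0 hC] := doubling_compare H (5 / s).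
have delta0 : (0 < (2 * C)^-1)%R by rewrite invr_gt0 mulr_gt0.
(* Sparsity at this level in [ball a (3 * eta)] leaves [E] at most half of each [ball y (s * eta)]
   with [y] within [2 * eta] of [a], as [C] compares the measures of the two balls. *)
exists (2 * C)^-1%R => // E M A x r r1 tau mE tE A0 Ax r10 Adens tau0.
set f := (fun y => _) in tE.
pose P := TV_inf mu f.
have tP : TV_le mu f P by exact: (TV_le_TV_inf H tE).
have P0 : (0 <= P)%R by exact: (TV_le_ge0 H tP).
have [vg hvg] := near_optimal tE.
pose W eta := thickening A eta.
have mW eta : meas (W eta) by apply: (measurable_openX H); exact: open_thickening.
have gg k : ge0_measurable mu (vg k).2 by have [/(admissible_ge0 H)] := hvg k.
have mE1 := measurable_indicE mE.
have gd k : ge0_measurable mu (fun y => `|((vg k).1 y)%:E - f y|).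
  by apply: (ge0_measurable_dist _ mE1); have [/(admissible_measurable H)] := hvg k.
(* The levels below which the energies of a near-optimal sequence eventually fall on some thickening
   of [A]. If [tau] is one of them, that sequence proves the claim. *)
pose S := [set t : R | (0 < t)%R /\ exists2 eta : R, (0 < eta)%R &
  exists K : nat, forall k, (K <= k)%N -> int (W eta) (vg k).2 <= t%:E].
have Sup t t' : (t <= t')%R -> S t -> S t'.
  move=> tt' [t0 [eta eta0 [K hK]]]; split; first exact: lt_le_trans tt'.
  by exists eta => //; exists K => k /hK/le_trans; apply; rewrite lee_fin.
have ST : S (P + 1)%R.
  split; first by rewrite ltr_wpDl.
  exists 1%R => //; exists 0%N => k _; have [_ h _] := hvg k.
  apply: le_trans (le_trans _ h) _; first by apply: int_subset => //; exact: measT.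
  by rewrite lee_fin lerD2l invf_le1// ler1n.
have [Stau|nStau] := pselect (S tau).
  have [_ [eta eta0 [K hK]]] := Stau; exists eta => // r' e e0.
  have [K1 hK1] := harmonic_le e0; have [K2 hK2] := nat_ge r'.
  pose k := maxn K (maxn K1 K2); have [avg _ hd] := hvg k.
  have kK2 : (r' <= k%:R)%R by apply: hK2; rewrite /k !leq_max leqnn !orbT.
  exists (vg k).1, (vg k).2; split=> //.
    apply: (@le_trans _ _ tau%:E); first by apply: hK; rewrite leq_maxl.
    by rewrite lee_fin lerDl ltW.
  apply: le_trans (_ : _ <= (k.+1%:R^-1)%:E) _; last first.
    by rewrite lee_fin; apply: hK1; rewrite /k !leq_max leqnn !orbT.
  apply: le_trans hd; apply: int_subset; [exact: (measurable_ball H)..|exact: gd|].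
  exact: sub_ball_center.
(* The energy that concentrates on [A]: eventually at most [2 * kappa] on one thickening, but above
   [3/4 kappa] infinitely often on every thickening. Cutting [E] off lowers the variation to
   [P - kappa / 4], against the minimality of [P]. *)
exfalso; pose kappa := inf S.
have infS : has_inf S by split; [exists (P + 1)%R | exists 0%R => t [/ltW]].
have Stau t : S t -> (tau <= t)%R.
  by move=> St; rewrite leNgt; apply/negP => /ltW h; apply: nStau; exact: Sup St.
have k0 : (0 < kappa)%R.
  by apply: lt_le_trans tau0 _; apply: lb_le_inf; [exists (P + 1)%R|exact: Stau].
have [_ [eta0 eta00 [K0 hK0]]] : S (2 * kappa)%R.
  have [t St tk] := inf_adherent k0 infS; apply: Sup St; apply/ltW.
  by rewrite (_ : 2 * kappa = inf S + kappa)%R// /kappa; ring.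
have freq eta K : (0 < eta)%R -> exists2 k, (K <= k)%N & (3 / 4 * kappa)%:E < int (W eta) (vg k).2.
  move=> etap; apply: contrapT => nk.
  have : (kappa <= 3 / 4 * kappa)%R.
    apply: inf_lbound; first by case: infS.
    split; first by rewrite mulr_gt0// divr_gt0.
    exists eta => //; exists K => k Kk; rewrite leNgt; apply/negP => h.
    by apply: nk; exists k.
  by move: k0; clear -H; lra.
suff : TV_le mu f (P - kappa / 4).
  by move/(TV_inf_le H); rewrite -/P; move: k0; clear -H; lra.
move=> r' e e_gt0.
pose theta := (Num.min (1 / 2) (kappa / (32 * (P + 1))))%R.
have P1 : (0 < 32 * (P + 1))%R by rewrite mulr_gt0// ltr_wpDl.
have thetaP : (0 < theta <= 1 / 2)%R.
  by rewrite /theta lt_min ge_min lexx/= !divr_gt0.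
have /andP[theta0 theta2] := thetaP.
have thP : (theta * (2 * (P + 1)) <= kappa / 16)%R.
  apply: (@le_trans _ _ (kappa / (32 * (P + 1)) * (2 * (P + 1)))%R).
    by rewrite ler_wpM2r ?ge_min ?lexx ?orbT// mulr_ge0// addr_ge0.
  rewrite le_eqVlt; apply/orP; left; apply/eqP; field.
  by rewrite gt_eqF// ltr_wpDl.
(* The three bounds keep the energy near [A] under [2 * kappa], the sparsity of [E] at scale
   [3 * eta], and the part of [E] that is removed small in [L^1]. The index [k] is chosen
   afterwards, since its tolerance must beat [1 / eta] and [1 / theta]. *)
pose eta := (Num.min (eta0 / 3) (Num.min (r1 / 3) (4 * e / kappa)))%R.
have eta_gt0 : (0 < eta)%R by rewrite /eta !lt_min !divr_gt0// mulr_gt0.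
have eta1 : (3 * eta <= eta0)%R.
  by have : (eta <= eta0 / 3)%R; [rewrite ge_min lexx|clear -H; lra].
have eta2 : (3 * eta <= r1)%R.
  by have : (eta <= r1 / 3)%R; [rewrite !ge_min lexx orbT|clear -H; lra].
have eta3 : (eta * kappa <= 4 * e)%R by rewrite -ler_pdivlMr// !ge_min lexx !orbT.
pose Q := (2 + eta^-1 * (N + theta^-1))%R.
have Q0 : (0 < Q)%R by rewrite addr_gt0// mulr_gt0 ?invr_gt0// addr_gt0// invr_gt0.
have [K1 hK1] := harmonic_le (divr_gt0 (divr_gt0 k0 (@ltr0n R 16)) Q0).
have N2 : (0 < N + 2)%R by rewrite addr_gt0.
have [K2 hK2] := harmonic_le (divr_gt0 (divr_gt0 e_gt0 (@ltr0n R 2)) N2).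
have [K3 hK3] := nat_ge r'.
have [K4 hK4] := nat_ge (mdist point x + (r + 3 * eta))%R.
have [k Kk hk] := freq eta (maxn K0 (maxn K1 (maxn K2 (maxn K3 K4)))) eta_gt0.
move: Kk; rewrite !geq_max => /and5P[kK0 kK1 kK2 kK3 kK4].
have [avg hg hd] := hvg k; set v := (vg k).1 in avg hd *; set g := (vg k).2 in avg hg hk *.
set i := (k.+1%:R^-1)%R in hg hd.
have i01 : (0 <= i <= 1)%R by rewrite invr_ge0 ler0n/= invf_le1// ler1n.
have hi1 : (Q * i <= kappa / 16)%R by rewrite mulrC -ler_pdivlMr//; exact: hK1.
have hi2 : ((N + 2) * i <= e / 2)%R by rewrite mulrC -ler_pdivlMr//; exact: hK2.
have W3k : W (3 * eta)%R `<=` ball point k%:R.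
  apply: subset_trans (thickening_bounded A0 Ax) _; apply: sub_ball; exact: hK4.
have dW3 : int (W (3 * eta)%R) (fun y => `|(v y)%:E - f y|) <= i%:E.
  by apply: le_trans hd; apply: int_subset => //; [exact: (measurable_ball H)|exact: gd].
have gW3 : int (W (3 * eta)%R) g <= (2 * kappa)%:E.
  apply: le_trans (hK0 _ kK0); apply: int_subset => //; [exact: gg|].
  exact: thickening_sub.
have W23 : W (2 * eta)%R `<=` W (3 * eta)%R by apply: thickening_sub; rewrite ler_pM2r// ler_nat.
have seta0 : (0 < s * eta)%R by rewrite mulr_gt0.
have seta1 : (s * eta <= eta)%R by rewrite ler_piMl// ltW.
have EW2 : mu (E `&` W (2 * eta)%R) <= (N * CP * s * eta * (2 * kappa) + N * i)%:E.
  apply: le_trans (hN E (W (2 * eta)%R) (W (3 * eta)%R) (s * eta)%R v g x (r + 2 * eta)%R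
    mE (mW _) (mW _) seta0 (thickening_bounded A0 Ax) _ _ avg) _.
  - move=> y yW; apply: (thickening_ball A0 yW).
    have : (lambda * (s * eta) <= eta)%R by rewrite mulrA ler_piMl// ltW.
    by clear -H; lra.
  - move=> y /(thickeningP _ _ A0)[a Aa ya].
    have ball_sub : ball y (s * eta)%R `<=` ball a (3 * eta)%R.
      by apply: sub_ball; move: ya seta1; rewrite metric_sym; clear -H; lra.
    apply: (@le_trans _ _ ((2 * C)^-1%:E * mu (ball a (3 * eta)%R))).
      apply: le_trans (Adens a (3 * eta)%R Aa _); last by rewrite eta2 mulr_gt0.
      by apply: le_outer_measure; exact: setIS.
    apply: (@le_trans _ _ ((2 * C)^-1%:E * (C%:E * mu (ball y (s * eta)%R)))).
      apply: lee_wpmul2l; first by rewrite lee_fin ltW.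
      have KE : (5 / s * (s * eta) = 5 * eta)%R by field; rewrite gt_eqF.
      by apply: hC => //; rewrite KE; [rewrite ler_pM2r// ler_nat|move: ya eta_gt0; clear -H; lra].
    rewrite muleA -EFinM; apply: lee_wpmul2r; first exact: outer_measure_ge0.
    by rewrite lee_fin invfM -mulrA mulVf ?gt_eqF// mulr1 mul1r.
  - apply: (@le_trans _ _ (N%:E * ((CP * (s * eta))%:E * (2 * kappa)%:E + i%:E))).
      apply: lee_wpmul2l; first by rewrite lee_fin ltW.
      apply: leeD => //; apply: lee_wpmul2l => //.
      by rewrite lee_fin mulr_ge0// ltW.
    rewrite -EFinM lee_fin le_eqVlt; apply/orP; left; apply/eqP; ring.
have [w [h [aw hw werr]]] := cutoff_energy H avg A0 eta_gt0 thetaP.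
exists w, h; split=> //.
  apply: le_trans hw _; set a := int (~` _) g; set b := mu (_ `&` _).
  have ha : a <= (P + i - 3 / 4 * kappa)%:E.
    have : a + int (W eta) g <= (P + i)%:E.
      rewrite -int_setUD; [|exact: measC (mW eta)|exact: mW|exact: gg|by rewrite setICl].
      by rewrite setvU.
    have a0 : 0 <= a by apply: int_ge0; exact: gg.
    move: hk a0; case: (int (W eta) g) => [t| |]//; case: a => [a'| |]//=.
    by rewrite lte_fin -EFinD !lee_fin; clear -H; lra.
  have hb : b <= mu (E `&` W (2 * eta)%R) + (theta^-1 * i)%:E.
    apply: le_trans (chebyshev H mE (mW (2 * eta)%R) avg theta0) _; apply: leeD2l.
    rewrite EFinM; apply: lee_wpmul2l; first by rewrite lee_fin invr_ge0 ltW.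
    by apply: le_trans dW3; apply: int_subset => //; exact: gd.
  have {}hb := le_trans hb (leeD2r _ EW2).
  have a0 : 0 <= a by apply: int_ge0; exact: gg.
  have b0 : 0 <= b by exact: outer_measure_ge0.
  move: a0 b0 ha hb; case: a => [a'| |]//; case: b => [b'| |]// _ _.
  rewrite -EFinD !lee_fin => ha hb.
  apply: (@le_trans _ _ (P - kappa / 4)%R); last by rewrite lerDl ltW.
  apply: (energy_decrease (N := N) (q := N * CP * s) (i := i)) hb _ => //.
apply: (@le_trans _ _ (int (ball point k%:R) (fun y => 2%:E * `|(v y)%:E - f y| +
    (\1_(E `&` W (2 * eta)%R) y)%:E))).
  have mEW : meas (E `&` W (2 * eta)%R) by exact: measI.
  have g2 : ge0_measurable mu (fun y => 2%:E * `|(v y)%:E - f y| + (\1_(E `&` W (2 * eta)%R) y)%:E).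
    by apply: ge0_measurableD; [by apply: ge0_measurableZ => //; exact: gd|exact: ge0_measurable_indic].
  have gw : ge0_measurable mu (fun y => `|(w y)%:E - f y|).
    by apply: (ge0_measurable_dist _ mE1); exact: (admissible_measurable H aw).
  apply: (@le_trans _ _ (int (ball point k%:R) (fun y => `|(w y)%:E - f y|))).
    apply: int_subset => //; [exact: (measurable_ball H)..|].
    by apply: sub_ball_center; exact: hK3.
  apply: int_le => //; first exact: (measurable_ball H).
  by move=> y _; rewrite /f -!EFinB !abse_EFin -EFinM -EFinD lee_fin; exact: werr.
have mEW : meas (E `&` W (2 * eta)%R) by exact: measI.
rewrite intD//; [|exact: (measurable_ball H)|by apply: ge0_measurableZ => //; exact: gd|exact: ge0_measurable_indic].
rewrite intZ//; [|exact: (measurable_ball H)|exact: gd].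
rewrite int_indic//; last exact: (measurable_ball H).
apply: (@le_trans _ _ ((2 * i)%:E + (N * CP * s * eta * (2 * kappa) + N * i)%:E)).
  apply: leeD; first by rewrite EFinM; apply: lee_wpmul2l.
  by apply: le_trans EW2; apply: le_outer_measure => y [].
rewrite -EFinD lee_fin.
have : (N * CP * s * eta * (2 * kappa) <= e / 2)%R.
  rewrite (_ : _ * _ = 2 * (N * CP * s) * (eta * kappa))%R; last by ring.
  apply: (@le_trans _ _ (8^-1 * (4 * e))%R); last by clear -H; lra.
  apply: ler_pM => //; [by rewrite !mulr_ge0// ltW|by rewrite mulr_ge0// ltW|].
  by move: q1; clear -H; lra.
by move: hi2; clear -H; rewrite mulrDl; lra.
Qed.

End concentration.

(** * Points of density zero and of positive density *)

Section quasi_topology.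
Context {R : realType} {X : completeMetricType R}.
Context (mu : {outer_measure set X -> \bar R}) (Cd CP lambda : R).
Hypothesis H : PI_space mu Cd CP lambda.
Implicit Types (x y z : X) (r s : R) (A B E V W Y : set X) (v : X -> R) (g u : X -> \bar R).
Local Open Scope ereal_scope.
Local Notation int := (mu_int mu).
Local Notation meas := (mu_measurable mu).
Local Notation mfun := (mu_measurable_fun mu setT).

Definition sparse_at E x := forall e : R, (0 < e)%R -> exists2 r0, (0 < r0)%R &
  forall r, (0 < r < r0)%R -> mu (E `&` ball x r) <= e%:E * mu (ball x r).

Definition dense_at (c : R) E x := exists2 r0, (0 < r0)%R &
  forall r, (0 < r < r0)%R -> c%:E * mu (ball x r) <= mu (E `&` ball x r).

Lemma cover_le_set0 (e : R) : (0 <= e)%R -> cover_le mu set0 e.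
Proof. by move=> e0; exists set0; split=> //; rewrite esum_set0. Qed.

Lemma cover_leU A B (a b : R) : cover_le mu A a -> cover_le mu B b ->
  cover_le mu (A `|` B) (a + b).
Proof.
move=> [D [hD cD sD]] [D' [hD' cD' sD']]; exists (D `|` D'); split.
- by move=> p [/hD|/hD'].
- by move=> x [/cD[p Dp px]|/cD'[p Dp px]]; exists p => //; [left|right].
- rewrite (esumID D); last by move=> p _; exact: ball_weight_ge0.
  rewrite EFinD; apply: leeD.
    by apply: le_trans sD; apply: esum_subset => p [].
  by apply: le_trans sD'; apply: esum_subset => p [[]].
Qed.

Lemma boxing_near (c0 : R) : (0 < c0)%R -> (Cd * c0 <= 1 / 2)%R ->
  exists2 C : R, (0 < C)%R & forall E W Y (r0 tau : R), meas E -> meas W ->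
    (0 < r0)%R -> (5 * (lambda * r0) <= 1)%R -> (0 <= tau)%R ->
    TV_le_on mu W E tau -> (forall y, Y y -> ball y (lambda * r0)%R `<=` W) ->
    (forall y, Y y -> dense_at c0 E y) ->
    (forall y, Y y -> mu (E `&` ball y r0) <= c0%:E * mu (ball y r0)) ->
    cover_le mu Y (C * tau).
Proof.
move=> c00 Cc; have [C C0 hC] := boxing H c00; exists C => //.
move=> E W Y r0 tau mE mW r00 lr0 tau0 tW YW Ydense Ysparse.
have l0 : (0 < lambda)%R by apply: lt_le_trans (PI_lambda_ge1 H).
have hrho y : exists rho, Y y -> (0 < rho <= r0)%R /\ c0%:E * mu (ball y rho) <=
    mine (mu (E `&` ball y rho)) (mu (ball y rho `\` E)).
  have [Yy|nYy] := pselect (Y y); last by exists 0%R.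
  have [rho h1 h2] := crossing_radius H mE r00 c00 Cc (Ysparse _ Yy) (Ydense _ Yy).
  by exists rho.
pose rho y := sval (cid (hrho y)); have rhoP y := svalP (cid (hrho y)).
have lrho y : Y y -> (lambda * rho y <= lambda * r0)%R.
  by move=> /rhoP[/andP[_ h] _]; rewrite ler_pM2l.
apply: (hC E W Y rho) => //.
- move=> y Yy; have [/andP[h1 h2] _] := rhoP _ Yy; split=> //.
  by apply: le_trans lr0; rewrite ler_pM2l//; exact: lrho.
- by move=> y Yy; apply: subset_trans (YW _ Yy); apply: sub_ball_center; exact: lrho.
- by move=> y /rhoP[].
Qed.

(** Near [A] the energy can be made at most [e / C] by [no_concentration]. Points close to [A] are
    still sparse at one fixed scale, so those at which [E] is dense have a crossing radius below it,
    and boxing inside the thickening covers them. *)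
Lemma quasi_open_local (c0 : R) : (0 < c0)%R -> (Cd * c0 <= 1 / 2)%R ->
  exists2 delta : R, (0 < delta)%R & forall E A x (M r r1 e : R), meas E ->
    TV_le mu (fun y => (\1_E y)%:E) M -> A `<=` ball x r -> (0 < r1)%R ->
    (forall a s, A a -> (0 < s <= r1)%R ->
       mu (E `&` ball a s) <= delta%:E * mu (ball a s)) ->
    (0 < e)%R ->
    exists Y (eta : R), [/\ (0 < eta)%R, cover_le mu Y e &
      forall a y, A a -> ball a eta y -> dense_at c0 E y -> Y y].
Proof.
move=> c00 Cc; have [C C0 hC] := boxing_near c00 Cc.
have [delta delta0 hdelta] := no_concentration H.
have [C2 C20 hC2] := doubling_compare H 2.
have l1 := PI_lambda_ge1 H; have l0 : (0 < lambda)%R by apply: lt_le_trans l1.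
(* The second bound transfers sparsity from [ball a (2 * et)] to [ball y et]: doubling costs the
   factor [C2], leaving density at most [c0]. *)
exists (Num.min delta (c0 / C2))%R; first by rewrite lt_min delta0 divr_gt0.
move=> E A x M r r1 e mE tE Ax r10 Adens e0.
have [A0|nA0] := pselect (A !=set0); last first.
  exists set0, 1%R; split=> //; first exact/cover_le_set0/ltW.
  by move=> a y Aa; exfalso; apply: nA0; exists a.
have Adelta a s : A a -> (0 < s <= r1)%R -> mu (E `&` ball a s) <= delta%:E * mu (ball a s).
  move=> Aa /(Adens _ _ Aa)/le_trans; apply; rewrite lee_wpmul2r ?outer_measure_ge0//.
  by rewrite lee_fin ge_min lexx.
have [eta eta0 tW] := hdelta E M A x r r1 (e / C)%R mE tE A0 Ax r10 Adelta (divr_gt0 e0 C0).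
pose et := (Num.min (eta / (2 * lambda)) (Num.min (1 / (5 * lambda)) (r1 / 2)))%R.
have et0 : (0 < et)%R by rewrite !lt_min !divr_gt0// mulr_gt0.
have et1 : (2 * (lambda * et) <= eta)%R.
  by rewrite mulrA mulrC -ler_pdivlMr ?mulr_gt0// ge_min lexx.
have et2 : (5 * (lambda * et) <= 1)%R.
  by rewrite mulrA mulrC -ler_pdivlMr ?mulr_gt0// !ge_min lexx orbT.
have et3 : (2 * et <= r1)%R.
  by rewrite mulrC -ler_pdivlMr// !ge_min lexx !orbT.
have le_et : (et <= lambda * et)%R by rewrite ler_peMl// ltW.
exists [set y | thickening A et y /\ dense_at c0 E y], et; split=> //; last first.
  move=> a y Aa /in_ball ay dy; split=> //; apply/(thickeningP _ _ A0).
  by exists a => //; rewrite metric_sym.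
rewrite (_ : e = C * (e / C))%R; last by rewrite mulrC divfK// gt_eqF.
apply: (hC E (thickening A eta) _ et) => //.
- by apply: (measurable_openX H); exact: open_thickening.
- by rewrite divr_ge0// ltW.
- move=> y [yA _]; apply: (thickening_ball A0 yA); move: le_et et1; clear -H; lra.
- by move=> y [].
- move=> y [/(thickeningP _ _ A0)[a Aa ya] _].
  apply: (@le_trans _ _ (mu (E `&` ball a (2 * et)%R))).
    apply: le_outer_measure; apply: setIS; apply: sub_ball.
    by move: ya; rewrite metric_sym; clear -H; lra.
  apply: le_trans (Adens a (2 * et)%R Aa _) _; first by rewrite et3 andbT mulr_gt0.
  apply: (@le_trans _ _ ((c0 / C2)%:E * mu (ball a (2 * et)%R))).
    by rewrite lee_wpmul2r ?outer_measure_ge0// lee_fin ge_min lexx orbT.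
  apply: (@le_trans _ _ ((c0 / C2)%:E * (C2%:E * mu (ball y et)))).
    apply: lee_wpmul2l; first by rewrite lee_fin divr_ge0// ltW.
    by apply: hC2 => //; move: ya et0; clear -H; lra.
  by rewrite muleA -EFinM divfK// gt_eqF.
Qed.

(** Sparsity is uniform on each [A m], a bounded set on which it holds at all scales up to
    [1 / (m + 1)]. These sets exhaust the points of density zero, and their exceptional sets have
    geometrically decreasing content. *)
Lemma quasi_open (c0 : R) E (M e : R) : (0 < c0)%R -> (Cd * c0 <= 1 / 2)%R ->
  meas E -> TV_le mu (fun y => (\1_E y)%:E) M -> (0 < e)%R ->
  exists2 Y, cover_le mu Y e & forall x, sparse_at E x ->
    exists2 r, (0 < r)%R & forall y, ball x r y -> dense_at c0 E y -> Y y.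
Proof.
move=> c00 Cc mE tE e0; have [delta delta0 hd] := quasi_open_local c00 Cc.
pose A (m : nat) := [set x | ball point m.+1%:R x /\
  forall s, (0 < s <= m.+1%:R^-1)%R -> mu (E `&` ball x s) <= delta%:E * mu (ball x s)].
have hA m : exists Yeta : set X * R, [/\ (0 < Yeta.2)%R,
    cover_le mu Yeta.1 (e / (2 ^ m.+1)%:R) &
    forall a y, A m a -> ball a Yeta.2 y -> dense_at c0 E y -> Yeta.1 y].
  have [| | | |Y [eta ?]] := hd E (A m) point M m.+1%:R%R (m.+1%:R^-1)%R (e / (2 ^ m.+1)%:R)%R mE tE.
  - by move=> x [].
  - by rewrite invr_gt0.
  - by move=> a s [_]; apply.
  - by rewrite divr_gt0// ltr0n expn_gt0.
  - by exists (Y, eta).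
pose Y m := (sval (cid (hA m))).1; have hY m := svalP (cid (hA m)).
exists (\bigcup_m Y m).
  by apply: cover_le_bigcup; [exact: ltW|move=> m; have [_ h _] := hY m].
move=> x /(_ _ delta0)[r0 r00 hr0].
have [K1 hK1] := harmonic_le (divr_gt0 r00 (@ltr0n R 2)); have [K2 hK2] := nat_ge (mdist point x).
pose m := maxn K1 K2; have Amx : A m x.
  split.
    apply/in_ball; apply: le_lt_trans (hK2 m _) _; first exact: leq_maxr.
    by rewrite ltr_nat.
  move=> s /andP[s0 sm]; apply: hr0; rewrite s0 /=; apply: le_lt_trans sm _.
  by apply: le_lt_trans (hK1 m (leq_maxl _ _)) _; rewrite ltr_pdivrMr// ltr_pMr// ltr1n.
have [eta0 _ h] := hY m; exists (sval (cid (hA m))).2 => // y xy dy.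
by exists m => //; exact: h xy dy.
Qed.

(** Two kinds of points at the fixed scale [r0]: where [E] has density below [c0], boxing on the
    whole space gives a bound by the perimeter; elsewhere ([Y2]) disjoint balls of radius [r0] each
    take a share of [mu E]. *)
Lemma dense_cover (c0 : R) : (0 < c0)%R -> (Cd * c0 <= 1 / 2)%R ->
  exists2 C : R, (0 < C)%R & forall E (M m : R), meas E ->
    TV_le mu (fun y => (\1_E y)%:E) M -> mu E <= m%:E ->
    cover_le mu [set y | dense_at c0 E y] (C * (M + m)).
Proof.
move=> c00 Cc; have [C C0 hC] := boxing_near c00 Cc.
have l1 := PI_lambda_ge1 H; have l0 : (0 < lambda)%R by apply: lt_le_trans l1.
pose r0 := ((5 * lambda)^-1)%R; have r00 : (0 < r0)%R by rewrite invr_gt0 mulr_gt0.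
have [C5 C50 hC5] := doubling_compare H 5.
have K0 : (0 < C5 / (5 * r0) / c0)%R by rewrite !divr_gt0// mulr_gt0.
exists (C + C5 / (5 * r0) / c0)%R; first exact: addr_gt0.
move=> E M m mE tE Em; have M0 : (0 <= M)%R by exact: (TV_le_ge0 H tE).
have m0 : (0 <= m)%R by rewrite -lee_fin; apply: le_trans Em; exact: outer_measure_ge0.
set Y2 := [set y | c0%:E * mu (ball y r0) <= mu (E `&` ball y r0)].
have c1 : cover_le mu ([set y | dense_at c0 E y] `\` Y2) (C * M).
  apply: (hC E setT _ r0) => //.
  - exact: measT.
  - rewrite mulrA divff ?gt_eqF// mulr_gt0//.
  - by move=> y [].
  - by move=> y [_ /negP]; rewrite -ltNge => /ltW.
have c2 : cover_le mu Y2 (C5 / (5 * r0) / c0 * m).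
  have [|D [DY tD covD]] := @vitali_covering R X Y2 (fun=> r0) r0.
    by move=> y _; rewrite r00 lexx.
  pose f y : X * R := (y, 5 * r0)%R.
  have r5 : (5 * r0 <= 1)%R by rewrite /r0 invfM mulrA divff// mul1r invf_le1.
  exists (f @` D); split.
  - by move=> _ [y _ <-] /=; rewrite r5 andbT mulr_gt0.
  - by move=> y Yy; have [z Dz yz] := covD _ Yy; exists (f z); [exists z|apply: yz; exact: ballxx].
  - apply: esum_le_seq => s us sD.
    have sP p : p \in s -> D p.1 /\ p.2 = (5 * r0)%R by move=> /sD[y Dy <-].
    apply: (@le_trans _ _ (\sum_(p <- s) (C5 / (5 * r0) / c0)%:E * mu (E `&` ball p.1 r0))).
      rewrite big_seq [leRHS]big_seq; apply: lee_sum => p /sP[Dp p2].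
      rewrite /ball_weight p2; apply: (@le_trans _ _ ((C5 / (5 * r0))%:E * mu (ball p.1 r0))).
        rewrite muleC [(C5 / (5 * r0))%R]mulrC EFinM -muleA; apply: lee_wpmul2l.
          by rewrite lee_fin invr_ge0 mulr_ge0// ltW.
        by apply: hC5 => //; rewrite mdistxx mulr_ge0// ltW.
      rewrite [leRHS](_ : _ = (C5 / (5 * r0))%:E * ((c0^-1)%:E * mu (E `&` ball p.1 r0))).
        apply: lee_wpmul2l; first by rewrite lee_fin divr_ge0 ?ltW// mulr_gt0.
        by rewrite lee_pdivlMl//; exact: DY.
      by rewrite muleA -EFinM.
    rewrite -ge0_sume_distrr; last by move=> p _; exact: outer_measure_ge0.
    rewrite [leRHS]EFinM; apply: lee_wpmul2l; first by rewrite lee_fin ltW.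
    apply: le_trans Em; apply: mu_disjoint_sum => //.
    + by move=> p; apply: measI => //; exact: (measurable_ball H).
    + move=> p q ps qs pq; have [Dp p2] := sP _ ps; have [Dq q2] := sP _ qs.
      have : p.1 = q.1 by apply: tD => //; case: pq => y [[_ py] [_ qy]]; exists y.
      by move: p q p2 q2 {ps qs pq Dp Dq} => [? ?] [? ?] /= -> -> ->.
apply: cover_le_sub (_ : _ `<=` ([set y | dense_at c0 E y] `\` Y2) `|` Y2) _.
  by move=> y dy; have [|] := pselect (Y2 y); [right|left].
have [D [h1 h2 h3]] := cover_leU c1 c2; exists D; split=> //; apply: le_trans h3 _.
rewrite lee_fin [leRHS]mulrDr.
by apply: lerD; apply: ler_wpM2r => //; [rewrite lerDl ltW|rewrite lerDr ltW].
Qed.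

Lemma superlevel_measure u (t : R) : mfun u -> (0 < t)%R ->
  t%:E * mu (superlevel u t) <= int setT (fun x => `|u x|).
Proof.
move=> mu_ t0; have mS := measurable_superlevel t mu_.
rewrite -[superlevel u t]setIT -int_indic//; last exact: measT.
rewrite -intZ//; [|exact: measT|exact: ltW|exact: ge0_measurable_indic].
apply: int_le; [exact: measT| |exact: ge0_measurable_abse|].
  by apply: ge0_measurableZ; [exact: ltW|exact: ge0_measurable_indic].
move=> x _; rewrite indicE; case: (boolP (x \in _)) => [/set_mem|_]; last by rewrite mule0.
by rewrite mule1 => /ltW/le_trans; apply; exact: lee_abs.
Qed.

(** On a far interval [[k, k + 1]] the truncation of [u] has variation at most [d], so some level
    [t] there has perimeter at most [2 * d], while [mu {u > t}] is small by Chebyshev's inequality.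
    The choice of [d] makes [C * (2 * d + 2 * d) = e]. *)
Lemma quasi_bounded (c0 : R) u (M e : R) : (0 < c0)%R -> (Cd * c0 <= 1 / 2)%R ->
  mfun u -> int setT (fun x => `|u x|) < +oo -> TV_le mu u M -> (0 < e)%R ->
  exists t M' : R, [/\ (0 < t)%R, TV_le mu (fun y => (\1_(superlevel u t) y)%:E) M' &
    cover_le mu [set y | dense_at c0 (superlevel u t) y] e].
Proof.
move=> c00 Cc mu_ iu tu e0; have [C C0 hC] := dense_cover c00 Cc.
have gu := ge0_measurable_abse mu_.
pose I := fine (int setT (fun x => `|u x|)).
have iE : int setT (fun x => `|u x|) = I%:E by rewrite fineK// ge0_fin_numE// int_ge0.
have I0 : (0 <= I)%R by rewrite -lee_fin -iE int_ge0.
pose d := (e / (4 * C))%R; have d0 : (0 < d)%R by rewrite divr_gt0// mulr_gt0.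
have [K0 hK0] := nat_ge (I / d + 1)%R.
have [k Kk tk] := TV_le_clampE_tail H K0 mu_ tu d0.
have kk1 : (k%:R < k.+1%:R :> R)%R by rewrite ltr_nat.
have dk : (d < 2 * d * (k.+1%:R - k%:R))%R.
  by rewrite -[k.+1%:R]natr1 [(k%:R + 1)%R]addrC addrK mulr1 ltr_pMl// ltr1n.
have [t /andP[kt _] tt] := TV_le_superlevel H mu_ kk1 tk dk.
have It : (I / d + 1 <= t)%R by apply: le_trans kt; exact: hK0.
have Id0 : (0 <= I / d)%R by rewrite divr_ge0// ltW.
have t0 : (0 < t)%R by apply: lt_le_trans It; rewrite ltr_wpDl.
exists t, (2 * d)%R; split=> //.
rewrite (_ : e = C * (2 * d + 2 * d))%R; last by rewrite /d; field; rewrite gt_eqF.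
apply: hC => //; first exact: measurable_superlevel.
apply: (@le_trans _ _ (t^-1%:E * (t%:E * mu (superlevel u t)))).
  by rewrite muleA -EFinM mulVf ?gt_eqF// mul1e.
apply: le_trans (lee_wpmul2l _ (superlevel_measure mu_ t0)) _.
  by rewrite lee_fin invr_ge0 ltW.
rewrite iE -EFinM lee_fin mulrC ler_pdivrMr//.
apply: (@le_trans _ _ (d * t)%R); last first.
  by apply: ler_wpM2r; [exact: ltW|apply: ler_peMl; [exact: ltW|rewrite ler1n]].
by rewrite mulrC -ler_pdivrMr//; apply: le_trans It; rewrite lerDl.
Qed.

End quasi_topology.

(** * Capacity of covers *)

Section capacity.
Context {R : realType} {X : completeMetricType R}.
Context (mu : {outer_measure set X -> \bar R}) (Cd CP lambda : R).
Hypothesis H : PI_space mu Cd CP lambda.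
Implicit Types (x y z : X) (r s : R) (A B E V W Y G : set X) (v : X -> R) (g u : X -> \bar R).
Local Open Scope ereal_scope.
Local Notation int := (mu_int mu).
Local Notation meas := (mu_measurable mu).

(** Only finitely many terms of a finite sum are at least [1 / (n + 1)]. *)
Lemma finite_sum_countable (T : choiceType) (D : set T) (a : T -> \bar R) (M : R) :
  (forall i, D i -> 0 < a i) -> \esum_(i in D) a i <= M%:E -> countable D.
Proof.
move=> a0 aM; pose F n := [set i | D i /\ (n.+1%:R^-1)%:E <= a i].
have -> : D = \bigcup_n F n.
  apply/seteqP; split=> [i Di|i [n _ []]//].
  have [n hn] : exists n, (n.+1%:R^-1)%:E <= a i.
    move: (a0 i Di); case: (a i) => [c| |]// => [c0|_]; last by exists 0%N; rewrite leey.
    by have [n hn] := harmonic_le (c := c) c0; exists n; rewrite lee_fin hn.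
  by exists n.
apply: bigcup_countable => // n _; apply: finite_set_countable.
apply: contrapT => infF.
have [B BF nB] := infinite_set_fset (Num.truncn (M * n.+1%:R)).+1 infF.
have : \sum_(i <- enum_fset B) (n.+1%:R^-1)%:E <= M%:E.
  apply: le_trans aM; apply: le_trans (_ : _ <= \sum_(i <- enum_fset B) a i) _.
    by rewrite big_seq [leRHS]big_seq; apply: lee_sum => i /BF[].
  by apply: le_esum_seq; [exact: fset_uniq|move=> i /BF[]].
rewrite sumEFin lee_fin big_const_seq count_predT iter_addr_0 leNgt => /negP; apply.
have sB : ((Num.truncn (M * n.+1%:R)).+1%:R <= (size (enum_fset B))%:R :> R)%R by rewrite ler_nat.
rewrite -[X in (_ < X)%R]mulr_natl ltr_pdivlMr//.
exact: lt_le_trans (truncnS_gt _) sB.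
Qed.

Definition option_weight (w : X * R -> \bar R) (o : option (X * R)) : \bar R :=
  if o is Some p then w p else 0.

Lemma enumerate_countable (D : set (X * R)) (w : X * R -> \bar R) (M : \bar R) :
  countable D -> (forall p, 0 <= w p) -> \esum_(p in D) w p <= M ->
  exists q : nat -> option (X * R),
    [/\ forall n p, q n = Some p -> D p, forall p, D p -> exists n, q n = Some p &
        \sum_(n <oo) option_weight w (q n) <= M].
Proof.
move=> /countable_injP[j injj] w0 wM.
have hq n : exists o : option (X * R), (forall p, o = Some p -> D p /\ j p = n) /\
    (forall p, D p -> j p = n -> o = Some p).
  have [[p [Dp jp]]|np] := pselect (exists p, D p /\ j p = n).
    exists (Some p); split=> [_ [<-]//|p' Dp' jp'].
    by congr Some; apply: injj; rewrite ?jp ?jp'//; exact: mem_set.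
  by exists None; split=> // p Dp jp; exfalso; apply: np; exists p.
pose q n := sval (cid (hq n)); have qP n := svalP (cid (hq n)).
exists q; split.
- by move=> n p qp; have [/(_ p qp)[]] := qP n.
- by move=> p Dp; exists (j p); have [_] := qP (j p); apply.
- apply: lime_le; first by apply: is_cvg_nneseries => n *; case: (q n) => /=.
  apply: nearW => N; apply: le_trans wM.
  have -> : \sum_(0 <= n < N) option_weight w (q n) = \sum_(p <- pmap q (iota 0 N)) w p.
    rewrite /index_iota subn0; elim: (iota 0 N) => [|n s IH]; first by rewrite !big_nil.
    by rewrite big_cons IH /=; case: (q n) => [p|] /=; rewrite ?add0e// big_cons.
  apply: le_esum_seq.
    have : uniq (iota 0 N) by exact: iota_uniq.
    elim: (iota 0 N) => //= n s IH /andP[ns us]; case E: (q n) => [p|] /=; last exact: IH.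
    rewrite IH// andbT; apply/negP; rewrite mem_pmap => /mapP[m ms] /esym qm.
    have [/(_ _ E)[_ jn] _] := qP n; have [/(_ _ qm)[_ jm] _] := qP m.
    by move: ns; rewrite -jn jm ms.
  move=> p; rewrite mem_pmap => /mapP[n _] /esym qn.
  by have [/(_ _ qn)[]] := qP n.
Qed.

(** Each ball [B] of radius [r] carries a bump equal to 1 on [B] and supported in the double ball,
    with upper gradient [1 / r] there. By doubling its energy is at most [Cd * mu B / r], and so is
    the measure of its support because [r <= 1]; the sum of the two bounds gives [Cd + Cd]. *)
Lemma capacity_cover : exists2 C : R, (0 < C)%R & forall A (e : R),
  cover_le mu A e -> exists G, [/\ open G, A `<=` G & Cap1 mu G <= (C * e)%:E].
Proof.
have Cd0 : (0 < Cd)%R by apply: lt_le_trans (PI_Cd_ge1 H).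
exists (Cd + Cd)%R; first exact: addr_gt0.
move=> A e [D [hD cD sD]].
have wpos p : D p -> 0 < ball_weight mu p.
  by move=> /hD/andP[p0 _]; rewrite mule_gt0 ?(mu_ball_gt0 H)// lte_fin invr_gt0.
have cntD := finite_sum_countable wpos sD.
have [q [qD Dq qe]] := enumerate_countable cntD (@ball_weight_ge0 _ _ mu) sD.
have hb n : exists (phi : X -> R) (gn : X -> \bar R) (V : set X), [/\
    forall x, (0 <= phi x <= 1)%R,
    forall p, q n = Some p -> forall x, ball p.1 p.2 x -> phi x = 1%R,
    (forall x, ~ V x -> phi x = 0%R) /\ meas V,
    admissible phi gn &
    mu V <= Cd%:E * option_weight (ball_weight mu) (q n) /\
    int setT gn <= Cd%:E * option_weight (ball_weight mu) (q n)].
  case E: (q n) => [p|]; last first.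
    exists (fun=> 0%R), (fun=> 0), set0; split=> //.
    - by move=> x; rewrite lexx ler01.
    - by split=> //; exact: meas0.
    - have L0 (x y : X) : (`|0 - 0 : R| <= 0 * mdist x y)%R by rewrite subrr normr0 mul0r.
      by split; [exact: Lipschitz_Lip_loc L0|exact: (upper_gradient_Lipschitz _ L0)].
    - rewrite /= mule0 outer_measure0; split=> //.
      by rewrite int_cst ?mul0e//; exact: measT.
  have /hD/andP[p0 p1] := qD _ _ E.
  have dL x y : (`|mdist p.1 x - mdist p.1 y| <= mdist x y)%R.
    have := metric_triangle p.1 x y; have := metric_triangle p.1 y x.
    rewrite (metric_sym y x) ler_norml => h1 h2; apply/andP; split; move: h1 h2; clear -H; lra.
  have [phi [h01 h1 h0 aphi]] := Lipschitz_bump H p0 dL.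
  have eB : [set x | (mdist p.1 x < 2 * p.2)%R] = ball p.1 (2 * p.2)%R.
    by rewrite ballEmdist.
  rewrite eB in aphi.
  have w1 : mu (ball p.1 (2 * p.2)%R) <= Cd%:E * mu (ball p.1 p.2).
    by have [] := PI_doubling H p.1 p0.
  exists phi, (cst (p.2^-1)%:E \_ (ball p.1 (2 * p.2)%R)), (ball p.1 (2 * p.2)%R); split=> //.
  - by move=> _ [<-] x /in_ball; exact: h1.
  - split; last exact: (measurable_ball H).
    by move=> x nx; apply: h0; rewrite leNgt; apply/negP => h; apply: nx; apply/in_ball.
  - split.
      apply: le_trans w1 _; apply: lee_wpmul2l; first by rewrite lee_fin ltW.
      rewrite /= /ball_weight -[leLHS]mule1; apply: lee_wpmul2l; first exact: outer_measure_ge0.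
      by rewrite lee_fin -invr1 lef_pV2 ?posrE.
    rewrite int_restrict setTI int_cst; last exact: (measurable_ball H).
    rewrite /= /ball_weight [leRHS]muleA [leRHS]muleC; apply: lee_wpmul2l => //.
    by rewrite lee_fin invr_ge0 ltW.
have [phi hphi] := choice hb; have [gn hgn] := choice hphi; have [V hV] := choice hgn.
clear hb hphi hgn.
(* A supremum rather than a sum: [u] stays in [[0, 1]], hence finite, and the sum of the upper
   gradients is an upper gradient of it. *)
pose u x := ereal_sup (range (fun n => (phi n x)%:E)).
pose g x := \sum_(n <oo) gn n x.
have gn0 n x : 0 <= gn n x by have [_ _ _ [_ [_ g0 _]] _] := hV n; exact: g0.
have u0 x : 0 <= u x.
  apply: (@le_trans _ _ (phi 0%N x)%:E); last by apply: ereal_sup_ubound; exists 0%N.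
  by rewrite lee_fin; have [/(_ x)/andP[]] := hV 0%N.
have u1 x : u x <= 1.
  by apply: ge_ereal_sup => _ [n _ <-]; have [/(_ x)/andP[_]] := hV n; rewrite lee_fin.
have uB : Borel_fun u.
  apply: lsc_Borel_fun => a.
  have -> : [set x | a%:E < u x] = \bigcup_n [set x | (a < phi n x)%R].
    apply/seteqP; split=> x /=.
      by move=> /ereal_sup_gt[_ [n _ <-]]; rewrite lte_fin => h; exists n.
    move=> [n _ /= h]; apply: (@lt_le_trans _ _ (phi n x)%:E); first by rewrite lte_fin.
    by apply: ereal_sup_ubound; exists n.
  apply: bigcup_open => n _; apply: continuous_open_gt.
  by have [_ _ _ [lphi _]] := hV n; by have := Lip_loc_continuous H lphi.
have gB : Borel_fun g.
  apply: ge0_emeasurable_sum => // n _; by have [_ _ _ [_ []]] := hV n.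
have ugu : upper_gradient u g.
  split=> //; first by move=> x; exact: nneseries_ge0.
  move=> c l cl.
  have step x y n : (x = c 0%R /\ y = c l \/ x = c l /\ y = c 0%R) ->
      (phi n x)%:E <= u y + curve_integral g c l.
    move=> xy; have [_ _ _ [_ [mgn _ hug]] _] := hV n.
    have h1 : (`|phi n x - phi n y|)%:E <= curve_integral g c l.
      have : (`|phi n x - phi n y|)%:E <= curve_integral (gn n) c l.
        by case: xy => -[-> ->]; [|rewrite distrC]; exact: (hug c l cl).
      move=> h; apply: le_trans h _; apply: ge0_le_integral => //.
      - exact: curve_measurable cl mgn.
      - exact: curve_measurable cl gB.
      - move=> t _; rewrite /g (nneseriesD1 (n := n) (fun k _ => gn0 k _))//.
        by rewrite leeDl//; apply: nneseries_ge0 => k *; exact: gn0.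
    apply: (@le_trans _ _ ((phi n y)%:E + (`|phi n x - phi n y|)%:E)).
      by rewrite -EFinD lee_fin -lerBlDl; exact: ler_norm.
    by apply: leeD => //; apply: ereal_sup_ubound; exists n.
  have uf x : u x \is a fin_num.
    by rewrite ge0_fin_numE//; apply: le_lt_trans (u1 x) _; exact: ltry.
  have hu x y : (x = c 0%R /\ y = c l \/ x = c l /\ y = c 0%R) ->
      u x <= u y + curve_integral g c l.
    by move=> xy; apply: ge_ereal_sup => _ [n _ <-]; exact: step.
  have := hu _ _ (or_introl (conj erefl erefl)); have := hu _ _ (or_intror (conj erefl erefl)).
  rewrite -(fineK (uf (c 0%R))) -(fineK (uf (c l))).
  case: (curve_integral g c l) => [I| |]; [|by move=> *; rewrite leey|by rewrite addeNy leeNy_eq].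
  by rewrite -!EFinD !lee_fin ler_norml => h1 h2; apply/andP; split; move: h1 h2; clear -H; lra.
have mu_u := int_Borel (measurable_Borel H) uB.
have sumE : \sum_(n <oo) Cd%:E * option_weight (ball_weight mu) (q n) <= (Cd * e)%:E.
  rewrite nneseriesZl; last by move=> n _; case: (q n) => // p; exact: ball_weight_ge0.
  by rewrite EFinM; apply: lee_wpmul2l => //; rewrite lee_fin ltW.
have gpos n : ge0_measurable mu (gn n) by have [_ _ _ /(admissible_ge0 H)] := hV n.
have norm_u : N11_norm mu u <= ((Cd + Cd) * e)%:E.
  rewrite /N11_norm mulrDl EFinD; apply: leeD.
    apply: (@le_trans _ _ (int setT (fun x => (\1_(\bigcup_n V n) x)%:E))).
      have mV : meas (\bigcup_n V n) by apply: meas_bigcup => n; have [_ _ []] := hV n.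
      apply: int_le; [exact: measT|exact: ge0_measurable_abse|exact: ge0_measurable_indic|].
      move=> x _; rewrite gee0_abs//; apply: ge_ereal_sup => _ [n _ <-]; rewrite lee_fin.
      have [/(_ x)/andP[p0 p1] _ [pV _]] := hV n.
      have [Vx|/pV->] := pselect (V n x); last by rewrite indicE ler0n.
      by rewrite indicE mem_set//; exists n.
    rewrite int_indic ?setIT; [|exact: measT|by apply: meas_bigcup => n; have [_ _ []] := hV n].
    apply: le_trans (outer_measure_sigma_subadditive mu V) _; apply: le_trans sumE.
    apply: lee_nneseries => [n *|n *]; first exact: outer_measure_ge0.
    by have [_ _ _ _ []] := hV n.
  apply: (@le_trans _ _ (int setT g)); first by apply: ereal_inf_lbound; exists g.
  rewrite int_nneseries//; last exact: measT.
  apply: le_trans sumE; apply: lee_nneseries => [n *|n *]; first exact: int_ge0.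
  by have [_ _ _ _ []] := hV n.
have oG : open (\bigcup_(p in D) ball p.1 p.2) by apply: bigcup_open => p _; exact: open_ball.
exists (\bigcup_(p in D) ball p.1 p.2); split=> //.
apply: (@le_trans _ _ (N11_norm mu u)) => //; apply: ereal_inf_lbound; exists u => //; split.
  by split=> //; apply: le_lt_trans (norm_u) _; exact: ltry.
apply/set_nbhsP; exists (\bigcup_(p in D) ball p.1 p.2); split=> //.
move=> x [p Dp px] /=; have [n qn] := Dq _ Dp.
have [_ /(_ _ qn _ px) p1 _ _ _] := hV n.
by rewrite -p1; apply: ereal_sup_ubound; exists n.
Qed.

End capacity.

Lemma ge0_cvg0 (R : realType) (T : Type) (F : set_system T) (f : T -> \bar R) :
  Filter F -> (forall e : R, 0 < e -> \forall t \near F, (0 <= f t <= e%:E)%E) ->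
  f t @[t --> F] --> 0%E.
Proof.
move=> FF hf; apply/fine_cvgP; split.
  apply: filterS (hf 1 ltr01) => t /andP[f0 f1]; rewrite ge0_fin_numE//.
  by apply: le_lt_trans f1 _; exact: ltry.
apply/cvgrPdist_le => e e0; apply: filterS (hf e e0) => t /=.
case: (f t) => [a| |]//=; rewrite ?leeNy_eq ?andbF// !lee_fin => /andP[a0 ae].
by rewrite sub0r normrN ger0_norm.
Qed.

(** * Densities and essential values *)

Section density.
Context {R : realType} {X : completeMetricType R}.
Context (mu : {outer_measure set X -> \bar R}) (Cd CP lambda : R).
Hypothesis H : PI_space mu Cd CP lambda.
Implicit Types (x y z : X) (r s c : R) (A B E V W Y : set X).
Local Open Scope ereal_scope.
Local Notation meas := (mu_measurable mu).

Lemma near0_rightP (P : R -> Prop) : (\forall r \near 0%R^'+, P r) <->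
  exists2 r0, (0 < r0)%R & forall r, (0 < r < r0)%R -> P r.
Proof.
split=> [/nbhs_ballP[r0 r00 h]|[r0 r00 h]].
  exists r0 => // r /andP[r1 r2]; apply: h => //.
  by rewrite /ball/= sub0r normrN gtr0_norm.
near=> r; apply: h; apply/andP; split; near: r; first exact: nbhs_right_gt.
exact: nbhs_right_lt.
Unshelve. all: end_near. Qed.

Lemma density_ratio_le E x r c : (0 < r)%R ->
  (density_ratio mu E x r <= c%:E) = (mu (E `&` ball x r) <= c%:E * mu (ball x r)).
Proof.
move=> r0; have := mu_ball_gt0 H x r0; rewrite /density_ratio.
rewrite -(fineK (mu_ball_fin_num H x r)) lte_fin => m0.
by rewrite inver gt_eqF// lee_pdivrMr.
Qed.

Lemma le_density_ratio E x r c : (0 < r)%R ->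
  (c%:E <= density_ratio mu E x r) = (c%:E * mu (ball x r) <= mu (E `&` ball x r)).
Proof.
move=> r0; have := mu_ball_gt0 H x r0; rewrite /density_ratio.
rewrite -(fineK (mu_ball_fin_num H x r)) lte_fin => m0.
by rewrite inver gt_eqF// lee_pdivlMr.
Qed.

Lemma density_ratio_ge0 E x r : (0 < r)%R -> 0 <= density_ratio mu E x r.
Proof. by move=> r0; rewrite (le_density_ratio E x 0%R r0) mul0e outer_measure_ge0. Qed.

Lemma zero_densityP E x : zero_density mu E x <-> sparse_at mu E x.
Proof.
split=> [h e e0|h].
  have /near0_rightP[r0 r00 hr] : \forall r \near 0%R^'+, density_ratio mu E x r < e%:E.
    exact: (cvg0_near_lt _ e0 h).
  exists r0 => // r rr; have /andP[r1 _] := rr.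
  by rewrite -density_ratio_le// ltW// hr.
apply: ge0_cvg0 => e e0; apply/near0_rightP; have [r0 r00 hr] := h e e0.
exists r0 => // r rr; have /andP[r1 _] := rr.
by rewrite density_ratio_ge0//= density_ratio_le// hr.
Qed.

Lemma upper_density_sparse E x : ~ 0 < upper_density mu E x -> sparse_at mu E x.
Proof.
move=> h e e0.
have : upper_density mu E x < e%:E.
  by apply: le_lt_trans (_ : 0 < _); [rewrite leNgt; apply/negP|rewrite lte_fin].
rewrite /upper_density limf_esupE => /ereal_inf_lt[_ [V nV <-]] hV.
have /near0_rightP[r0 r00 hr] : \forall r \near 0%R^'+, V r by [].
exists r0 => // r rr; have /andP[r1 _] := rr; rewrite -density_ratio_le//.
apply: le_trans (ltW hV); apply: ereal_sup_ubound; exists r => //; exact: hr.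
Qed.

Lemma lower_density_dense (c c' : R) E x : (c' < c)%R -> c%:E <= lower_density mu E x ->
  dense_at mu c' E x.
Proof.
move=> cc h.
have : c'%:E < lower_density mu E x by apply: lt_le_trans h; rewrite lte_fin.
rewrite /lower_density limf_einfE => /ereal_sup_gt[_ [V nV <-]] hV.
have /near0_rightP[r0 r00 hr] : \forall r \near 0%R^'+, V r by [].
exists r0 => // r rr; have /andP[r1 _] := rr; rewrite -le_density_ratio//.
apply: le_trans (ltW hV) _; apply: ereal_inf_lbound; exists r => //; exact: hr.
Qed.

Lemma sparse_setC_dense E x c : meas E -> (c < 1)%R -> sparse_at mu (~` E) x ->
  dense_at mu c E x.
Proof.
move=> mE c1 h; have [|r0 r00 hr] := h (1 - c)%R; first by rewrite subr_gt0.
exists r0 => // r /hr.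
have mB := measurable_ball H x r.
rewrite setIC -setDE => hd.
have eB := mu_setID (ball x r) mE;
have fB := mu_ball_fin_num H x r.
have f1 : mu (E `&` ball x r) \is a fin_num.
  by rewrite ge0_fin_numE ?outer_measure_ge0//; apply: (mu_bounded_fin H (x := x) (r := r)); exact: subIsetr.
have f2 : mu (ball x r `\` E) \is a fin_num.
  by rewrite ge0_fin_numE ?outer_measure_ge0//; apply: (mu_bounded_fin H (x := x) (r := r)); exact: subDsetl.
move: hd eB; rewrite -(fineK fB) -(fineK f1) -(fineK f2) -EFinD !lee_fin => hd -[eB].
by move: hd eB; clear -H; lra.
Qed.

Lemma dense_not_sparse E x c : (0 < c)%R -> dense_at mu c E x -> ~ sparse_at mu E x.
Proof.
move=> c0 [r0 r00 hr] h; have [|r1 r10 hr1] := h (c / 2)%R; first exact: divr_gt0.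
pose r := (Num.min r0 r1 / 2)%R.
have r_gt0 : (0 < r)%R by rewrite divr_gt0// lt_min r00.
have rr : (r < Num.min r0 r1)%R.
  by rewrite ltr_pdivrMr// ltr_pMr ?ltr1n// lt_min r00.
move: rr; rewrite lt_min => /andP[rr0 rr1].
have h1 := hr r; have h2 := hr1 r; rewrite r_gt0 rr0 in h1; rewrite r_gt0 rr1 in h2.
have := le_trans (h1 isT) (h2 isT).
have := mu_ball_gt0 H x r_gt0; rewrite -(fineK (mu_ball_fin_num H x r)) lte_fin !lee_fin => m0.
by rewrite ler_pM2r// => {}h1; move: h1 c0; clear -H; lra.
Qed.

Lemma sparse_sub A B x : A `<=` B -> sparse_at mu B x -> sparse_at mu A x.
Proof.
move=> AB h e /h[r0 r00 hr]; exists r0 => // r /hr; apply: le_trans.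
by apply: le_outer_measure; exact: setSI.
Qed.

Lemma sparseU A B x : sparse_at mu A x -> sparse_at mu B x -> sparse_at mu (A `|` B) x.
Proof.
move=> hA hB e e0; have [|r0 r00 h0] := hA (e / 2)%R; first exact: divr_gt0.
have [|r1 r10 h1] := hB (e / 2)%R; first exact: divr_gt0.
exists (Num.min r0 r1); first by rewrite lt_min r00.
move=> r /andP[r_gt0]; rewrite lt_min => /andP[rr0 rr1].
have := h0 r; have := h1 r; rewrite r_gt0 rr0 rr1 => /(_ isT) {}h1 /(_ isT) {}h0.
rewrite setIUl; apply: le_trans (outer_measureU2 mu _ _) _.
apply: le_trans (leeD h0 h1) _.
by rewrite -(fineK (mu_ball_fin_num H x r)) -!EFinM -EFinD lee_fin -mulrDl -splitr.
Qed.

Lemma sparse_set0 x : sparse_at mu set0 x.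
Proof.
move=> e e0; exists 1%R => // r _; rewrite set0I outer_measure0.
by rewrite mule_ge0 ?outer_measure_ge0// lee_fin ltW.
Qed.

(** Either [E] has upper density zero, or its complement does and [E] has density one, or [x] is in
    the measure theoretic boundary and the bound by [gamma] applies off a null set. A lower density
    of at least [gamma] yields a share [c] at all small radii only for [c < gamma]. *)
Lemma density_dichotomy (gamma M : R) E : boundary_density_bound mu gamma ->
  (gamma <= 1 / 2)%R -> meas E -> TV_le mu (fun y => (\1_E y)%:E) M ->
  exists2 N, codim1_Hausdorff mu N = 0 &
    forall x, ~ N x -> sparse_at mu E x \/ forall c, (c < gamma)%R -> dense_at mu c E x.
Proof.
move=> hg g2 mE tE.
have fpE : finite_perimeter mu E.
  split=> //; apply: le_lt_trans (_ : M%:E < _); last exact: ltry.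
  by apply: (total_variation_le H) => //; exact: measurable_indicE.
exists [set x | mt_boundary mu E x /\ ~ [/\ gamma%:E <= lower_density mu E x,
    lower_density mu E x <= upper_density mu E x & upper_density mu E x <= (1 - gamma)%:E]].
  exact: hg.
move=> x nx.
have [h|nE] := pselect (0 < upper_density mu E x); last by left; exact: upper_density_sparse.
right=> c cg; have [h'|nE'] := pselect (0 < upper_density mu (~` E) x); last first.
  apply: sparse_setC_dense => //; last exact: upper_density_sparse.
  by move: cg g2; clear -H; lra.
apply: (lower_density_dense cg); apply: contrapT => ng; apply: nx; split=> //.
by case.
Qed.

End density.

Lemma half_gap_lt (R : realFieldType) (a b : R) : a < b -> a + (b - a) / 2 < b.
Proof. by lra. Qed.

(** * Essential values and jump values *)

Section essential_values.
Context {R : realType} {X : completeMetricType R}.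
Context (mu : {outer_measure set X -> \bar R}) (Cd CP lambda : R).
Hypothesis H : PI_space mu Cd CP lambda.
Context (u : X -> \bar R) (x : X).
Implicit Types (r s t c v w : R) (A B E : set X).
Local Open Scope ereal_scope.
Local Notation sparse A := (sparse_at mu A x).

Definition essential_value v := forall e : R, (0 < e)%R ->
  ~ sparse [set y | (v - e)%:E < u y < (v + e)%:E].

Lemma essential_value_not_sparse v (a b : \bar R) A : essential_value v ->
  a < v%:E -> v%:E < b -> [set y | a < u y < b] `<=` A -> ~ sparse A.
Proof.
move=> ev av vb sA spA.
have [e1 e10 h1] : exists2 e : R, (0 < e)%R & a <= (v - e)%:E.
  case: a av {sA} => [a| |]// => [av|_]; last by exists 1%R; rewrite ?leNye.
  exists (v - a)%R; first by rewrite subr_gt0 -lte_fin.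
  by rewrite opprB addrC subrK.
have [e2 e20 h2] : exists2 e : R, (0 < e)%R & (v + e)%:E <= b.
  case: b vb {sA} => [b| |]// => [vb|_]; last by exists 1%R; rewrite ?leey.
  exists (b - v)%R; first by rewrite subr_gt0 -lte_fin.
  by rewrite addrC subrK.
apply: (ev (Num.min e1 e2)); first by rewrite lt_min e10.
apply: sparse_sub spA => y /andP[y1 y2]; apply: sA; apply/andP; split.
  by apply: le_lt_trans h1 (le_lt_trans _ y1); rewrite lee_fin lerD2l lerN2 ge_min lexx.
by apply: lt_le_trans (lt_le_trans y2 _) h2; rewrite lee_fin lerD2l ge_min lexx orbT.
Qed.

Lemma not_essential_sparse v : ~ essential_value v -> exists2 e : R, (0 < e)%R &
  sparse [set y | (v - e)%:E < u y < (v + e)%:E].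
Proof.
move=> nv; apply: contrapT => h; apply: nv => e e0 spe; apply: h; by exists e.
Qed.

(** Compactness of [[a, b]] in the form of a supremum argument: the slab over [[a, t]] is sparse for
    [t] up to some supremum, and the sparse window around this supremum carries sparsity past it
    unless it is [b]. *)
Lemma sparse_essential_free a b : (forall v, (a <= v <= b)%R -> ~ essential_value v) ->
  sparse [set y | a%:E <= u y <= b%:E].
Proof.
move=> free; have [ab|ba] := leP a b; last first.
  apply: sparse_sub (sparse_set0 mu x) => y /andP[y1 y2].
  by have := le_trans y1 y2; rewrite lee_fin leNgt ba.
pose F := [set t | (a <= t <= b)%R /\ sparse [set y | a%:E <= u y <= t%:E]].
have Fa : F a.
  split; first by rewrite lexx.
  have [e e0] : exists2 e : R, (0 < e)%R & sparse [set y | (a - e)%:E < u y < (a + e)%:E].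
    by apply: not_essential_sparse; apply: free; rewrite lexx.
  apply: sparse_sub => y /= /andP[y1 y2]; apply/andP; split.
    by apply: lt_le_trans y1; rewrite lte_fin gtrBl.
  by apply: le_lt_trans y2 _; rewrite lte_fin ltrDl.
have ubF : ubound F b by move=> t [/andP[]].
have hsF : has_sup F by split; [exists a|exists b].
have a_sup : (a <= sup F)%R by exact: sup_upper_bound.
have sup_b : (sup F <= b)%R by apply: ge_sup => //; exists a.
have [e e0 he] : exists2 e : R, (0 < e)%R &
    sparse [set y | (sup F - e)%:E < u y < (sup F + e)%:E].
  by apply: not_essential_sparse; apply: free; rewrite a_sup.
have [t [/andP[_ tb] spt] ht] := sup_adherent e0 hsF.
pose t' := Num.min b (sup F + e / 2)%R.
have t'e : (t' < sup F + e)%R by rewrite gt_min ltrD2l gtr_pMr// invf_lt1// ltr1n orbT.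
have Ft' : F t'.
  split; first by rewrite le_min ab ge_min lexx /= ler_wpDr// ltW// divr_gt0.
  apply: sparse_sub (sparseU H spt he) => y /= /andP[y1 y2].
  have [yt|ty] := leP (u y) t%:E; first by left; rewrite y1.
  right; apply/andP; split; first by apply: lt_trans ty; rewrite lte_fin.
  by apply: le_lt_trans y2 _; rewrite lte_fin.
have := sup_upper_bound hsF Ft'.
rewrite ge_min => /orP[bs|]; last first.
  by move=> h; exfalso; move: h e0; clear -H; lra.
have : t' = b.
  apply/min_idPl; apply: le_trans bs _; rewrite lerDl; exact: ltW (divr_gt0 _ _).
by move=> <-; case: Ft'.
Qed.

Context (T : R).
Hypothesis uT : sparse [set y | T%:E < u y].
Hypothesis uNT : sparse [set y | u y < (- T)%:E].

Lemma essential_value_bounded v : essential_value v -> (- T <= v <= T)%R.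
Proof.
move=> ev; apply/andP; split; rewrite leNgt; apply/negP => h.
  apply: (essential_value_not_sparse (a := -oo) (b := (- T)%:E) ev _ _ _ uNT).
  - exact: ltNyr.
  - by rewrite lte_fin.
  - by move=> y /andP[].
apply: (essential_value_not_sparse (a := T%:E) (b := +oo) ev _ _ _ uT).
- by rewrite lte_fin.
- exact: ltry.
- by move=> y /andP[].
Qed.

Lemma sparse_lt_essential t : (forall v, essential_value v -> (t < v)%R) ->
  sparse [set y | u y < t%:E].
Proof.
move=> ht; have free v : (- T <= v <= t)%R -> ~ essential_value v.
  by move=> /andP[_ vt] /ht; rewrite ltNge vt.
apply: sparse_sub (sparseU H uNT (sparse_essential_free free)) => y /= yt.
have [yT|yT] := ltP (u y) (- T)%:E; first by left.
by right; apply/andP; split=> //; exact: ltW.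
Qed.

Lemma sparse_gt_essential t : (forall v, essential_value v -> (v < t)%R) ->
  sparse [set y | t%:E < u y].
Proof.
move=> ht; have free v : (t <= v <= T)%R -> ~ essential_value v.
  by move=> /andP[vt _] /ht; rewrite ltNge vt.
apply: sparse_sub (sparseU H uT (sparse_essential_free free)) => y /= yt.
have [yT|yT] := ltP T%:E (u y); first by left.
by right; apply/andP; split=> //; exact: ltW.
Qed.

Lemma not_sparse_setT : ~ sparse setT.
Proof.
apply: (@dense_not_sparse _ _ _ _ _ _ H _ _ 1%R) => //.
by exists 1%R => // r _; rewrite mul1e setTI.
Qed.

Context (s : seq R).
Hypothesis s_sorted : sorted <%R s.
Hypothesis sP : forall v, essential_value v <-> v \in s.

(** Without essential values the slab over [[-T, T]] is sparse as well, and the whole space would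
    have density zero. *)
Lemma size_essential_values : (0 < size s)%N.
Proof.
have := sP; case: (s) => // h; exfalso; apply: not_sparse_setT.
have free v : (- T <= v <= T)%R -> ~ essential_value v by move=> _ /h.
apply: sparse_sub (sparseU H uT (sparseU H uNT (sparse_essential_free free))) => y _.
have [yT|yT] := ltP T%:E (u y); first by left.
have [yT'|yT'] := ltP (u y) (- T)%:E; first by right; left.
by right; right; rewrite /= yT yT'.
Qed.

Lemma nth_essential i : (i < size s)%N -> essential_value (nth 0%R s i).
Proof. by move=> im; apply/sP; exact: mem_nth. Qed.

Lemma essential_nth v : essential_value v -> exists2 i, (i < size s)%N & v = nth 0%R s i.
Proof. by move=> /sP/(nthP 0%R)[i im <-]; exists i. Qed.

Lemma lt_nth_essential i j : (i < size s)%N -> (j < size s)%N ->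
  (nth 0 s i < nth 0 s j)%R = (i < j)%N.
Proof. by move=> im jm; exact: (lt_sorted_ltn_nth 0%R s_sorted). Qed.

Lemma le_nth_essential i j : (i < size s)%N -> (j < size s)%N ->
  (nth 0 s i <= nth 0 s j)%R = (i <= j)%N.
Proof. by move=> im jm; rewrite leNgt lt_nth_essential// -leqNgt. Qed.

Lemma approx_liminf_essential : approx_liminf mu u x = (nth 0%R s 0)%:E.
Proof.
have m0 := size_essential_values; have e0 := nth_essential m0.
apply/eqP; rewrite eq_le; apply/andP; split.
  apply: ge_ereal_sup => t /= /(zero_densityP H) ht; rewrite leNgt; apply/negP => lt_t.
  apply: (essential_value_not_sparse (a := -oo) e0 _ lt_t _ ht); first exact: ltNyr.
  by move=> y /andP[].
apply/lee_subgt0Pr => e e_gt0; apply: ereal_sup_ubound => /=; apply/(zero_densityP H).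
apply: sparse_lt_essential => v /essential_nth[i im ->].
by rewrite ltrBlDr ltr_pwDr// le_nth_essential.
Qed.

Lemma approx_limsup_essential : approx_limsup mu u x = (nth 0%R s (size s).-1)%:E.
Proof.
have m0 := size_essential_values; have m1 : ((size s).-1 < size s)%N by rewrite prednK.
have e0 := nth_essential m1.
apply/eqP; rewrite eq_le; apply/andP; split.
  apply/lee_addgt0Pr => e e_gt0; apply: ereal_inf_lbound => /=; apply/(zero_densityP H).
  apply: sparse_gt_essential => v /essential_nth[i im ->].
  by rewrite ltr_pwDr// le_nth_essential// -ltnS prednK.
apply: le_ereal_inf_tmp => t /= /(zero_densityP H) ht; rewrite leNgt; apply/negP => lt_t.
apply: (essential_value_not_sparse (b := +oo) e0 lt_t _ _ ht); first exact: ltry.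
by move=> y /andP[].
Qed.

(** Between consecutive essential values no slab at positive distance from both ends contains one,
    hence it is sparse. A [t] beyond the next value fails the test with [delta] half the gap, since
    the open slab then contains that value. *)
Lemma next_jump_value_essential i : (i.+1 < size s)%N ->
  next_jump_value mu u x (nth 0%R s i)%:E = (nth 0%R s i.+1)%:E.
Proof.
move=> im; have im' := ltnW im; have m0 := size_essential_values.
have m1 : ((size s).-1 < size s)%N by rewrite prednK.
rewrite /next_jump_value approx_limsup_essential lte_fin lt_nth_essential//.
rewrite -[X in (_ < X)%N]/(_.-1) -ltnS prednK// im.
have e1 := nth_essential im.
have ii : (nth 0 s i < nth 0 s i.+1)%R by rewrite lt_nth_essential.
apply/eqP; rewrite eq_le; apply/andP; split.
  apply: ge_ereal_sup => t /= ht; rewrite leNgt; apply/negP => lt_t.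
  pose e := ((nth 0 s i.+1 - nth 0 s i) / 2)%R.
  have e_gt0 : (0 < e)%R by rewrite divr_gt0// subr_gt0.
  have /(zero_densityP H) := ht e e_gt0.
  apply: (essential_value_not_sparse (a := (nth 0 s i + e)%:E) e1 _ lt_t) => //.
  by rewrite lte_fin half_gap_lt.
apply/lee_subgt0Pr => e e_gt0; apply: ereal_sup_ubound => /= d d_gt0.
apply/(zero_densityP H).
have free v : (nth 0 s i + d <= v <= nth 0 s i.+1 - e)%R -> ~ essential_value v.
  move=> /andP[v1 v2] /essential_nth[j jm vj]; rewrite {}vj in v1 v2.
  have : (nth 0 s i < nth 0 s j)%R by apply: lt_le_trans v1; rewrite ltrDl.
  have : (nth 0 s j < nth 0 s i.+1)%R by apply: le_lt_trans v2 _; rewrite gtrBl.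
  by rewrite !lt_nth_essential// ltnS => ji ij; have := leq_trans ij ji; rewrite ltnn.
by apply: sparse_sub (sparse_essential_free free) => y /= /andP[y1 y2]; rewrite !ltW.
Qed.

(** With fewer than [n] essential values the iteration reaches the largest one and stays there,
    whence [minn]. The shift by one comes from numbering jump values from 1 and list entries from
    0. *)
Lemma jump_value_essential n l : (size s <= n)%N -> (0 < l <= n)%N ->
  jump_value mu u n l x = (nth 0%R s (minn l (size s)).-1)%:E.
Proof.
move=> mn /andP[l0 ln]; have m0 := size_essential_values; rewrite /jump_value.
case: eqP => [->|_]; first by rewrite approx_limsup_essential (minn_idPr mn).
case: l l0 ln => // l _ _ /=; elim: l => [|l IH] /=.
  by rewrite approx_liminf_essential (minn_idPl m0).
rewrite IH; have [lm|ml] := ltnP l.+1 (size s).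
  by rewrite (minn_idPl lm) next_jump_value_essential.
rewrite (minn_idPr (leqW ml)) /next_jump_value.
by rewrite approx_limsup_essential ltxx.
Qed.

End essential_values.

Lemma separated_seq (R : realFieldType) (s : seq R) : exists2 e : R, 0 < e &
  forall a b, a \in s -> b \in s -> a != b -> e <= `|a - b|.
Proof.
elim: s => [|a s [e e0 he]]; first by exists 1.
have [e' e'0 he'] : exists2 e' : R, 0 < e' & forall b, b \in s -> a != b -> e' <= `|a - b|.
  elim: s {e0 he} => [|b s [e' e'0 he']]; first by exists 1.
  have [<-|ab] := eqVneq a b.
    by exists e' => // c; rewrite inE => /predU1P[->|/he']; rewrite ?eqxx.
  exists (Num.min e' `|a - b|); first by rewrite lt_min e'0 normr_gt0 subr_eq0.
  move=> c; rewrite inE => /predU1P[->|cs] ac; rewrite ge_min ?lexx ?orbT//.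
  by rewrite he'.
exists (Num.min e e'); first by rewrite lt_min e0.
move=> b c; rewrite !inE => /predU1P[->|bs] /predU1P[->|cs] bc; rewrite ge_min.
- by rewrite eqxx in bc.
- by rewrite he' ?orbT.
- by rewrite distrC he' ?orbT// eq_sym.
- by rewrite he.
Qed.

Lemma sorted_enumeration (R : realType) (S : set R) (n : nat) :
  (forall s, uniq s -> (forall v, v \in s -> S v) -> (size s <= n)%N) ->
  exists s, [/\ sorted <%R s, forall v, S v <-> v \in s & (size s <= n)%N].
Proof.
move=> hS; have finS : finite_set S.
  apply: contrapT => infS; have [B BS nB] := infinite_set_fset n.+1 infS.
  by have := hS _ (fset_uniq B) (fun v vB => BS v vB); rewrite leqNgt nB.
have us : uniq (sort <=%R (enum_fset (fset_set S))) by rewrite sort_uniq; exact: fset_uniq.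
have memS v : S v <-> v \in sort <=%R (enum_fset (fset_set S)).
  rewrite mem_sort; have e : (v \in fset_set S) = (v \in S) := in_fset_set finS v.
  by rewrite -[v \in enum_fset _]/(v \in fset_set S) e; split; [exact: mem_set|exact: set_mem].
exists (sort <=%R (enum_fset (fset_set S))); split=> //.
  by rewrite sort_lt_sorted; exact: fset_uniq.
by apply: hS => // v /memS.
Qed.

(** * Exceptional sets and quasi-semicontinuity *)

Section level_sets.
Context {R : realType} {X : completeMetricType R}.
Context (mu : {outer_measure set X -> \bar R}) (Cd CP lambda : R).
Hypothesis H : PI_space mu Cd CP lambda.
Implicit Types (x y z : X) (r s t c v w : R) (A B E Y N : set X) (u : X -> \bar R).
Local Open Scope ereal_scope.
Local Notation int := (mu_int mu).
Local Notation meas := (mu_measurable mu).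
Local Notation mfun := (mu_measurable_fun mu setT).

Lemma dense_disjoint_size (T : choiceType) (s : seq T) (A : T -> set X) x c :
  (0 < c)%R -> uniq s -> (forall i, meas (A i)) -> trivIset [set` s] A ->
  (forall i, i \in s -> dense_at mu c (A i) x) -> ((size s)%:R * c <= 1)%R.
Proof.
move=> c0 us mA tA dA.
have [r0 r00 hr] : exists2 r0, (0 < r0)%R & forall r, (0 < r < r0)%R ->
    forall i, i \in s -> c%:E * mu (ball x r) <= mu (A i `&` ball x r).
  elim: s {us tA} dA => [|i s IH] dA; first by exists 1%R.
  have [|r0 r00 h0] := IH; first by move=> j js; apply: dA; rewrite inE js orbT.
  have [r1 r10 h1] := dA i (mem_head _ _).
  exists (Num.min r0 r1); first by rewrite lt_min r00.
  move=> r /andP[r_gt0]; rewrite lt_min => /andP[rr0 rr1] j.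
  by rewrite inE => /predU1P[->|js]; [apply: h1|apply: h0]; rewrite ?r_gt0.
pose r := (r0 / 2)%R; have r_gt0 : (0 < r)%R by rewrite divr_gt0.
have rr0 : (r < r0)%R by rewrite ltr_pdivrMr// ltr_pMr// ltr1n.
have hi := hr r; rewrite r_gt0 rr0 in hi; have {}hi := hi isT.
have mB := measurable_ball H x r.
have : \sum_(i <- s) mu (A i `&` ball x r) <= mu (ball x r).
  apply: mu_disjoint_sum => //.
  - by move=> i; exact: measI.
  - exact: trivIset_setIr.
move: (mu_ball_gt0 H x r_gt0) hi; rewrite -(fineK (mu_ball_fin_num H x r)).
rewrite lte_fin => m0 hi h.
have : (size s)%:R%:E * (c%:E * (fine (mu (ball x r)))%:E) <= (fine (mu (ball x r)))%:E.
  apply: le_trans h; rewrite -sume_cst; last by rewrite -EFinM lee_fin mulr_ge0// ltW.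
  by rewrite big_seq [leRHS]big_seq; apply: lee_sum.
by rewrite -!EFinM lee_fin mulrA -[leRHS]mul1r ler_pM2r.
Qed.

Lemma level_sequence u (M : R) : mfun u -> TV_le mu u M ->
  exists2 d : nat -> R, (forall a b, (a < b)%R -> exists j, (a < d j < b)%R) &
    forall j, exists K, TV_le mu (fun y => (\1_(superlevel u (d j)) y)%:E) K.
Proof.
move=> mu_ tu.
have lev (a b : R) : (a < b)%R -> exists t, (a <= t < b)%R /\
    exists K, TV_le mu (fun y => (\1_(superlevel u t) y)%:E) K.
  move=> ab; have tab : TV_le mu (fun y => (clampE a b (u y))%:E) M.
    by apply: (TV_le_clampE H mu_) => //; apply: measurable_clampE => //; exact: ltW.
  have [|t ht tt] := TV_le_superlevel H (K := ((M + 1) / (b - a))%R) mu_ ab tab.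
    by rewrite divfK ?subr_eq0 ?gt_eqF// ltrDl.
  by exists t; split=> //; exists ((M + 1) / (b - a))%R.
have /choice[d hd] (j : nat) : exists t,
    (forall q : rat * rat, choice.pickle q = j -> (ratr q.1 < ratr q.2 :> R)%R ->
       (ratr q.1 <= t < ratr q.2)%R) /\
    exists K, TV_le mu (fun y => (\1_(superlevel u t) y)%:E) K.
  have [[q [qj qq]]|nq] := pselect (exists q : rat * rat, choice.pickle q = j /\ (ratr q.1 < ratr q.2 :> R)%R).
    have [t [ht tt]] := lev _ _ qq; exists t; split=> // q' q'j _.
    by rewrite (_ : q' = q)//; apply: (pcan_inj choice.pickleK); rewrite q'j.
  have [t [_ tt]] := lev 0%R 1%R ltr01; exists t; split=> // q qj qq.
  by exfalso; apply: nq; exists q.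
exists d => [a b ab|j]; last by have [] := hd j.
have [q] := rat_in_itvoo ab; rewrite in_itv/= => /andP[aq qb].
have [q'] := rat_in_itvoo qb; rewrite in_itv/= => /andP[qq' q'b].
exists (choice.pickle (q, q')); have [/(_ (q, q') erefl qq')/= /andP[h1 h2] _] := hd (choice.pickle (q, q')).
by rewrite (lt_le_trans aq h1) (lt_trans h2 q'b).
Qed.

Lemma essential_size u x (d : nat -> R) c n : mfun u -> (0 < c)%R -> (1 < n.+1%:R * c)%R ->
  (forall a b, (a < b)%R -> exists j, (a < d j < b)%R) ->
  (forall j k, sparse_at mu (superlevel u (d j) `\` superlevel u (d k)) x \/
     dense_at mu c (superlevel u (d j) `\` superlevel u (d k)) x) ->
  forall s : seq R, uniq s -> (forall v, v \in s -> essential_value mu u x v) ->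
  (size s <= n)%N.
Proof.
move=> mu_ c0 nc hd hx s us sS; rewrite leqNgt; apply/negP => ns.
(* Slabs within [e / 2] of values at mutual distance at least [e] are disjoint. *)
have [e e0 he] := separated_seq s; have e20 : (0 < e / 2)%R by rewrite divr_gt0.
have /choice[j hj] v : exists j, (v - e / 2 < d j < v)%R by apply: hd; rewrite gtrBl.
have /choice[k hk] v : exists k, (v < d k < v + e / 2)%R by apply: hd; rewrite ltrDl.
pose A v := superlevel u (d (j v)) `\` superlevel u (d (k v)).
have mS t : meas (superlevel u t) by exact: measurable_superlevel.
have AE v y : A v y -> (d (j v))%:E < u y <= (d (k v))%:E.
  by move=> [/= -> /negP]; rewrite -leNgt.
have : ((size s)%:R * c <= 1)%R.
  apply: (@dense_disjoint_size _ s A x) => //.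
  - by move=> v; exact: measD.
  - apply/trivIsetP => a b /= sa sb ab; apply/seteqP; split=> // y [/AE Ay /AE By].
    have := he _ _ sa sb ab; apply/negP; rewrite -ltNge.
    have /andP[a1 a2] := hj a; have /andP[a3 a4] := hk a.
    have /andP[b1 b2] := hj b; have /andP[b3 b4] := hk b.
    move: Ay By; case: (u y) => [q| |]; rewrite ?lte_fin ?lee_fin ?andbF//.
    move=> /andP[q1 q2] /andP[q3 q4]; rewrite ltr_norml; apply/andP; split;
      move: a1 a4 b1 b4 q1 q2 q3 q4; clear -H; lra.
  - move=> v vs; have [spA|//] := hx (j v) (k v); exfalso.
    have /andP[a1 a2] := hj v; have /andP[a3 a4] := hk v.
    apply: (essential_value_not_sparse (a := (d (j v))%:E) (b := (d (k v))%:E) (sS v vs) _ _ _ spA).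
    + by rewrite lte_fin.
    + by rewrite lte_fin.
    + move=> y /andP[y1 y2]; split=> //=; apply/negP; rewrite -leNgt; exact: ltW.
apply/negP; rewrite -ltNge; apply: lt_le_trans nc _.
by rewrite ler_pM2r// ler_nat.
Qed.

End level_sets.

Section exceptional_sets.
Context {R : realType} {X : completeMetricType R}.
Context (mu : {outer_measure set X -> \bar R}) (Cd CP lambda : R).
Hypothesis H : PI_space mu Cd CP lambda.
Context (gamma : R).
Hypothesis gamma_gt0 : (0 < gamma)%R.
Hypothesis gamma_le : (gamma <= 1 / 2)%R.
Hypothesis gamma_density : boundary_density_bound mu gamma.
Implicit Types (x y z : X) (r s t c v w : R) (A B E Y N : set X) (u : X -> \bar R).
Local Open Scope ereal_scope.
Local Notation int := (mu_int mu).
Local Notation meas := (mu_measurable mu).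
Local Notation mfun := (mu_measurable_fun mu setT).

(** [Q i] is not assumed to pass to larger sets, so each [i] keeps its own [Y'] inside the union. *)
Lemma cover_le_countable (I : countType) (Q : I -> set X -> Prop) (e : R) :
  (0 < e)%R -> (forall i (d : R), (0 < d)%R -> exists2 Y, cover_le mu Y d & Q i Y) ->
  exists2 Y, cover_le mu Y e & forall i, exists2 Y', Y' `<=` Y & Q i Y'.
Proof.
move=> e0 hQ.
have /choice[Y hY] (n : nat) : exists Y, cover_le mu Y (e / (2 ^ n.+1)%:R) /\
    forall i, choice.pickle i = n -> Q i Y.
  have en0 : (0 < e / (2 ^ n.+1)%:R)%R by rewrite divr_gt0// ltr0n expn_gt0.
  have [[i iE]|ni] := pselect (exists i : I, choice.pickle i = n).
    have [Y cY QY] := hQ i _ en0; exists Y; split=> // j jE.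
    by rewrite (_ : j = i)//; apply: (pcan_inj choice.pickleK); rewrite jE.
  exists set0; split; first by apply: cover_le_set0; exact: ltW.
  by move=> i iE; exfalso; apply: ni; exists i.
exists (\bigcup_n Y n).
  by apply: cover_le_bigcup; [exact: ltW|move=> n; have [] := hY n].
move=> i; exists (Y (choice.pickle i)); first by move=> y Yy; exists (choice.pickle i).
by have [_] := hY (choice.pickle i); apply.
Qed.

(** The first bound is what [crossing_radius] asks for; the second lets the dichotomy produce points
    of density [c]. *)
Lemma exists_small_density : exists2 c : R, (0 < c)%R & (Cd * c <= 1 / 2)%R /\ (c < gamma)%R.
Proof.
have Cd1 := PI_Cd_ge1 H; have Cd0 : (0 < Cd)%R by apply: lt_le_trans Cd1.
exists (Num.min (gamma / 2) (1 / (2 * Cd)))%R.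
  by rewrite lt_min !divr_gt0// mulr_gt0.
split.
  apply: (@le_trans _ _ (Cd * (1 / (2 * Cd)))%R).
    by rewrite ler_pM2l// ge_min lexx orbT.
  by rewrite !div1r invfM mulrCA divff ?gt_eqF// mulr1.
by rewrite gt_min ltr_pdivrMr// ltr_pMr// ltr1n.
Qed.

(** The second clause says that off [Y] the points of density zero form a relatively open set; the
    first turns a failure of sparsity into a density bound uniform in the point. *)
Definition quasi_continuous_off Y E :=
  (forall x, ~ Y x -> sparse_at mu E x \/ forall c, (c < gamma)%R -> dense_at mu c E x) /\
  forall x, ~ Y x -> sparse_at mu E x ->
    exists2 r, (0 < r)%R & forall y, ball x r y -> ~ Y y -> sparse_at mu E y.

Lemma quasi_continuous_indic E (M e : R) : meas E -> TV_le mu (fun y => (\1_E y)%:E) M ->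
  (0 < e)%R -> exists2 Y, cover_le mu Y e & quasi_continuous_off Y E.
Proof.
move=> mE tE e0; have [c c0 [Cdc cg]] := exists_small_density.
have e20 : (0 < e / 2)%R by rewrite divr_gt0.
have [N hN dN] := density_dichotomy H gamma_density gamma_le mE tE.
have [Y cY hY] := quasi_open H c0 Cdc mE tE e20.
exists (N `|` Y).
  by rewrite [e]splitr; apply: cover_leU => //; exact: cover_le_codim1_Hausdorff.
split=> [x nx|x _ /hY[r r0 hr]]; first by apply: dN => Nx; apply: nx; left.
exists r => // y xy ny.
have [|//|dy] := dN y; first by move=> Ny; apply: ny; left.
by exfalso; apply: ny; right; apply: (hr y xy); exact: dy.
Qed.

Lemma quasi_continuous_off_sub Y Y' E : Y' `<=` Y -> quasi_continuous_off Y' E ->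
  quasi_continuous_off Y E.
Proof.
move=> YY [h1 h2]; split=> [x nx|x nx spx]; first by apply: h1 => /YY.
have [|r r0 hr] := h2 x _ spx; first by move=> /YY.
by exists r => // y xy ny; apply: hr => // /YY.
Qed.

Lemma superlevel_sparse_off u (M e : R) : mfun u -> int setT (fun x => `|u x|) < +oo ->
  TV_le mu u M -> (0 < e)%R -> exists T : R, exists2 Y, cover_le mu Y e &
    forall x, ~ Y x -> sparse_at mu (superlevel u T) x.
Proof.
move=> mu_ iu tu e0; have [c c0 [Cdc cg]] := exists_small_density.
have e20 : (0 < e / 2)%R by rewrite divr_gt0.
have [t [M' [t0 tt ct]]] := quasi_bounded H c0 Cdc mu_ iu tu e20.
have [N hN dN] := density_dichotomy H gamma_density gamma_le (measurable_superlevel t mu_) tt.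
exists t, (N `|` [set y | dense_at mu c (superlevel u t) y]).
  by rewrite [e]splitr; apply: cover_leU => //; exact: cover_le_codim1_Hausdorff.
move=> x nx; have [|//|dx] := dN x; first by move=> Nx; apply: nx; left.
by exfalso; apply: nx; right; exact: dx.
Qed.

Lemma bounded_sparse_off u (M e : R) : mfun u -> int setT (fun x => `|u x|) < +oo ->
  TV_le mu u M -> (0 < e)%R -> exists T : R, exists2 Y, cover_le mu Y e &
    forall x, ~ Y x -> sparse_at mu [set y | T%:E < u y] x /\
      sparse_at mu [set y | u y < (- T)%:E] x.
Proof.
move=> mu_ iu tu e0; have e20 : (0 < e / 2)%R by rewrite divr_gt0.
have [T [Y cY hY]] := superlevel_sparse_off mu_ iu tu e20.
have mN : mfun (fun x => - u x) by apply: measurableT_comp => //; exact: oppe_measurable.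
have iN : int setT (fun x => `|- u x|) < +oo.
  by rewrite (_ : int _ _ = int setT (fun x => `|u x|))//; apply: int_eq => x _; rewrite abseN.
have [T' [Y' cY' hY']] := superlevel_sparse_off mN iN (TV_leN mu_ tu) e20.
exists (Num.max T T'), (Y `|` Y'); first by rewrite [e]splitr; exact: cover_leU.
move=> x nx; split.
  apply: sparse_sub (hY x _) => [y /=|Yx]; last by apply: nx; left.
  by apply: le_lt_trans; rewrite lee_fin le_max lexx.
apply: sparse_sub (hY' x _) => [y /=|Yx]; last by apply: nx; right.
move=> uy; rewrite /superlevel/= lteNr; apply: lt_le_trans uy _.
by rewrite lee_fin lerN2 le_max lexx orbT.
Qed.

End exceptional_sets.

(** * Upper semicontinuity of the set of essential values *)

Section quasi_semicontinuity.
Context {R : realType} {X : completeMetricType R}.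
Context (mu : {outer_measure set X -> \bar R}) (Cd CP lambda : R).
Hypothesis H : PI_space mu Cd CP lambda.
Context (u : X -> \bar R) (d : nat -> R) (T : R) (Y : set X).
Implicit Types (x y : X).
Local Open Scope ereal_scope.
Hypothesis d_dense : forall a b : R, (a < b)%R -> exists j, (a < d j < b)%R.
Hypothesis uT : forall x, ~ Y x -> sparse_at mu [set y | T%:E < u y] x.
Hypothesis uNT : forall x, ~ Y x -> sparse_at mu [set y | u y < (- T)%:E] x.
Hypothesis slab_sparse : forall j k x, ~ Y x ->
  sparse_at mu (superlevel u (d j) `\` superlevel u (d k)) x ->
  exists2 r, (0 < r)%R & forall y, ball x r y -> ~ Y y ->
    sparse_at mu (superlevel u (d j) `\` superlevel u (d k)) y.

(** An essential value at [y] lies in the interior of one of finitely many slabs, which is then not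
    sparse at [y]. For [y] close to [x] the slab is not sparse at [x] either, so it contains an
    essential value at [x] up to closing it; the slabs are shorter than [e]. *)
Lemma essential_value_usc x (e : R) : ~ Y x -> (0 < e)%R ->
  exists2 r, (0 < r)%R & forall y, ball x r y -> ~ Y y ->
    forall w, essential_value mu u y w -> exists2 v, essential_value mu u x v & (`|w - v| < e)%R.
Proof.
move=> nx e0; pose h := (e / 4)%R; have h0 : (0 < h)%R by rewrite divr_gt0.
(* A grid of step [h = e / 4] from [2 * h] below [-T], so that every essential value lies above
   [p 1] and a level below it is available. The slab with index [i] has its levels between [p i] and
   [p i.+3], hence length below [3 * h < e]. *)
pose p (i : nat) := (- T - 2 * h + i%:R * h)%R.
have /choice[j hj] i : exists j, (p i < d j < p i.+1)%R.
  by apply: d_dense; rewrite ltrD2l ltr_pM2r// ltr_nat.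
pose N := (Num.truncn ((2 * T + 2 * h) / h)).+1.
(* The slabs overlap, so that every value lies in the interior of one of them. *)
pose A i := superlevel u (d (j i)) `\` superlevel u (d (j i.+2)).
have : \forall r \near 0%R^'+, forall i : 'I_N, sparse_at mu (A i) x ->
    forall y, ball x r y -> ~ Y y -> sparse_at mu (A i) y.
  apply: filter_forall => i; apply/near0_rightP.
  have [spx|nspx] := pselect (sparse_at mu (A i) x); last by exists 1%R.
  have [r0 r00 hr] := slab_sparse nx spx; exists r0 => // r /andP[_ rr0] _ y xy.
  by apply: hr; apply: le_ball xy; exact: ltW.
move=> /near0_rightP[r0 r00 hr]; exists (r0 / 2)%R; first by rewrite divr_gt0.
have {}hr := hr (r0 / 2)%R; rewrite divr_gt0// ltr_pdivrMr// ltr_pMr// ltr1n in hr.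
move=> y xy ny w ew.
have /andP[w1 w2] := essential_value_bounded (uT ny) (uNT ny) ew.
pose m := Num.truncn ((w - (- T - 2 * h)) / h).
have /andP[m1 m2] : (m%:R <= (w - (- T - 2 * h)) / h < m.+1%:R)%R.
  by apply: truncn_itv; rewrite divr_ge0 ?ltW//; move: w1 h0; clear -H d_dense uT uNT slab_sparse; lra.
have m0 : (0 < m)%N.
  rewrite lt0n; apply/eqP => m_eq0; move: m2; rewrite m_eq0 ltr_pdivrMr// mul1r.
  by move: w1 h0; clear -H d_dense uT uNT slab_sparse; lra.
pose i := m.-1; have im : i.+1 = m by rewrite prednK.
have iN : (i < N)%N.
  rewrite -ltnS im ltnS; apply: leqW; apply: le_truncn.
  by rewrite ler_pM2r ?invr_gt0//; move: w2; clear -H d_dense uT uNT slab_sparse; lra.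
have /andP[j1 j2] := hj i; have /andP[j3 j4] := hj i.+2.
have wp : (p i.+1 <= w)%R.
  by move: m1; rewrite /p im ler_pdivlMr//; clear -H d_dense uT uNT slab_sparse; lra.
have pw : (w < p i.+2)%R.
  by move: m2; rewrite /p im ltr_pdivrMr//; clear -H d_dense uT uNT slab_sparse; lra.
have nsA : ~ sparse_at mu (A i) y.
  apply: (essential_value_not_sparse (a := (d (j i))%:E) (b := (d (j i.+2))%:E) ew).
  - by rewrite lte_fin (lt_le_trans j2).
  - by rewrite lte_fin (lt_trans pw).
  - by move=> z /andP[z1 z2]; split=> //=; apply/negP; rewrite -leNgt; exact: ltW.
have nsx : ~ sparse_at mu (A i) x.
  by move=> spx; apply: nsA; apply: (hr isT (Ordinal iN) spx y xy ny).
apply: contrapT => nv; apply: nsx.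
have free v : (d (j i) <= v <= d (j i.+2))%R -> ~ essential_value mu u x v.
  move=> /andP[v1 v2] ev; apply: nv; exists v => //.
  have p1 : p i.+1 = (p i + h)%R by rewrite /p -natr1; clear -H d_dense uT uNT slab_sparse; lra.
  have p2 : p i.+2 = (p i.+1 + h)%R by rewrite /p -[i.+2%:R]natr1; clear -H d_dense uT uNT slab_sparse; lra.
  have p3 : p i.+3 = (p i.+2 + h)%R by rewrite /p -[i.+3%:R]natr1; clear -H d_dense uT uNT slab_sparse; lra.
  have he : (e = 4 * h)%R by rewrite /h mulrC divfK.
  rewrite ltr_norml; apply/andP; split;
    move: p1 p2 p3 he v1 v2 wp pw j1 j4 h0; clear -H d_dense uT uNT slab_sparse; lra.
apply: sparse_sub (sparse_essential_free H free) => z [/= z1 /negP].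
by rewrite -leNgt => z2; rewrite z2 ltW.
Qed.

End quasi_semicontinuity.

Lemma bigmine_le (R : realType) (s : seq nat) (F : nat -> \bar R) i : i \in s ->
  (\big[mine/+oo]_(j <- s) F j <= F i)%E.
Proof.
elim: s => [//|j s IH]; rewrite inE big_cons ge_min => /predU1P[->|/IH ->].
  by rewrite lexx.
by rewrite orbT.
Qed.

Theorem theorem1p1 (R : realType) (X : completeMetricType R)
    (mu : {outer_measure set X -> \bar R}) (Cd CP lambda gamma : R)
    (mu_reg : Borel_regular mu)
    (Cd_ge1 : 1 <= Cd) (mu_doubling : doubling mu Cd)
    (CP_gt0 : 0 < CP) (lambda_ge1 : 1 <= lambda)
    (mu_Poincare : Poincare mu CP lambda)
    (gamma_gt0 : 0 < gamma) (gamma_le : gamma <= 1 / 2)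
    (gamma_density : boundary_density_bound mu gamma)
    (u : X -> \bar R) (u_BV : BV mu u) (eps : R) (eps_gt0 : 0 < eps) :
  let n := Num.truncn (1 / gamma) in
  exists G : set X,
    [/\ open G, (Cap1 mu G < eps%:E)%E &
        forall (y : nat -> X) (x : X),
          (forall k, ~ G (y k)) -> ~ G x -> y k @[k --> \oo] --> x ->
          forall l1 : nat, (1 <= l1 <= n)%N ->
            (\big[mine/+oo]_(1 <= l2 < n.+1)
               `|jump_value mu u n l1 (y k) - jump_value mu u n l2 x|)%E
              @[k --> \oo] --> 0%E].
Proof.
move=> n; have H : PI_space mu Cd CP lambda by split.
have [/integrableP[mu_ iu] tvu] := u_BV.
have [M tu] : exists M : R, TV_le mu u M.
  case E: (Defs.total_variation mu u) tvu => [M| |]// _; [exists M|exists 0];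
    by apply: (TV_le_of_total_variation H); rewrite E ?leNye.
have [C C0 hC] := capacity_cover H.
(* Two exceptional sets of content [e] have capacity at most [C * (e + e) = eps / 2]. *)
pose e := eps / (2 * C) / 2; have e0 : 0 < e by rewrite !divr_gt0// mulr_gt0.
have [d d_dense tVd] := level_sequence H mu_ tu.
have [T [Y1 cY1 hY1]] := bounded_sparse_off H gamma_gt0 gamma_le gamma_density mu_ iu tu e0.
pose A (i : nat * nat) := superlevel u (d i.1) `\` superlevel u (d i.2).
have [Y2 cY2 hY2] : exists2 Y, cover_le mu Y e &
    forall i, exists2 Y', Y' `<=` Y & quasi_continuous_off mu gamma Y' (A i).
  apply: (cover_le_countable (Q := fun i Y => quasi_continuous_off mu gamma Y (A i))) => //.
  move=> [j k] r r0; have [K1 tK1] := tVd j; have [K2 tK2] := tVd k.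
  have mS t : mu_measurable mu (superlevel u t) by exact: measurable_superlevel.
  apply: (quasi_continuous_indic H gamma_gt0 gamma_le gamma_density (M := K1 + K2)) => //.
    exact: measD.
  exact: (TV_le_setD H).
pose Y := Y1 `|` Y2.
have [G [oG YG cG]] := hC _ _ (cover_leU cY1 cY2).
exists G; split=> //.
  apply: le_lt_trans cG _; rewrite lte_fin -splitr -[ltRHS](divfK (x := 2 * C)) ?gt_eqF ?mulr_gt0//.
  rewrite mulrC ltr_pM2l ?divr_gt0 ?mulr_gt0//.
  by rewrite ltr_pMl// ltr1n.
have uT x : ~ G x -> sparse_at mu [set y | (T%:E < u y)%E] x.
  by move=> nx; have [|//] := hY1 x; move=> Yx; apply: nx; apply: YG; left.
have uNT x : ~ G x -> sparse_at mu [set y | (u y < (- T)%:E)%E] x.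
  by move=> nx; have [|//] := hY1 x; move=> Yx; apply: nx; apply: YG; left.
have qc i : quasi_continuous_off mu gamma G (A i).
  have [Y' YY] := hY2 i; apply: quasi_continuous_off_sub => z Y'z.
  by apply: YG; right; exact: YY.
(* Below [gamma], so the dichotomy gives density [c]; above [1 / (n + 1)], so [n + 1] disjoint slabs
   cannot all have it. *)
pose c := (n.+1%:R^-1 + gamma) / 2.
have ng : n.+1%:R^-1 < gamma.
  by rewrite -[ltRHS]invrK ltf_pV2 ?posrE ?invr_gt0// -div1r truncnS_gt.
have [nc cg] : n.+1%:R^-1 < c /\ c < gamma by split; have := midf_lt ng => -[].
have c0 : 0 < c by apply: lt_trans nc; rewrite invr_gt0.
have enum x : ~ G x -> exists s : seq R, [/\ sorted <%R s,
    forall v, essential_value mu u x v <-> v \in s & (size s <= n)%N].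
  move=> nx; apply: sorted_enumeration; apply: (essential_size H (d := d) (c := c)) => //.
    by rewrite mulrC -ltr_pdivrMr// div1r.
  by move=> j k; have [/(_ x nx)[|/(_ c cg)]] := qc (j, k); [left|right].
move=> y x ny nx yx l1 l1n; apply: ge0_cvg0 => r r0.
have [r1 r10 hr] : exists2 r1, 0 < r1 & forall z, ball x r1 z -> ~ G z ->
    forall w, essential_value mu u z w ->
    exists2 v, essential_value mu u x v & `|w - v| < r.
  apply: (essential_value_usc H d_dense uT uNT) => // j k z nz.
  by have [_] := qc (j, k); apply.
have [s [s_sorted sP sn]] := enum x nx.
have : \forall k \near \oo, ball x r1 (y k) by apply: yx; exact: nbhsx_ballx.
apply: filterS => k xyk; apply/andP; split.
  elim/big_ind: _ => [|a b a0 b0|i _]; rewrite ?leey// ?abse_ge0//.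
  by rewrite le_min a0.
have [s' [s'_sorted s'P s'n]] := enum (y k) (ny k).
have m0' := size_essential_values H (uT _ (ny k)) (uNT _ (ny k)) s'P.
rewrite (jump_value_essential H (uT _ (ny k)) (uNT _ (ny k)) s'_sorted s'P s'n l1n).
(* The jump value with index [l1] at [y k] is an essential value there, so some essential value [v]
   at [x] is within [r] of it. Being entry [i] of the list at [x], [v] is the jump value with index
   [l2 = i.+1]. *)
have [|v ev wv] := hr (y k) xyk (ny k) (nth 0 s' (minn l1 (size s')).-1).
  apply/s'P; apply: mem_nth; rewrite prednK ?geq_minr//.
  by rewrite leq_min m0' andbT; case/andP: l1n.
have [i im vi] := essential_nth sP ev.
have in1 : (0 < i.+1 <= n)%N by rewrite (leq_trans im sn).
apply: le_trans (bigmine_le _ (i := i.+1) _) _.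
  by rewrite mem_index_iota ltnS.
rewrite (jump_value_essential H (uT _ nx) (uNT _ nx) s_sorted sP sn in1).
by rewrite (minn_idPl im) /= -vi lee_fin ltW.
Qed.
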